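(* Let $E$ and $F$ be infinite dimensional Banach spaces over $\mathbb{K}$ and let $n\in\mathbb{N}$. If $\mathcal{P}_{K}(^{n}E;F)$ contains an isomorphic copy of $c_{0}$, then $\mathcal{P}_{K}(^{n}E;F)$ is not complemented in $\mathcal{P}(^{n}E;F)$.
   Context: $\mathbb{K}$ is $\mathbb{R}$ or $\mathbb{C}$. For Banach spaces $E,F$ over $\mathbb{K}$ and $n\in\mathbb{N}=\{1,2,\dots\}$, $\mathcal{P}(^{n}E;F)$ is the Banach space of all continuous $n$-homogeneous polynomials from $E$ into $F$, with norm $\|P\|=\sup_{\|x\|\le 1}\|P(x)\|$. $\mathcal{P}_{K}(^{n}E;F)$ is the subspace of all $P\in\mathcal{P}(^{n}E;F)$ which map bounded sets to relatively compact sets. A Banach space $X$ contains a (isomorphic) copy of $Y$ if some closed subspace of $X$ is linearly homeomorphic to $Y$. A subspace is complemented if it is the range of a bounded linear projection of the whole space. *)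

(* Defs.v *)
From HB Require Import structures.
From mathcomp Require Import all_boot all_order all_algebra.
From mathcomp Require Import complex.
From mathcomp Require Import all_classical all_reals all_analysis.

Set Implicit Arguments.
Unset Strict Implicit.
Unset Printing Implicit Defensive.

Import Order.TTheory GRing.Theory Num.Theory.
Import numFieldNormedType.Exports.

Local Open Scope classical_set_scope.
Local Open Scope ring_scope.

Variant real_or_complex (R : realType) : numFieldType -> Prop :=
| scalars_real : real_or_complex R R
| scalars_complex : real_or_complex R R[i].

Definition finite_dimensional (K : numFieldType) (E : lmodType K) : Prop :=
  exists (m : nat) (e : 'I_m -> E),
    forall x : E, exists a : 'I_m -> K, x = \sum_(i < m) a i *: e i.

(* The values `|f x| lie in K, so the supremum is taken for the order of K;
   for K = R[i] only numbers with equal imaginary parts are comparable, hence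
   upper bounds of a nonempty set of real numbers are real. *)
Definition sup_norm (K : numFieldType) (V : normedModType K) (T : Type)
  (D : set T) (f : T -> V) : K := supremum 0 [set `|f x| | x in D].

Section sup_norm_theory.
Variables (R : realType) (K : numFieldType) (hK : real_or_complex R K).

Lemma scalar_supremums (A : set K) : A !=set0 -> (forall a, A a -> 0 <= a) ->
  has_ubound A -> supremums A !=set0.
Proof.
case: hK A => A [a0 Aa0] A0 [M AM].
  exists (sup A); split; first by move=> a Aa; apply: ub_le_sup => //; exists M.
  by move=> b Ab; apply: ge_sup => //; exists a0.
have imA a : A a -> a = (complex.Re a)%:C%C.
  by move=> /A0; case: a => x y; rewrite lecE /= => /andP[/eqP -> _].
pose B := (@complex.Re R) @` A.
have B0 : B !=set0 by exists (complex.Re a0), a0.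
have BM : has_ubound B.
  by exists (complex.Re M) => _ [a Aa <-]; have := AM _ Aa; rewrite lecE => /andP[].
exists ((sup B)%:C%C); split.
  move=> a Aa; rewrite (imA _ Aa) lecR.
  by apply: ub_le_sup => //; exists a.
move=> b Ab; rewrite lecE /=; apply/andP; split.
  by have := Ab _ Aa0; rewrite {1}(imA _ Aa0) lecE /= => /andP[].
apply: ge_sup => // _ [a Aa <-].
by have := Ab _ Aa; rewrite lecE => /andP[].
Qed.

Variables (V : normedModType K) (T : Type) (D : set T).
Implicit Types f g : T -> V.

Definition bounded_over f := exists M : K, forall x, D x -> `|f x| <= M.

Lemma sup_norm_lub f : D !=set0 -> bounded_over f ->
  supremums [set `|f x| | x in D] (sup_norm D f).
Proof.
move=> [x0 Dx0] [M fM]; rewrite /sup_norm /supremum.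
have h : [set `|f x| | x in D] !=set0 by exists `|f x0|, x0.
rewrite ifF; last by apply/negbTE/set0P.
have [s hs] := @scalar_supremums _ h ltac:(by move=> _ [x _ <-])
   ltac:(by exists M => _ [x Dx <-]; exact: fM).
exact: (xgetPex _ (ex_intro _ s hs)).
Qed.

Lemma le_sup_norm f x : bounded_over f -> D x -> `|f x| <= sup_norm D f.
Proof.
move=> bf Dx; have [ub _] := sup_norm_lub (ex_intro _ x Dx) bf.
by apply: ub; exists x.
Qed.

Lemma sup_norm_le f M : D !=set0 -> (forall x, D x -> `|f x| <= M) ->
  sup_norm D f <= M.
Proof.
move=> D0 fM; have [_ lub] := sup_norm_lub D0 (ex_intro _ M fM).
by apply: lub => _ [x Dx <-]; exact: fM.
Qed.

Lemma bounded_overD f g : bounded_over f -> bounded_over g ->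
  bounded_over (f + g).
Proof.
move=> [M fM] [N gN]; exists (M + N) => x Dx.
by rewrite (le_trans (ler_normD _ _))// lerD// ?fM ?gN.
Qed.

Lemma bounded_overZ (l : K) f : bounded_over f -> bounded_over (l *: f).
Proof.
move=> [M fM]; exists (`|l| * M) => x Dx.
by rewrite normrZ ler_wpM2l// fM.
Qed.

Hypothesis D0 : D !=set0.

Lemma sup_normD f g : bounded_over f -> bounded_over g ->
  sup_norm D (f + g) <= sup_norm D f + sup_norm D g.
Proof.
move=> bf bg; apply: sup_norm_le => // x Dx.
by rewrite (le_trans (ler_normD _ _))// lerD// le_sup_norm.
Qed.

Lemma sup_normZ (l : K) f : bounded_over f ->
  sup_norm D (l *: f) = `|l| * sup_norm D f.
Proof.
move=> bf; apply/eqP; rewrite eq_le; apply/andP; split.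
  by apply: sup_norm_le => // x Dx; rewrite normrZ ler_wpM2l// le_sup_norm.
have [->|l0] := eqVneq l 0.
  rewrite normr0 mul0r; have [x Dx] := D0.
  apply: le_trans (le_sup_norm (bounded_overZ 0 bf) Dx).
  exact: normr_ge0.
rewrite mulrC -ler_pdivlMr ?normr_gt0//.
apply: sup_norm_le => // x Dx; rewrite ler_pdivlMr ?normr_gt0// mulrC -normrZ.
exact: (le_sup_norm (bounded_overZ l bf) Dx).
Qed.

Lemma sup_norm0 f : bounded_over f -> sup_norm D f = 0 ->
  forall x, D x -> f x = 0.
Proof.
by move=> bf f0 x /(le_sup_norm bf); rewrite f0 normr_le0 => /eqP.
Qed.

End sup_norm_theory.


Section null_sequences.
Variable K : numFieldType.

Definition null_seq : {pred nat -> K^o} :=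
  [pred u : nat -> K^o | `[< u @ \oo --> (0 : K^o) >]].

Lemma null_seq_submod : GRing.submod_closed null_seq.
Proof.
split; first by apply/asboolP; exact: cvg_cst.
move=> l u v /asboolP hu /asboolP hv; apply/asboolP.
have := cvgD (cvgZl_tmp (k := l) hu) hv; rewrite scaler0 addr0; exact.
Qed.

HB.instance Definition _ := GRing.isSubmodClosed.Build K (nat -> K^o) null_seq
  null_seq_submod.

End null_sequences.

(* The hypothesis hK is only used to equip the type with its norm. *)
Record c0 (R : realType) (K : numFieldType) (hK : real_or_complex R K) :=
  C0 { c0_seq :> nat -> K^o; _ : c0_seq \in @null_seq K }.

Section c0_normed.
Variables (R : realType) (K : numFieldType) (hK : real_or_complex R K).

HB.instance Definition _ := [isSub for @c0_seq R K hK].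
HB.instance Definition _ := [Choice of c0 hK by <:].
HB.instance Definition _ := [SubChoice_isSubLmodule of c0 hK by <:].

Definition c0_norm (u : c0 hK) : K := sup_norm [set: nat] u.

Lemma c0_bounded (u : c0 hK) : bounded_over [set: nat] u.
Proof.
have /asboolP h := valP u.
have [M [_ hM]] := cvg_seq_bounded (cvgP _ h).
by exists (M + 1) => n _; apply: (hM (M + 1)) => //; rewrite ltrDl.
Qed.

Let nat0 : [set: nat] !=set0. Proof. by exists 0%N. Qed.

Lemma c0_normD (u v : c0 hK) : c0_norm (u + v) <= c0_norm u + c0_norm v.
Proof. exact: (sup_normD hK nat0 (c0_bounded u) (c0_bounded v)). Qed.

Lemma c0_normZ (l : K) (u : c0 hK) : c0_norm (l *: u) = `|l| * c0_norm u.
Proof. exact: (sup_normZ hK nat0 l (c0_bounded u)). Qed.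

Lemma c0_norm_eq0 (u : c0 hK) : c0_norm u = 0 -> u = 0.
Proof.
move=> u0; apply/val_inj/funext => n.
exact: (sup_norm0 hK (c0_bounded u) u0).
Qed.

HB.instance Definition _ :=
  Lmodule_isNormed.Build K (c0 hK) c0_normD c0_normZ c0_norm_eq0.

Lemma c0_normE (u : c0 hK) : `|u| = sup_norm [set: nat] u.
Proof. by []. Qed.

End c0_normed.

Section polynomials.
Variables (K : numFieldType) (E F : normedModType K) (n : nat).

Definition multilinear (A : ('I_n -> E) -> F) : Prop :=
  forall (i : 'I_n) (x : 'I_n -> E), linear (fun v : E => A (dfwith x i v)).

Definition homogeneous_poly (P : E -> F) : Prop :=
  exists2 A : ('I_n -> E) -> F, multilinear A & forall x, P x = A (fun=> x).

Definition continuous_poly : {pred E -> F} :=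
  [pred P : E -> F | `[< homogeneous_poly P /\ continuous P >]].

Lemma continuous_poly_submod : GRing.submod_closed continuous_poly.
Proof.
split.
  apply/asboolP; split; last by move=> x; exact: cvg_cst.
  exists (fun=> 0) => // i x l u v /=; by rewrite scaler0 addr0.
move=> l P Q /asboolP[[A Alin PA] cP] /asboolP[[B Blin QB] cQ].
apply/asboolP; split; last first.
  by move=> x; apply: cvgD; [exact: cvgZl_tmp (cP x)|exact: cQ].
exists (l *: A + B); last by move=> x; rewrite !fctE PA QB.
move=> i x k u v; rewrite !fctE (Alin i x) (Blin i x).
rewrite !scalerDr !scalerA (mulrC l k) -!addrA; congr (_ + _).
by rewrite addrCA.
Qed.

HB.instance Definition _ := GRing.isSubmodClosed.Build K (E -> F) continuous_poly
  continuous_poly_submod.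

Lemma homogeneous_polyZ P (t : K) x :
  homogeneous_poly P -> P (t *: x) = t ^+ n *: P x.
Proof.
move=> [A Alin PA]; rewrite !PA.
pose y k := fun i : 'I_n => if (i < k)%N then t *: x else x.
suff H k : (k <= n)%N -> A (y k) = t ^+ k *: A (fun=> x).
  by rewrite -(H n (leqnn n)); congr A; apply/funext => i; rewrite /y ltn_ord.
elim: k => [_|k IH kn]; first by rewrite expr0 scale1r.
have -> : y k.+1 = dfwith (y k) (Ordinal kn) (t *: x).
  apply/funext => i; case: dfwithP => [|j]; rewrite /y /= ?ltnSn//.
  by rewrite -val_eqE /= ltnS leq_eqVlt eq_sym => /negbTE ->.
have := Alin (Ordinal kn) (y k) t x 0; rewrite addr0 => ->.
have -> : A (dfwith (y k) (Ordinal kn) 0) = 0.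
  have := Alin (Ordinal kn) (y k) (-1) 0 0.
  by rewrite scaler0 addr0 scaleN1r addNr.
rewrite addr0 exprS -scalerA -IH 1?ltnW//; congr (_ *: A _).
apply/funext => i; case: dfwithP => //.
by rewrite /y /= ltnn.
Qed.

Lemma continuous_poly_bounded P : P \in continuous_poly ->
  bounded_over [set x : E | `|x| <= 1] P.
Proof.
move=> /asboolP[hP /(_ 0) /cvgrPdist_lt/(_ 1 ltr01)].
move=> /nbhs_normP[e /= e0 he].
exists (`|(2 / e) ^+ n| * (`|P 0| + 1)) => x /= x1.
have -> : x = (2 / e) *: ((e / 2) *: x).
  by rewrite scalerA mulrA divfK ?divff ?scale1r ?gt_eqF.
rewrite homogeneous_polyZ// normrZ ler_wpM2l//.
set z := (e / 2) *: x.
have zP : `|P 0 - P z| < 1.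
  apply: he; rewrite /= sub0r normrN normrZ gtr0_norm ?divr_gt0//.
  apply: (@le_lt_trans _ _ (e / 2)); last by rewrite gtr_pMr// invf_lt1// ltr1n.
  by rewrite ler_piMr// ltW// divr_gt0.
rewrite -[P z](subrK (P 0)) (le_trans (ler_normD _ _))// addrC lerD2l distrC.
exact: ltW.
Qed.

End polynomials.

Record poly_space (R : realType) (K : numFieldType) (hK : real_or_complex R K)
    (n : nat) (E F : normedModType K) :=
  PolySpace { poly_fun :> E -> F; _ : poly_fun \in continuous_poly n }.

Section poly_space_normed.
Variables (R : realType) (K : numFieldType) (hK : real_or_complex R K).
Variables (n : nat) (E F : normedModType K).

HB.instance Definition _ := [isSub for @poly_fun R K hK n E F].
HB.instance Definition _ := [Choice of poly_space hK n E F by <:].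
HB.instance Definition _ :=
  [SubChoice_isSubLmodule of poly_space hK n E F by <:].

Definition poly_norm (P : poly_space hK n E F) : K :=
  sup_norm [set x : E | `|x| <= 1] P.

Let poly_bounded (P : poly_space hK n E F) :
  bounded_over [set x : E | `|x| <= 1] P.
Proof. exact: continuous_poly_bounded (valP P). Qed.

Let unit_ball0 : [set x : E | `|x| <= 1] !=set0.
Proof. by exists 0; rewrite /= normr0. Qed.

Lemma poly_normD (P Q : poly_space hK n E F) :
  poly_norm (P + Q) <= poly_norm P + poly_norm Q.
Proof.
exact: (sup_normD hK unit_ball0 (@poly_bounded P) (@poly_bounded Q)).
Qed.

Lemma poly_normZ (l : K) (P : poly_space hK n E F) :
  poly_norm (l *: P) = `|l| * poly_norm P.
Proof. exact: (sup_normZ hK unit_ball0 l (@poly_bounded P)). Qed.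

Lemma poly_norm_eq0 (P : poly_space hK n E F) : poly_norm P = 0 -> P = 0.
Proof.
move=> P0; apply/val_inj/funext => x /=.
have P1 := sup_norm0 hK (@poly_bounded P) P0.
have [->|x0] := eqVneq x 0; first by apply: P1; rewrite /= normr0.
have /asboolP[hP _] := valP P.
rewrite -[x](scalerKV (a := `|x|)) ?normr_eq0//.
rewrite (homogeneous_polyZ _ _ hP) [X in _ *: X]P1 ?scaler0//=.
by rewrite normrZ normfV normr_id mulVf ?normr_eq0.
Qed.

HB.instance Definition _ := Lmodule_isNormed.Build K (poly_space hK n E F)
  poly_normD poly_normZ poly_norm_eq0.

Lemma poly_space_normE (P : poly_space hK n E F) :
  `|P| = sup_norm [set x : E | `|x| <= 1] P.
Proof. by []. Qed.

Definition compact_polys : set (poly_space hK n E F) :=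
  [set P | forall B : set E, bounded_set B -> precompact (P @` B)].

End poly_space_normed.

Arguments compact_polys {R K} hK n E F.

(* M is meant to be a linear subspace of X; closedness of the copy of Y is
   relative to M, and g restricts to the inverse of the isomorphism T. *)
Definition contains_copy (K : numFieldType) (X : normedModType K) (M : set X)
    (Y : normedModType K) : Prop :=
  exists (T : {linear Y -> X}) (g : X -> Y),
    [/\ range T `<=` M,
        exists2 C : set X, closed C & range T = M `&` C,
        continuous T,
        cancel T g &
        {within range T, continuous g}].

Definition complemented (K : numFieldType) (X : normedModType K) (M : set X)
    : Prop :=
  exists p : {linear X -> X},
    [/\ exists C : K, forall x, `|p x| <= C * `|x|,
        forall x, p (p x) = p x &
        range p = M].

(* Main.v *)
(* Suppose that p projects P(^nE;F) onto the compact polynomials. The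
   basis of the copy of c0 gives compact T_k, bounded below at points x_k
   of the unit ball, whose series is weakly unconditionally Cauchy.

   If all subseries converge pointwise, their sums S_A are polynomials (by
   polarization), and p S_A - S_A is a finitely additive function of A
   vanishing on finite sets. By Whitley's almost disjoint family argument
   countably many functionals kill it for some infinite A, so S_A(x_j) is
   Cauchy along ultrafilters. Take functionals phi_j norming T_j(x_j),
   thinned out by Rosenthal's lemma, and phi a weak-star cluster point of
   them: the scalar polynomials phi o T_k then have blocks u_i with sum_i
   |u_i| bounded and |u_i(x'_i)| bounded below. As F is infinite
   dimensional it has a bounded separated sequence y_i, and the same
   argument applied to the polynomials u_i y_i makes some S_A(x'_j), which
   is close to u_j(x'_j) y_j, Cauchy along an ultrafilter: a
   contradiction.

   If some subseries diverges at a point, F contains a weakly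
   unconditionally Cauchy series of blocks y_i bounded below. As E is
   infinite dimensional, the Josefson-Nissenzweig theorem gives f_i in the
   dual ball, weak-star null and bounded below in norm, and the first case
   applies to the f_i^n y_i.

   For Josefson-Nissenzweig, pass to convex blocks g of a bounded sequence
   of functionals whose oscillation on the unit ball cannot be decreased
   by further blocking. If this oscillation is 0, g converges weak-star,
   and one subtracts the limit. Otherwise there are points x_k such that
   some terms of g behave on them like the vertices of a cube; limits of
   the Rademacher averages of these terms are bounded below at the x_k and
   square summable at every point. *)
Require Import Defs.
From HB Require Import structures.
From mathcomp Require Import all_boot all_order all_algebra.
From mathcomp Require Import complex ring lra.
From mathcomp Require Import all_classical all_reals all_analysis.

Set Implicit Arguments.
Unset Strict Implicit.
Unset Printing Implicit Defensive.

Import Order.TTheory GRing.Theory Num.Theory.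
Import numFieldNormedType.Exports.

Local Open Scope classical_set_scope.
Local Open Scope ring_scope.

(** * Real and complex scalars *)

(* Norms of K-normed spaces are handled as elements of [R], through [re].
   The element [imu] is ['i] over [R[i]] and [0] over [R], so that the
   formula [re_imE] and the complexification in [hahn_banach_norming] hold
   in both cases. *)
Record real_structure (R : realType) (K : numFieldType) := RealStructure {
  ofR : {rmorphism R -> K};
  re : K -> R;
  imu : K;
  re_lin : forall t a b, re (ofR t * a + b) = t * re a + re b;
  re_ofR : forall t, re (ofR t) = t;
  ler_ofR : forall s t, (ofR s <= ofR t) = (s <= t);
  ofR_re : forall a, 0 <= a -> ofR (re a) = a;
  re_le_norm : forall a, re a <= re `|a|;
  imu_le1 : `|imu| <= 1;
  imu_sqr : imu = 0 \/ imu * imu = -1;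
  re_imE : forall a, a = ofR (re a) - imu * ofR (re (imu * a)) }.

Lemma real_structure_ex (R : realType) (K : numFieldType) :
  real_or_complex R K -> inhabited (real_structure R K).
Proof.
case.
  apply: inhabits; apply: (@RealStructure R R idfun idfun 0) => //=.
  - by move=> a; exact: ler_norm.
  - by rewrite normr0.
  - by left.
  - by move=> a; rewrite mul0r subr0.
apply: inhabits; apply: (@RealStructure R R[i] (real_complex R) (@complex.Re
  R) 'i%C) => //=.
- by move=> t [a1 a2] [b1 b2] /=; ring.
- by move=> s t; rewrite lecR.
- by case=> x y; rewrite lecE /= => /andP[/eqP -> _].
- move=> [x y]; change (x <= Num.sqrt (x ^+ 2 + y ^+ 2)).
  apply: le_trans (ler_norm _) _.
  by rewrite -sqrtr_sqr ler_wsqrtr// lerDl sqr_ge0.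
- change ((Num.sqrt (0 ^+ 2 + 1 ^+ 2) : R)%:C%C <= 1).
  by rewrite expr0n /= add0r expr1n sqrtr1.
- by right; rewrite -expr2 sqr_i.
- by move=> [x y] /=; apply/eqP; rewrite eq_complex /=; apply/andP; split;
  apply/eqP; ring.
Qed.

Section rnorm.
Variables (R : realType) (K : numFieldType) (S : real_structure R K).
Local Notation ofR := (ofR S).
Local Notation re := (re S).

Definition rnorm (V : normedZmodType K) (x : V) : R := re `|x|.

Lemma ofR_rnorm (V : normedZmodType K) (x : V) : ofR (rnorm x) = `|x|.
Proof. by rewrite ofR_re. Qed.

Lemma ltr_ofR s t : (ofR s < ofR t) = (s < t).
Proof.
by rewrite !lt_neqAle (ler_ofR S) (inj_eq (fmorph_inj (ofR))).
Qed.

Lemma ofR_ge0 s : (0 <= ofR s) = (0 <= s).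
Proof. by rewrite -(rmorph0 ofR) ler_ofR. Qed.

Lemma ofR_gt0 s : (0 < ofR s) = (0 < s).
Proof. by rewrite -(rmorph0 ofR) ltr_ofR. Qed.

Lemma rnorm_le_ofR (V : normedZmodType K) (x : V) M :
  (`|x| <= ofR M) = (rnorm x <= M).
Proof. by rewrite -ofR_rnorm ler_ofR. Qed.

Lemma rnorm_lt_ofR (V : normedZmodType K) (x : V) M :
  (`|x| < ofR M) = (rnorm x < M).
Proof. by rewrite -ofR_rnorm ltr_ofR. Qed.

Lemma ofR_inj : injective ofR. Proof. exact: fmorph_inj. Qed.

Lemma rnorm_ge0 (V : normedZmodType K) (x : V) : 0 <= rnorm x.
Proof. by rewrite -ofR_ge0 ofR_rnorm. Qed.

Lemma rnorm0 (V : normedZmodType K) : rnorm (0 : V) = 0.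
Proof. by apply: ofR_inj; rewrite ofR_rnorm normr0 rmorph0. Qed.

Lemma rnorm_eq0 (V : normedZmodType K) (x : V) : (rnorm x == 0) = (x == 0).
Proof. by rewrite -(inj_eq ofR_inj) ofR_rnorm rmorph0 normr_eq0. Qed.

Lemma rnormN (V : normedZmodType K) (x : V) : rnorm (- x) = rnorm x.
Proof. by rewrite /rnorm normrN. Qed.

Lemma rnormB (V : normedZmodType K) (x y : V) : rnorm (x - y) = rnorm (y - x).
Proof. by rewrite /rnorm distrC. Qed.

Lemma ler_rnormD (V : normedZmodType K) (x y : V) :
  rnorm (x + y) <= rnorm x + rnorm y.
Proof. by rewrite -(ler_ofR S) rmorphD /= !ofR_rnorm ler_normD. Qed.

Lemma ler_rnormB (V : normedZmodType K) (x y : V) :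
  rnorm (x - y) <= rnorm x + rnorm y.
Proof. by rewrite (le_trans (ler_rnormD _ _))// rnormN. Qed.

Lemma ler_rnorm_tri (V : normedZmodType K) (z x y : V) :
  rnorm (x - y) <= rnorm (x - z) + rnorm (z - y).
Proof. by rewrite -[x - y](subrKA z) ler_rnormD. Qed.

Lemma ler_rnorm_sum (V : normedZmodType K) (I : Type) (r : seq I) (P : pred I)
    (f : I -> V) :
  rnorm (\sum_(i <- r | P i) f i) <= \sum_(i <- r | P i) rnorm (f i).
Proof.
elim/big_ind2 : _ => [|x a y b xa yb|//]; first by rewrite rnorm0.
by rewrite (le_trans (ler_rnormD _ _))// lerD.
Qed.

Lemma rnormZ (V : normedModType K) (a : K) (x : V) :
  rnorm (a *: x) = rnorm a * rnorm x.
Proof. by apply: ofR_inj; rewrite rmorphM /= !ofR_rnorm normrZ. Qed.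

Lemma rnormM (a b : K) : rnorm (a * b) = rnorm a * rnorm b.
Proof. by apply: ofR_inj; rewrite rmorphM /= !ofR_rnorm normrM. Qed.

Lemma rnorm1 : rnorm (1 : K) = 1.
Proof. by apply: ofR_inj; rewrite ofR_rnorm normr1 rmorph1. Qed.

Lemma rnormX (a : K) n : rnorm (a ^+ n) = rnorm a ^+ n.
Proof. by apply: ofR_inj; rewrite rmorphXn /= !ofR_rnorm normrX. Qed.

Lemma rnorm_ofR t : rnorm (ofR t) = `|t|.
Proof.
apply: ofR_inj; rewrite ofR_rnorm; case: (lerP 0 t) => t0.
  by rewrite !ger0_norm ?ofR_ge0.
by rewrite -normrN -rmorphN gtr0_norm ?ofR_gt0 ?oppr_gt0 ?ltr0_norm.
Qed.

Lemma rnorm_imu : rnorm (imu S) <= 1.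
Proof. by rewrite -rnorm_le_ofR rmorph1 imu_le1. Qed.

Lemma re0 : re 0 = 0. Proof. by rewrite -(rmorph0 ofR) re_ofR. Qed.

Lemma reD a b : re (a + b) = re a + re b.
Proof. by rewrite -[a in LHS]mul1r -(rmorph1 ofR) re_lin mul1r. Qed.

Lemma reZ t a : re (ofR t * a) = t * re a.
Proof. by rewrite -[ofR t * a]addr0 re_lin re0 addr0. Qed.

Lemma reN a : re (- a) = - re a.
Proof. by rewrite -mulN1r -(rmorph1 ofR) -rmorphN reZ mulN1r. Qed.

Lemma reB a b : re (a - b) = re a - re b.
Proof. by rewrite reD reN. Qed.

Lemma re_sum (I : Type) (r : seq I) (P : pred I) (f : I -> K) :
  re (\sum_(i <- r | P i) f i) = \sum_(i <- r | P i) re (f i).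
Proof. by apply: (big_morph re reD re0). Qed.

Lemma re_le_rnorm a : re a <= rnorm a.
Proof. exact: re_le_norm. Qed.

Lemma abs_re_le_rnorm a : `|re a| <= rnorm a.
Proof. by rewrite ler_norml re_le_rnorm andbT lerNl -reN -rnormN re_le_rnorm.
  Qed.

Lemma rnorm_le_re a : rnorm a <= `|re a| + `|re (imu S * a)|.
Proof.
rewrite {1}(re_imE S a) (le_trans (ler_rnormB _ _))// rnorm_ofR lerD2l.
by rewrite rnormM rnorm_ofR ler_piMl// rnorm_imu.
Qed.

(* Rotates [a] onto its modulus; the value at [a = 0] is [1]. *)
Definition phase (a : K) : K := if a == 0 then 1 else `|a| / a.

Lemma phaseM a : phase a * a = `|a|.
Proof.
rewrite /phase; case: eqVneq => [->|a0]; first by rewrite mulr0 normr0.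
by rewrite divfK.
Qed.

Lemma rnorm_phase a : rnorm (phase a) = 1.
Proof.
rewrite /phase; case: eqVneq => [_|a0]; first exact: rnorm1.
apply: ofR_inj; rewrite ofR_rnorm rmorph1 normrM normr_id normfV.
by rewrite divff// normr_eq0.
Qed.

Lemma cvg_rnormP (V : normedModType K) (T : Type) (F : set_system T)
    (FF : Filter F) (f : T -> V) (l : V) :
  f @ F --> l <-> forall e, 0 < e -> F [set x | rnorm (f x - l) < e].
Proof.
split=> [/cvgrPdist_lt fl e e0|H].
  have := fl (ofR e); rewrite ofR_gt0 => /(_ e0); apply: filterS => x.
  by rewrite distrC rnorm_lt_ofR.
apply/cvgrPdist_lt => e e0; have := H (re e).
rewrite -ofR_gt0 ofR_re ?ltW// => /(_ e0); apply: filterS => x /=.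
by rewrite -ltr_ofR ofR_rnorm ofR_re ?ltW// distrC.
Qed.

Lemma cvgn_rnormP (V : normedModType K) (f : nat -> V) (l : V) :
  f @ \oo --> l <->
  forall e, 0 < e -> exists N, forall n, (N <= n)%N -> rnorm (f n - l) < e.
Proof.
split=> [/cvg_rnormP fl e /fl[N _ H]|H]; first by exists N => n /H.
by apply/cvg_rnormP => e /H[N HN]; exists N.
Qed.

(** Compactness comes from the real square [[-M, M]^2]: by [re_imE] every scalar of modulus at most
    [M] is [s - imu * t] with [(s, t)] in that square, over both fields. *)
Lemma compact_scalar_image (V : normedModType K) (M : R) (y : V) :
  exists2 C : set V, compact C & forall a, rnorm a <= M -> C (a *: y).
Proof.
have cofR (T : Type) (f : T -> R) (F : set_system T) (t : R) : Filter F ->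
    f @ F --> t -> (ofR (f x) : K^o) @[x --> F] --> (ofR t : K^o).
  move=> FF /cvgrPdist_lt ft; apply/cvg_rnormP => e /ft; apply: filterS => u.
  by rewrite /= -rmorphB /= rnorm_ofR distrC.
pose h (st : R * R) : V := ((ofR st.1 : K^o) - imu S *: (ofR st.2 : K^o)) *: y.
exists (h @` (`[-M, M]%classic `*` `[-M, M]%classic)).
  apply: continuous_compact; last by apply: compact_setX;
    exact: segment_compact.
  apply: continuous_subspaceT => -[s t].
  apply: cvgZr_tmp; apply: cvgB.
    by apply: cofR; exact: cvg_fst.
  by apply: cvgZl_tmp; by apply: cofR; exact: cvg_snd.
move=> a aM; exists (re a, re (imu S * a)); last by rewrite /h /= -re_imE.
have inM b : rnorm b <= M -> `[-M, M]%classic (re b).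
  move=> bM; rewrite /= in_itv /= -ler_norml.
  exact: le_trans (abs_re_le_rnorm _) bM.
split; apply: inM => //=; rewrite rnormM; apply: le_trans aM.
by rewrite ler_piMl ?rnorm_ge0 ?rnorm_imu.
Qed.

End rnorm.

(** A cluster point of an ultrafilter is its limit: if a neighbourhood were missed, its complement
    would belong to the ultrafilter and would have to meet it. *)
Lemma ultra_compact_cvg (T : topologicalType) (C : set T) (U : set_system nat)
    (u : nat -> T) : UltraFilter U -> compact C -> U (u @^-1` C) ->
  exists2 p, C p & u @ U --> p.
Proof.
move=> UU cC UC.
have [p [Cp clp]] := cC (u @ U) _ UC.
exists p => // V Vp; have [//|UnV] := in_ultra_setVsetC (u @^-1` V) UU.
have [x [xC xV]] := clp (~` V) V UnV Vp.
by [].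
Qed.

Lemma ultra_bounded_cvg (R : realType) (K : numFieldType)
    (S : real_structure R K) (U : set_system nat) (u : nat -> K^o) (M : R) :
  UltraFilter U -> (forall n, rnorm S (u n) <= M) -> exists l : K^o,
    u @ U --> l.
Proof.
move=> UU uM; have [C cC HC] := compact_scalar_image S M (1 : K^o).
have [|l _ ul] := @ultra_compact_cvg _ C U u UU cC; last by exists l.
by apply: filterE => n /=; rewrite -[u n]mulr1; exact: HC.
Qed.

(** * Hahn-Banach *)

Section hahn_banach.
Variables (R : realType) (K : numFieldType) (S : real_structure R K).
Local Notation ofR := (ofR S).
Local Notation re := (re S).
Local Notation imu := (imu S).

Section sublinear.
Variable V : lmodType K.
Implicit Types (p q : V -> R) (x y : V).

Definition sublinear q := (forall x y, q (x + y) <= q x + q y) /\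
  (forall t x, 0 <= t -> q (ofR t *: x) <= t * q x).

Lemma sublinear0 q : sublinear q -> q 0 = 0.
Proof.
move=> [qD qZ]; have := qZ 0 0 (lexx _); have := qD 0 0.
by rewrite addr0 scaler0 mul0r; lra.
Qed.

Lemma sublinearN q x : sublinear q -> - q (- x) <= q x.
Proof.
move=> Sq; have [qD _] := Sq; have := qD x (- x).
by rewrite subrr (sublinear0 Sq); lra.
Qed.

Lemma sublinearZ q t x : sublinear q -> 0 <= t -> q (ofR t *: x) = t * q x.
Proof.
move=> Sq; have [qD qZ] := Sq; rewrite le_eqVlt => /predU1P[<-|t0].
  by rewrite rmorph0 scale0r mul0r sublinear0.
apply/eqP; rewrite eq_le (qZ _ _ (ltW t0)) /=.
have tV0 : 0 <= t^-1 by rewrite invr_ge0 ltW.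
have := qZ t^-1 (ofR t *: x) tV0.
rewrite scalerA -rmorphM mulVf ?gt_eqF// rmorph1 scale1r => h.
by rewrite mulrC -ler_pdivlMr// mulrC.
Qed.

(* The infimum [shift q y] of these values is sublinear, below [q], and
   satisfies [shift q y (- y) <= - q y]; hence a minimal [q] is odd, and
   so linear. *)
Definition shift_values q y x : set R :=
  [set q (x + ofR t *: y) - t * q y | t in [set t | 0 <= t]].

Definition shift q y x : R := inf (shift_values q y x).

Lemma shift_values_lbound q y x : sublinear q ->
  lbound (shift_values q y x) (- q (- x)).
Proof.
move=> Sq _ [t t0 <-]; rewrite -(sublinearZ _ Sq t0).
have := Sq.1 (x + ofR t *: y) (- x).
by rewrite addrC addKr; lra.
Qed.

Lemma shift_le q y x t : sublinear q -> 0 <= t ->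
  shift q y x <= q (x + ofR t *: y) - t * q y.
Proof.
move=> Sq t0; apply: ge_inf; last by exists t.
by exists (- q (- x)); exact: shift_values_lbound.
Qed.

Lemma shift_ge q y x b :
  (forall t, 0 <= t -> b <= q (x + ofR t *: y) - t * q y) -> b <= shift q y x.
Proof.
move=> H; apply: lb_le_inf; last by move=> _ [t t0 <-]; exact: H.
by exists (q (x + ofR 0 *: y) - 0 * q y); exists 0 => //=; exact: lexx.
Qed.

Lemma shift_le_self q y x : sublinear q -> shift q y x <= q x.
Proof.
move=> Sq; apply: le_trans (shift_le y x Sq (lexx 0)) _.
by rewrite rmorph0 scale0r addr0 mul0r subr0.
Qed.

Lemma shiftN q y : sublinear q -> shift q y (- y) <= - q y.
Proof.
move=> Sq; apply: le_trans (shift_le y (- y) Sq ler01) _.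
by rewrite rmorph1 scale1r addNr sublinear0// mul1r sub0r.
Qed.

Lemma sublinear_shift q y : sublinear q -> sublinear (shift q y).
Proof.
move=> Sq; split=> [x z|t x t0].
  rewrite -lerBlDr; apply: shift_ge => s s0.
  rewrite lerBlDr -lerBlDl; apply: shift_ge => t t0.
  rewrite lerBlDl; apply: le_trans (shift_le y (x + z) Sq (addr_ge0 s0 t0)) _.
  have := Sq.1 (x + ofR s *: y) (z + ofR t *: y).
  rewrite addrACA -scalerDl -rmorphD /=; lra.
move: t0; rewrite le_eqVlt => /predU1P[<-|t0].
  rewrite rmorph0 scale0r mul0r.
  by apply: le_trans (shift_le_self y 0 Sq) _; rewrite sublinear0.
rewrite mulrC -ler_pdivrMr//; apply: shift_ge => s s0; rewrite ler_pdivrMr//.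
have ts0 : 0 <= t * s by rewrite mulr_ge0// ltW.
apply: le_trans (shift_le y _ Sq ts0) _.
rewrite rmorphM /= -scalerA -scalerDr (sublinearZ _ Sq (ltW t0)).
by rewrite mulrBl mulrC [s * _ * t]mulrAC [s * t]mulrC.
Qed.

(** Zorn's lemma for the reversed pointwise order. The empty chain is bounded by [p] itself, a
    nonempty one by its pointwise infimum, which is finite because [- p (- x)] is a lower bound at
    [x]. *)
Lemma minimal_sublinear p : sublinear p ->
  exists q, [/\ sublinear q, forall x, q x <= p x &
    forall q', sublinear q' -> (forall x, q' x <= q x) -> q' = q].
Proof.
move=> Sp.
pose T := {q : V -> R | sublinear q /\ forall x, q x <= p x}.
pose rT (q1 q2 : T) := `[< forall x, sval q2 x <= sval q1 x >].
have [|||A totA|[q [Sq qp]] qmin] := @Zorn T rT.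
- by move=> q; apply/asboolP.
- move=> q1 q2 q3 /asboolP h1 /asboolP h2; apply/asboolP => x.
  exact: le_trans (h2 x) (h1 x).
- move=> [q1 h1] [q2 h2] /asboolP /= h12 /asboolP /= h21.
  by apply: eq_exist; apply/funext => x; apply/eqP; rewrite eq_le h12 h21.
- have [[q0 Aq0]|A0] := pselect (A !=set0); last first.
    exists (exist _ p (conj Sp (fun x => lexx (p x)))) => q Aq.
    by exfalso; apply: A0; exists q.
  pose vals x : set R := [set sval q x | q in A].
  have infle (q : T) x : A q -> inf (vals x) <= sval q x.
    move=> Aq; apply: ge_inf; last by exists q.
    exists (- p (- x)) => _ [q' _ <-]; have [Sq' q'p] := svalP q'.
    by apply: le_trans (sublinearN x Sq'); rewrite lerN2.
  have leinf b x : (forall q : T, A q -> b <= sval q x) -> b <= inf (vals x).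
    move=> H; apply: lb_le_inf; first by exists (sval q0 x), q0.
    by move=> _ [q' Aq' <-]; exact: H.
  (* Subadditivity uses the chain condition: of two members, one evaluated at [x] and one at [y],
     the smaller serves at both points. *)
  have Sinf : sublinear (fun x => inf (vals x)).
    split=> [x y|t x].
      rewrite -lerBlDr; apply: (leinf) => q1 A1; rewrite lerBlDr -lerBlDl.
      apply: (leinf) => q2 A2; rewrite lerBlDl.
      have [/asboolP h|/asboolP h] := totA _ _ A1 A2.
        apply: le_trans (infle _ _ A2) _; have [[qD _] _] := svalP q2.
        by apply: le_trans (qD _ _) _; rewrite lerD2r.
      apply: le_trans (infle _ _ A1) _; have [[qD _] _] := svalP q1.
      by apply: le_trans (qD _ _) _; rewrite lerD2l.
    rewrite le_eqVlt => /predU1P[<-|t0].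
      rewrite rmorph0 scale0r mul0r; apply: le_trans (infle _ _ Aq0) _.
      by have [Sq0 _] := svalP q0; rewrite sublinear0.
    rewrite mulrC -ler_pdivrMr//; apply: leinf => q' Aq'; rewrite ler_pdivrMr//.
    apply: le_trans (infle _ _ Aq') _; have [[_ qZ] _] := svalP q'.
    by rewrite mulrC qZ// ltW.
  have infp x : inf (vals x) <= p x.
    by apply: le_trans (infle _ _ Aq0) _; have [_] := svalP q0.
  exists (exist _ (fun x => inf (vals x)) (conj Sinf infp) : T) => q Aq.
  by apply/asboolP => x; exact: infle.
exists q; split => // q' Sq' q'q.
have q'p x : q' x <= p x by exact: le_trans (q'q x) (qp x).
have := qmin (exist _ q' (conj Sq' q'p)).
by move=> /(_ (introT (asboolP _) q'q)) /(congr1 sval).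
Qed.

Lemma hahn_banach_dominated p : sublinear p ->
  exists f : V -> R, (forall t x y, f (ofR t *: x + y) = t * f x + f y) /\
    forall x, f x <= p x.
Proof.
move=> /minimal_sublinear[q [Sq qp qmin]]; exists q; split => //.
have qN x : q (- x) = - q x.
  apply/eqP; rewrite eq_le; apply/andP; split; last first.
    by have := sublinearN (- x) Sq; rewrite opprK.
  rewrite -[X in X (- x)](qmin (shift q x)); first exact: shiftN.
  - exact: sublinear_shift.
  - by move=> y; exact: shift_le_self.
have qZ t x : q (ofR t *: x) = t * q x.
  have [t0|/ltW t0] := leP 0 t; first by rewrite sublinearZ.
  rewrite -[t]opprK rmorphN scaleNr qN sublinearZ// ?oppr_ge0//; lra.
move=> t x y; rewrite -qZ; apply/eqP; rewrite eq_le (Sq.1 _ _) /=.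
have := Sq.1 (ofR t *: x + y) (- y); rewrite addrK qN; lra.
Qed.

End sublinear.

(** * The unit ball of the dual space *)

Section dual_ball.
Variable V : normedModType K.
Local Notation rnorm := (rnorm S).

(** Functionals are bare functions, so that weak-star limits are pointwise limits. *)
Definition dual_ball : set (V -> K) := [set f : V -> K |
  (forall a x y, f (a *: x + y) = a * f x + f y) /\
  (forall x, rnorm (f x) <= rnorm x)].

(** The real functional is dominated by the norm shifted along [y], not by the norm alone. By
    [shiftN] this forces [f (- y) <= - rnorm y], so [f] norms [y] without an extension from a
    subspace. *)
Lemma hahn_banach_norming (y : V) :
  exists2 f, dual_ball f & rnorm (f y) = rnorm y.
Proof.
have Sn : sublinear (fun x : V => rnorm x).
  split=> [x z|t x t0]; first exact: ler_rnormD.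
  by rewrite rnormZ rnorm_ofR ger0_norm.
have [f [flin fp]] := hahn_banach_dominated (sublinear_shift y Sn).
have fle x : f x <= rnorm x by exact: le_trans (fp x) (shift_le_self _ _ Sn).
have f0 : f 0 = 0.
  by have := flin 1 0 0; rewrite scaler0 addr0; lra.
have fD x z : f (x + z) = f x + f z.
  by have := flin 1 x z; rewrite rmorph1 scale1r mul1r.
have fZ t x : f (ofR t *: x) = t * f x.
  by have := flin t x 0; rewrite !addr0 f0 addr0.
have fN x : f (- x) = - f x by have := fD x (- x); rewrite subrr f0; lra.
(* [f] is only real-linear; [g] is the [K]-linear functional whose real part is [f]. *)
pose g x : K := ofR (f x) - imu * ofR (f (imu *: x)).
have reg x : re (g x) = f x.
  rewrite /g; have [j0|j2] := imu_sqr S.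
    by rewrite j0 mul0r subr0 re_ofR.
  have rei t : re (imu * ofR t) = 0.
    have := re_imE S (ofR 1); rewrite re_ofR.
    move=> /eqP; rewrite -subr_eq0 opprB addrC subrK.
    rewrite mulf_eq0 => /orP[/eqP j0|].
      by move: j2; rewrite j0 mul0r => /eqP; rewrite eq_sym oppr_eq0 oner_eq0.
    rewrite -(rmorph0 ofR) (inj_eq (@ofR_inj _ _ S)) rmorph1 mulr1 => /eqP rj.
    by rewrite mulrC reZ rj mulr0.
  by rewrite reB rei re_ofR subr0.
have gD x z : g (x + z) = g x + g z.
  by rewrite /g scalerDr !fD !rmorphD /=; ring.
have gZi t x : g (ofR t *: x) = ofR t * g x.
  have jC : imu *: (ofR t *: x) = ofR t *: (imu *: x) by rewrite !scalerA mulrC.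
  by rewrite /g jC !fZ !rmorphM /=; ring.
have gj x : g (imu *: x) = imu * g x.
  rewrite /g; have [j0|j2] := imu_sqr S.
    by rewrite j0 scale0r f0 rmorph0 !mul0r subrr.
  rewrite scalerA j2 scaleN1r fN rmorphN /= mulrBr mulrA j2; ring.
have gZ a x : g (a *: x) = a * g x.
  rewrite {1}(re_imE S a) scalerBl -scalerA -scaleNr.
  have gN z : g (- z) = - g z.
    by rewrite -scaleN1r -(rmorph1 ofR) -rmorphN gZi rmorphN rmorph1 mulN1r.
  rewrite scaleNr gD gN gZi gj gZi [a in RHS](re_imE S a); ring.
(* Rotating [x] by the phase of [g x] makes the value real and nonnegative, where it equals [f] and
   is dominated. *)
have gle x : rnorm (g x) <= rnorm x.
  have -> : rnorm (g x) = re (g (phase (g x) *: x)).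
    by rewrite gZ phaseM /rnorm.
  by rewrite reg (le_trans (fle _))// rnormZ rnorm_phase mul1r.
exists g; first by split=> // a x z; rewrite gD gZ.
have fy : f y = rnorm y.
  apply/eqP; rewrite eq_le fle /=.
  by have := le_trans (fp (- y)) (shiftN y Sn); rewrite fN lerN2.
by apply/eqP; rewrite eq_le gle /= -fy -reg re_le_rnorm.
Qed.

Section dual_ball_theory.
Variable f : V -> K.
Hypothesis df : dual_ball f.

Lemma dual_ball0 : f 0 = 0.
Proof.
have := df.1 (-1) 0 0.
by rewrite scaleN1r oppr0 addr0 mulN1r addNr.
Qed.

Lemma dual_ballD x y : f (x + y) = f x + f y.
Proof. by have := df.1 1 x y; rewrite scale1r mul1r. Qed.

Lemma dual_ballZ a x : f (a *: x) = a * f x.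
Proof. by have := df.1 a x 0; rewrite !addr0 dual_ball0 addr0. Qed.

Lemma dual_ballN x : f (- x) = - f x.
Proof. by rewrite -scaleN1r dual_ballZ mulN1r. Qed.

Lemma dual_ballB x y : f (x - y) = f x - f y.
Proof. by rewrite dual_ballD dual_ballN. Qed.

Lemma dual_ball_sum (I : Type) (r : seq I) (P : pred I) (g : I -> V) :
  f (\sum_(i <- r | P i) g i) = \sum_(i <- r | P i) f (g i).
Proof. exact: (big_morph f dual_ballD dual_ball0). Qed.

Lemma dual_ball_le x : rnorm (f x) <= rnorm x.
Proof. exact: df.2. Qed.

Lemma dual_ball_le1 x : rnorm x <= 1 -> rnorm (f x) <= 1.
Proof. exact: le_trans (dual_ball_le x). Qed.

End dual_ball_theory.

(** Banach-Alaoglu for sequences: at each point the values are bounded, so they converge along the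
    ultrafilter, and linearity and the norm bound pass to the limit. *)
Lemma ultra_dual_ball (U : set_system nat) (f : nat -> V -> K) :
  UltraFilter U -> (forall n, dual_ball (f n)) ->
  exists2 g : V -> K, dual_ball g &
    forall x, (f n x : K^o) @[n --> U] --> (g x : K^o).
Proof.
move=> UU df.
have /choice[g fg] x : exists l : K^o, (f n x : K^o) @[n --> U] --> l.
  by apply: (@ultra_bounded_cvg _ _ S _ _ (rnorm x)) => n; exact: dual_ball_le.
exists g => //; split=> [a x y|x].
  have fgl : (f n (a *: x + y) : K^o) @[n --> U] --> (a * g x + g y : K^o).
    have -> : (fun n => f n (a *: x + y)) = fun n => a *: (f n x : K^o) + f n y.
      by apply/funext => n; rewrite (df n).1.
    by apply: cvgD; [apply: cvgZl_tmp; exact: fg|exact: fg].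
  exact: (cvg_unique (@norm_hausdorff _ _) (fg _) fgl).
rewrite leNgt; apply/negP => gx.
have e0 : 0 < rnorm (g x) - rnorm x by rewrite subr_gt0.
have /(cvg_rnormP S)/(_ _ e0) := fg x.
move=> /filter_ex[n /=]; have := dual_ball_le (df n) x.
have := ler_rnorm_tri S (f n x) (g x) 0.
rewrite !subr0 (rnormB S (g x)); lra.
Qed.

Definition bounded_functional (g : V -> K) :=
  (forall a x y, g (a *: x + y) = a * g x + g y) /\
  exists C, forall x, rnorm (g x) <= C * rnorm x.

(** Take for [c] the inverse of the norm of [g], and for [y] a point of the unit ball where more
    than half of that norm is reached. *)
Lemma bounded_functional_normalize (g : V -> K) x0 :
  bounded_functional g -> g x0 != 0 ->
  exists c y, [/\ dual_ball (fun x => c * g x), rnorm y <= 1 &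
    2^-1 <= rnorm (c * g y)].
Proof.
move=> [glin [C gC]] gx0.
have x00 : x0 != 0.
  apply: contraNneq gx0 => ->; have := glin (-1) 0 0.
  by rewrite scaler0 addr0 mulN1r addNr => ->.
have gZ a x : g (a *: x) = a * g x.
  have := glin a x 0; rewrite !addr0 => ->.
  suff -> : g 0 = 0 by rewrite addr0.
  by have := glin (-1) 0 0; rewrite scaler0 addr0 mulN1r addNr.
have normalize x : x != 0 -> rnorm ((ofR (rnorm x))^-1 *: x) = 1.
  move=> x0'; rewrite rnormZ -fmorphV rnorm_ofR ger0_norm ?invr_ge0
    ?rnorm_ge0//.
  by rewrite mulVf// rnorm_eq0.
pose A : set R := [set rnorm (g x) | x in [set x | rnorm x <= 1]].
have Ax0 : A (rnorm (g ((ofR (rnorm x0))^-1 *: x0))).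
  by exists ((ofR (rnorm x0))^-1 *: x0) => //=; rewrite normalize.
have A0 : 0 < rnorm (g ((ofR (rnorm x0))^-1 *: x0)).
  rewrite lt_neqAle rnorm_ge0 andbT eq_sym rnorm_eq0 gZ mulf_neq0//.
  by rewrite invr_eq0 fmorph_eq0 rnorm_eq0.
have Asup : has_sup A.
  split; first by exists (rnorm (g ((ofR (rnorm x0))^-1 *: x0))).
  exists `|C| => _ [x /= x1 <-]; apply: le_trans (gC x) _.
  apply: (@le_trans _ _ (`|C| * rnorm x)).
    by rewrite ler_wpM2r ?rnorm_ge0// ler_norm.
  by rewrite ler_piMr.
have s0 : 0 < sup A by apply: lt_le_trans A0 _; exact: (ub_le_sup Asup.2).
have [_ [y y1 <-] ys] :=
  @sup_adherent _ A (sup A / 2) ltac:(by rewrite divr_gt0) Asup.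
have nc : rnorm (ofR (sup A)^-1) = (sup A)^-1.
  by rewrite rnorm_ofR ger0_norm// invr_ge0 ltW.
exists (ofR (sup A)^-1), y; split => //; last first.
  rewrite rnormM nc mulrC ler_pdivlMr//; lra.
split=> [a x z|x]; first by rewrite glin; ring.
have [->|xn0] := eqVneq x 0.
  by have := gZ 0 0; rewrite scale0r mul0r => ->; rewrite mulr0 !rnorm0.
rewrite rnormM nc mulrC ler_pdivrMr// mulrC -ler_pdivrMr; last first.
  by rewrite lt_neqAle rnorm_ge0 andbT eq_sym rnorm_eq0.
apply: le_trans (_ : rnorm (g ((ofR (rnorm x))^-1 *: x)) <= _); last first.
  apply: (ub_le_sup Asup.2); exists ((ofR (rnorm x))^-1 *: x) => //=.
  by rewrite normalize.
rewrite gZ rnormM -fmorphV rnorm_ofR ger0_norm ?invr_ge0 ?rnorm_ge0//.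
by rewrite mulrC.
Qed.

(** Induction on [s]. To fix one more vector [z], add to [P] a rank-one correction in the direction
    [w = z - P z], with coefficient given by a functional norming [w]. The correction vanishes
    wherever [P x = x]. *)
Lemma finite_rank_fixing (s : seq V) :
  exists (P : V -> V) (m : nat) (e : 'I_m -> V),
  [/\ forall a x y, P (a *: x + y) = a *: P x + P y,
      exists C, forall x, rnorm (P x) <= C * rnorm x,
      forall x, exists a : 'I_m -> K, P x = \sum_(i < m) a i *: e i &
      forall x, x \in s -> P x = x].
Proof.
elim: s => [|z s [P [m [e [Plin [C PC] Pe Ps]]]]].
  exists (fun=> 0), 0%N, (fun=> 0); split => //.
  - by move=> a x y; rewrite scaler0 addr0.
  - by exists 0 => x; rewrite rnorm0 mul0r.
  - by move=> x; exists (fun=> 0); rewrite big_ord0.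
have [Pz|Pz] := eqVneq (P z) z.
  exists P, m, e; split => //; first by exists C.
  by move=> x; rewrite inE => /predU1P[->|/Ps].
have P0 : P 0 = 0.
  by have := Plin (-1) 0 0; rewrite scaler0 addr0 scaleN1r addNr.
have [w wE] : exists w, w = z - P z by exists (z - P z).
have w0 : w != 0 by rewrite wE subr_eq0 eq_sym.
have [f df fw] := hahn_banach_norming w.
have fw0 : f w != 0 by rewrite -(rnorm_eq0 S) fw rnorm_eq0.
exists (fun x => P x + (f w)^-1 *: (f (x - P x) *: w)), m.+1,
  (fun i => if unlift ord0 i is Some j then e j else w); split.
- move=> a x y; rewrite Plin opprD addrACA -scalerBr df.1.
  rewrite scalerDl !scalerDr !scalerA (mulrCA _ a) mulrA.
  exact: addrACA.
- exists (C + rnorm ((f w)^-1) * ((1 + C) * rnorm w)) => x.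
  rewrite (le_trans (ler_rnormD _ _ _))// mulrDl lerD// rnormZ -mulrA.
  rewrite ler_wpM2l ?rnorm_ge0// rnormZ mulrAC ler_wpM2r ?rnorm_ge0//.
  apply: le_trans (dual_ball_le df _) _; apply: le_trans (ler_rnormB _ _ _) _.
  by rewrite mulrDl mul1r lerD2l.
- move=> x; have [a ->] := Pe x.
  exists (fun i => if unlift ord0 i is Some j then a j else (f w)^-1 * f (x -
    \sum_(i < m) a i *: e i)).
  rewrite big_ord_recl unlift_none addrC scalerA; congr (_ + _).
  by apply: eq_bigr => i _; rewrite liftK.
move=> x; rewrite inE => /predU1P[->|/Ps ->].
  by rewrite -wE scalerA mulVf// scale1r wE addrC subrK.
by rewrite subrr dual_ball0// scale0r scaler0 addr0.
Qed.

(** A finite-rank [P] fixing [s] is not the identity, so some [f (x - P x)] is nonzero. This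
    functional of [x] kills [s], and it only has to be normalized. *)
Lemma dual_ball_vanishing (s : seq V) : ~ finite_dimensional V ->
  exists f y, [/\ dual_ball f, rnorm y <= 1, forall x, x \in s -> f x = 0 &
    2^-1 <= rnorm (f y)].
Proof.
move=> infV; have [P [m [e [Plin [C PC] Pe Ps]]]] := finite_rank_fixing s.
have [x0 Px0] : exists x, P x != x.
  apply: contrapT => /forallNP H; apply: infV; exists m, e => x.
  by have /negP/negPn/eqP <- := H x; exact: Pe.
have w0 : x0 - P x0 != 0 by rewrite subr_eq0 eq_sym.
have [f df fw] := hahn_banach_norming (x0 - P x0).
have bg : bounded_functional (fun x => f (x - P x)).
  split=> [a x y|]; first by rewrite Plin opprD addrACA -scalerBr df.1.
  exists (1 + C) => x; apply: le_trans (dual_ball_le df _) _.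
  by apply: le_trans (ler_rnormB _ _ _) _; rewrite mulrDl mul1r lerD2l.
have [|c [y [dg y1 gy]]] := bounded_functional_normalize bg (x0 := x0).
  by rewrite -(rnorm_eq0 S) fw rnorm_eq0.
exists (fun x => c * f (x - P x)), y; split => // x /Ps ->.
by rewrite subrr dual_ball0// mulr0.
Qed.

End dual_ball.
End hahn_banach.

(** * The Josefson-Nissenzweig theorem *)

Definition infinitely_often (P : nat -> Prop) :=
  forall N, exists2 n, (N <= n)%N & P n.

Lemma not_infinitely_often (P : nat -> Prop) :
  ~ infinitely_often P -> exists N, forall n, (N <= n)%N -> ~ P n.
Proof.
move=> /existsNP[N HN]; exists N => n Nn Pn; apply: HN.
by exists n.
Qed.

Lemma infinitely_often_sub (P Q : nat -> Prop) :
  (forall n, P n -> Q n) -> infinitely_often P -> infinitely_often Q.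
Proof. by move=> PQ H N; have [n Nn /PQ Qn] := H N; exists n. Qed.

Lemma infinitely_oftenU (P Q : nat -> Prop) :
  infinitely_often (fun n => P n \/ Q n) ->
  infinitely_often P \/ infinitely_often Q.
Proof.
move=> H; have [|/not_infinitely_often[N HN]] := pselect (infinitely_often P).
  by left.
right=> M; have [n] := H (maxn N M); rewrite geq_max => /andP[Nn Mn].
by case=> [/(HN _ Nn)//|Qn]; exists n.
Qed.

Lemma infinitely_often_ultra (U : set_system nat) (P : nat -> Prop) :
  ProperFilter U -> \oo `<=` U -> U [set n | P n] -> infinitely_often P.
Proof.
move=> UU ooU UP N.
have UN : U [set n | (N <= n)%N] by apply: ooU; exists N.
by have [n [/= Pn Nn]] := filter_ex (filterI UP UN); exists n.
Qed.

(** * Dyadic convex blocks and their oscillation *)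

Section blocks.
Variables (R : realType) (K : numFieldType) (S : real_structure R K).
Variable V : normedModType K.
Local Notation ofR := (ofR S).
Local Notation re := (re S).
Local Notation imu := (imu S).
Local Notation rnorm := (rnorm S).
Local Notation dual_ball := (@dual_ball R K S V).
Implicit Types (f g h : nat -> V -> K) (A B : set (V -> K)).

Definition midpoint (p q : V -> K) : V -> K := fun x => ofR 2^-1 * (p x + q x).

Definition midpoint_closed A := forall p q, A p -> A q -> A (midpoint p q).

(** The dyadic convex hull: closing under midpoints alone keeps the hull of a sequence countable, so
    that it can be listed in [independent_functionals]. *)
Definition hull A : set (V -> K) :=
  [set p | forall B, midpoint_closed B -> A `<=` B -> B p].

Lemma hull_min A B : midpoint_closed B -> A `<=` B -> hull A `<=` B.
Proof. by move=> mB AB p; exact. Qed.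

Lemma sub_hull A : A `<=` hull A.
Proof. by move=> p Ap B _; exact. Qed.

Lemma midpoint_closed_hull A : midpoint_closed (hull A).
Proof. by move=> p q hp hq B mB AB; exact: mB (hp _ mB AB) (hq _ mB AB). Qed.

Lemma hull_sub A B : A `<=` hull B -> hull A `<=` hull B.
Proof. by apply: hull_min; exact: midpoint_closed_hull. Qed.

Lemma hullS A B : A `<=` B -> hull A `<=` hull B.
Proof. by move=> AB; apply: hull_sub; exact: subset_trans AB (@sub_hull B). Qed.

Lemma re_half a b : re (ofR 2^-1 * (a + b)) = (re a + re b) / 2.
Proof. by rewrite reZ reD mulrC. Qed.

Lemma midpoint_closed_lt x b : midpoint_closed [set p | re (p x) < b].
Proof. by move=> p q /= hp hq; rewrite re_half; lra. Qed.

Lemma midpoint_closed_gt x b : midpoint_closed [set p | b < re (p x)].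
Proof. by move=> p q /= hp hq; rewrite re_half; lra. Qed.

Lemma midpoint_closed_ge x b : midpoint_closed [set p | b <= re (p x)].
Proof. by move=> p q /= hp hq; rewrite re_half; lra. Qed.

Lemma midpoint_closed_vanish x : midpoint_closed [set p | p x = 0].
Proof. by move=> p q /= hp hq; rewrite /midpoint hp hq addr0 mulr0. Qed.

Lemma rnorm_half : rnorm (ofR 2^-1) = 2^-1.
Proof. by rewrite rnorm_ofR ger0_norm// invr_ge0. Qed.

Lemma midpoint_closed_dual_ball : midpoint_closed dual_ball.
Proof.
move=> p q dp dq; split=> [a x y|x].
  by rewrite /midpoint dp.1 dq.1; ring.
rewrite rnormM rnorm_half; have := ler_rnormD S (p x) (q x).
have := dual_ball_le dp x; have := dual_ball_le dq x; lra.
Qed.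

Definition tail g N : set (V -> K) := [set g i | i in [set i | (N <= i)%N]].

Lemma tailS g N M : (N <= M)%N -> tail g M `<=` tail g N.
Proof. by move=> NM _ [i /= Mi <-]; exists i => //=; exact: leq_trans Mi. Qed.

Definition block h g := forall N, exists M, forall n, (M <= n)%N ->
  hull (tail g N) (h n).

Lemma block_trans f g h : block h g -> block g f -> block h f.
Proof.
move=> hg gf N; have [M1 H1] := gf N; have [M2 H2] := hg M1.
exists M2 => n /H2; apply: hull_sub => _ [i /= M1i <-]; exact: H1.
Qed.

Lemma block_refl g : block g g.
Proof. by move=> N; exists N => n Nn; apply: sub_hull; exists n. Qed.

Lemma block_subseq g (e : nat -> nat) : (forall n, (n <= e n)%N) ->
  block (fun n => g (e n)) g.
Proof.
move=> ne N; exists N => n Nn; apply: sub_hull; exists (e n) => //=.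
exact: leq_trans (ne n).
Qed.

(** Otherwise a tail of [g] would lie in the half-space [re (p x) < b], which is midpoint closed and
    would thus contain a tail of [h]. *)
Lemma block_io_ge g h x b : block h g ->
  infinitely_often (fun n => b <= re (h n x)) ->
  infinitely_often (fun n => b <= re (g n x)).
Proof.
move=> hg hb; apply: contrapT => /not_infinitely_often[N HN].
have [M HM] := hg N; have [n Mn bn] := hb M.
have := HM _ Mn _ (@midpoint_closed_lt x b).
suff : tail g N `<=` [set p | re (p x) < b].
  by move=> H /(_ H) /=; rewrite ltNge bn.
by move=> _ [i /= Ni <-]; rewrite ltNge; apply/negP; exact: HN.
Qed.

Lemma block_io_le g h x b : block h g ->
  infinitely_often (fun n => re (h n x) <= b) ->
  infinitely_often (fun n => re (g n x) <= b).
Proof.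
move=> hg hb; apply: contrapT => /not_infinitely_often[N HN].
have [M HM] := hg N; have [n Mn bn] := hb M.
have := HM _ Mn _ (@midpoint_closed_gt x b).
suff : tail g N `<=` [set p | b < re (p x)].
  by move=> H /(_ H) /=; rewrite ltNge bn.
by move=> _ [i /= Ni <-]; rewrite ltNge; apply/negP; exact: HN.
Qed.

(** The supremum of this set is the supremum over the unit ball of limsup minus liminf of
    [re (g n x)], expressed through levels that are passed infinitely often. *)
Definition osc_set g : set R := [set t | exists x a b,
  [/\ rnorm x <= 1, t < b - a,
      infinitely_often (fun n => b <= re (g n x)) &
      infinitely_often (fun n => re (g n x) <= a)]].

Definition osc g : R := sup (osc_set g).

Definition in_dual g := forall n, dual_ball (g n).

Lemma block_osc_set g h : block h g -> osc_set h `<=` osc_set g.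
Proof.
move=> hg t [x [a [b [x1 tb hb ha]]]]; exists x, a, b; split => //.
  exact: block_io_ge hb.
exact: block_io_le ha.
Qed.

Lemma osc_set_has_sup g : in_dual g -> has_sup (osc_set g).
Proof.
move=> dg; split.
  exists (-1), 0, 0, 0; rewrite rnorm0; split => //; first by lra.
    by move=> N; exists N => //; rewrite (dual_ball0 (dg N)) re0.
  by move=> N; exists N => //; rewrite (dual_ball0 (dg N)) re0.
exists 2 => t [x [a [b [x1 tb /(_ 0%N)[n _ hb] /(_ 0%N)[m _ ha]]]]].
have := dual_ball_le1 (dg n) x1; have := dual_ball_le1 (dg m) x1.
have := abs_re_le_rnorm S (g n x); have := abs_re_le_rnorm S (g m x).
rewrite !ler_norml => /andP[? ?] /andP[? ?]; lra.
Qed.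

Lemma block_osc_le g h : in_dual g -> in_dual h -> block h g -> osc h <= osc g.
Proof.
move=> dg dh hg; apply: ge_sup; first by have [] := osc_set_has_sup dh.
move=> t /(block_osc_set hg); apply: ub_le_sup.
by have [] := osc_set_has_sup dg.
Qed.

Lemma lt_osc g t : in_dual g -> t < osc g -> osc_set g t.
Proof.
move=> dg tg.
have [|s [x [a [b [x1 sb hb ha]]]] ts] :=
  @sup_adherent _ (osc_set g) (osc g - t) _ (osc_set_has_sup dg).
  by rewrite subr_gt0.
exists x, a, b; split => //; rewrite /osc in ts *; lra.
Qed.

Lemma osc_ge g t : in_dual g -> osc_set g t -> t <= osc g.
Proof.
by move=> dg; apply: ub_le_sup; have [] := osc_set_has_sup dg.
Qed.

Definition stable g := forall h, in_dual h -> block h g -> osc g <= osc h.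

Lemma almost_minimal_block g e : in_dual g -> 0 < e ->
  exists h, [/\ in_dual h, block h g &
    forall h', in_dual h' -> block h' g -> osc h <= osc h' + e].
Proof.
move=> dg e0; pose A : set R :=
  [set osc h | h in [set h | in_dual h /\ block h g]].
have Ainf : has_inf A.
  split; first by exists (osc g), g => //; split => //; exact: block_refl.
  exists (-1) => _ [h [dh _] <-]; apply: osc_ge => //.
  exists 0, 0, 0; rewrite rnorm0; split => //; first by lra.
    by move=> N; exists N => //; rewrite (dual_ball0 (dh N)) re0.
  by move=> N; exists N => //; rewrite (dual_ball0 (dh N)) re0.
have [_ [h [dh hg] <-] he] := inf_adherent e0 Ainf.
exists h; split => // h' dh' hg'; apply: le_trans (ltW he) _.
by rewrite lerD2r; apply: ge_inf; [exact: Ainf.2|exists h'].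
Qed.

(** Successive blocks [G k.+1] of [G k] have oscillation minimal up to [1 / (k + 1)]. A diagonal
    sequence is a block of every [G k], so its oscillation cannot be lowered at all. *)
Lemma stable_block g : in_dual g -> exists h, [/\ in_dual h,
  block h g & stable h].
Proof.
move=> dg.
have /choice[stp stpP] (kf : nat * (nat -> V -> K)) :
    exists h, in_dual kf.2 -> [/\ in_dual h, block h kf.2 &
      forall h', in_dual h' -> block h' kf.2 -> osc h <= osc h' +
        kf.1.+1%:R^-1].
  have [df|ndf] := pselect (in_dual kf.2); last by exists kf.2.
  have [|h H] := @almost_minimal_block kf.2 kf.1.+1%:R^-1 df; last by exists h.
  by rewrite invr_gt0.
pose G := fix G k := if k is k'.+1 then stp (k', G k') else g.
have dG k : in_dual (G k).
  by elim: k => [//|k IH] /=; have [] := stpP (k, G k) IH.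
have GS k : block (G k.+1) (G k) by have [] := stpP (k, G k) (dG k).
have GG i j : (i <= j)%N -> block (G j) (G i).
  elim: j => [|j IH]; first by rewrite leqn0 => /eqP ->; exact: block_refl.
  rewrite leq_eqVlt => /predU1P[->|]; first exact: block_refl.
  by rewrite ltnS => /IH; apply: block_trans.
(* One index far enough out in [G k] serves all the earlier sequences [G i] at once. *)
have diag k : exists n, forall i, (i <= k)%N -> hull (tail (G i) k) (G k n).
  have /choice[M HM] (i : 'I_k.+1) : exists M, forall n, (M <= n)%N ->
      hull (tail (G i) k) (G k n).
    by apply: GG; rewrite -ltnS ltn_ord.
  exists (\max_(i < k.+1) M i) => i ik.
  by apply: (HM (Ordinal (ik : (i < k.+1)%N))); exact: leq_bigmax.
have /choice[d dP] := diag.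
pose h k := G k (d k).
have dh : in_dual h by move=> k; exact: dG.
have hG i : block h (G i).
  move=> N; exists (maxn N i) => n; rewrite geq_max => /andP[Nn In].
  have := dP n i In; apply: hullS; exact: tailS.
exists h; split => //; first exact: (hG 0%N).
move=> h' dh' hh'; apply/ler_addgt0Pr => e e0.
pose k := Num.truncn e^-1.
have ke : k.+1%:R^-1 <= e.
  rewrite invf_ple ?posrE ?ltr0Sn//; apply: ltW.
  by have /andP[] := @truncn_itv R e^-1 ltac:(by rewrite invr_ge0 ltW).
have [_ _ /(_ h' dh') H] := stpP (k, G k) (dG k).
apply: le_trans (block_osc_le (dG k.+1) dh (hG k.+1)) _.
apply: le_trans (H (block_trans hh' (hG k))) _.
by rewrite lerD2l.
Qed.

(** * Averages and Rademacher coefficients on the cube *)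

Section dyadic.
Implicit Types v : seq bool -> K.

Fixpoint mean m v : K := if m is m'.+1 then
  ofR 2^-1 * (mean m' (v \o cons true) + mean m' (v \o cons false)) else v [::].

(* The coefficient of [v] on the [k]-th Rademacher function of {0,1}^m, by
   recursion on the first coordinate. *)
Fixpoint rademacher m k v : K := match m, k with
  | 0%N, _ => 0
  | m'.+1, 0%N =>
      ofR 2^-1 * (mean m' (v \o cons true) - mean m' (v \o cons false))
  | m'.+1, k'.+1 => ofR 2^-1 *
      (rademacher m' k' (v \o cons true) + rademacher m' k' (v \o cons false))
  end.

Lemma re_mean_le m v b : (forall s, size s = m -> re (v s) <= b) ->
  re (mean m v) <= b.
Proof.
elim: m v => [|m IH] v H /=; first exact: H.
have := IH (v \o cons true) (fun s (sm : size s = m) =>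
  H (true :: s) (congr1 succn sm)).
have := IH (v \o cons false) (fun s (sm : size s = m) =>
  H (false :: s) (congr1 succn sm)).
by rewrite re_half; lra.
Qed.

Lemma meanN m v : mean m (fun s => - v s) = - mean m v.
Proof.
elim: m v => [//|m IH] v /=.
by rewrite (IH (v \o cons true)) (IH (v \o cons false)) -opprD mulrN.
Qed.

Lemma re_mean_ge m v b : (forall s, size s = m -> b <= re (v s)) ->
  b <= re (mean m v).
Proof.
move=> H; rewrite -[b]opprK lerNl -reN -meanN; apply: re_mean_le => s sm.
by rewrite reN lerN2 H.
Qed.

(** Each of the [2 ^ m] values has weight [2 ^ - m] in the mean and none exceeds [b], so a defect of
    one value is not compensated by the others. *)
Lemma re_mean_concentrate m v b e :
  (forall s, size s = m -> re (v s) <= b) -> b - e <= re (mean m v) ->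
  forall s, size s = m -> b - 2 ^+ m * e <= re (v s).
Proof.
elim: m v e => [|m IH] v e H /=.
  by rewrite expr0 mul1r => he s /size0nil ->.
have Ht s : size s = m -> re ((v \o cons true) s) <= b by move=> sm;
  apply: H => /=; rewrite sm.
have Hf s : size s = m -> re ((v \o cons false) s) <= b by move=> sm;
  apply: H => /=; rewrite sm.
rewrite re_half => he [//|c s] /= [sm].
have := re_mean_le Ht; have := re_mean_le Hf => mf mt.
rewrite exprSr -mulrA.
case: c; [apply: (IH (v \o cons true)) => //|apply: (IH (v \o cons false)) =>
  //].
  by lra.
by lra.
Qed.

Lemma mean_hull (A : set (V -> K)) m (f : seq bool -> V -> K) :
  (forall s, size s = m -> hull A (f s)) -> hull A (fun x => mean m (fun s =>
    f s x)).
Proof.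
elim: m f => [|m IH] f H /=; first exact: (H [::]).
apply: (@midpoint_closed_hull A _ _ (IH (f \o cons true) _) (IH (f \o cons
  false) _)).
  by move=> s sm; apply: H; rewrite /= sm.
by move=> s sm; apply: H; rewrite /= sm.
Qed.

Lemma mean_dual_ball m (f : seq bool -> V -> K) :
  (forall s, size s = m -> dual_ball (f s)) ->
  dual_ball (fun x => mean m (fun s => f s x)).
Proof.
elim: m f => [|m IH] f H /=; first exact: (H [::]).
apply: (@midpoint_closed_dual_ball _ _ (IH (f \o cons true) _) (IH (f \o cons
  false) _)).
  by move=> s sm; apply: H; rewrite /= sm.
by move=> s sm; apply: H; rewrite /= sm.
Qed.

Lemma dual_ball_half_diff p q : dual_ball p -> dual_ball q ->
  dual_ball (fun x => ofR 2^-1 * (p x - q x)).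
Proof.
move=> dp dq; split=> [a x y|x]; first by rewrite dp.1 dq.1; ring.
rewrite rnormM rnorm_half; have := ler_rnormB S (p x) (q x).
have := dual_ball_le dp x; have := dual_ball_le dq x; lra.
Qed.

Lemma rademacher_dual_ball m k (f : seq bool -> V -> K) :
  (forall s, size s = m -> dual_ball (f s)) ->
  dual_ball (fun x => rademacher m k (fun s => f s x)).
Proof.
elim: m k f => [|m IH] k f H /=.
  split=> [a x y|x]; first by rewrite mulr0 addr0.
  by rewrite rnorm0 rnorm_ge0.
have Ht s : size s = m -> dual_ball ((f \o cons true) s) by move=> sm;
  apply: H => /=; rewrite sm.
have Hf s : size s = m -> dual_ball ((f \o cons false) s) by move=> sm;
  apply: H => /=; rewrite sm.
case: k => [|k]; last exact: (midpoint_closed_dual_ball (IH k _ Ht) (IH k _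
  Hf)).
exact: (dual_ball_half_diff (mean_dual_ball Ht) (mean_dual_ball Hf)).
Qed.

(** The coefficient is half the difference of the averages over the faces where bit [k] is [true]
    and where it is [false]. *)
Lemma rademacher_ge m k v a b : (k < m)%N ->
  (forall s, size s = m -> if nth false s k then b <= re (v s) else re (v s)
    <= a) ->
  (b - a) / 2 <= re (rademacher m k v).
Proof.
elim: m k v => [//|m IH] [|k] v km H /=.
  have : b <= re (mean m (v \o cons true)).
    by apply: re_mean_ge => s sm; apply: (H (true :: s)); rewrite /= sm.
  have : re (mean m (v \o cons false)) <= a.
    by apply: re_mean_le => s sm; apply: (H (false :: s)); rewrite /= sm.
  by rewrite reZ reB; lra.
have : (b - a) / 2 <= re (rademacher m k (v \o cons true)).
  by apply: IH => // s sm; apply: (H (true :: s)); rewrite /= sm.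
have : (b - a) / 2 <= re (rademacher m k (v \o cons false)).
  by apply: IH => // s sm; apply: (H (false :: s)); rewrite /= sm.
by rewrite re_half; lra.
Qed.

(** Bessel's inequality. The mean is kept on the left so that the induction closes: the new mean and
    the coefficient of index [0] are half the sum and half the difference of the two old means, and
    the sum of their squares is the average of the old squares. *)
Lemma rademacher_bessel m v (B : R) : (forall s,
  size s = m -> `|re (v s)| <= B) ->
  \sum_(k < m) re (rademacher m k v) ^+ 2 + re (mean m v) ^+ 2 <= B ^+ 2.
Proof.
elim: m v => [|m IH] v H.
  rewrite big_ord0 add0r /= -real_normK ?num_real// ler_sqr ?nnegrE//;
    last first.
    by apply: le_trans (H [::] _).
  exact: H.
have Ht s : size s = m -> `|re ((v \o cons true) s)| <= B by move=> sm;
  apply: H => /=; rewrite sm.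
have Hf s : size s = m -> `|re ((v \o cons false) s)| <= B by move=> sm;
  apply: H => /=; rewrite sm.
have := IH _ Ht; have := IH _ Hf; rewrite big_ord_recl /=.
under [X in _ -> _ -> _ + X + _ <= _]eq_bigr do rewrite /= re_half.
rewrite reZ reB re_half.
set mt := re (mean m (v \o cons true)); set mf := re (mean m (v \o cons false)).
have : \sum_(k < m) ((re (rademacher m k (v \o cons true)) + re (rademacher m
  k (v \o cons false))) / 2) ^+ 2
  <= (\sum_(k < m) re (rademacher m k (v \o cons true)) ^+ 2 +
      \sum_(k < m) re (rademacher m k (v \o cons false)) ^+ 2) / 2.
  rewrite -big_split /= mulr_suml; apply: ler_sum => k _.
  set p := re _; set q := re _; have := sqr_ge0 (p - q); nra.
nra.
Qed.

End dyadic.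

(* The average [h] of [2 ^ m] subsequences of [g] oscillates as much as
   [g] at some point [x], which forces every single term of the average to
   be close to the extreme values of [g] at [x]. *)
Lemma oscillation_step g (m : nat) (e : seq bool -> nat -> nat) :
  in_dual g -> stable g -> 0 < osc g -> (forall s n, (n <= e s n)%N) ->
  exists x a b (u v : nat -> nat), [/\ rnorm x <= 1, osc g / 4 <= b - a,
    forall n, (n <= u n)%N /\ (n <= v n)%N &
    forall s n, size s = m -> b <= re (g (e s (u n)) x) /\ re (g (e s (v n))
      x) <= a].
Proof.
move=> dg sg w0 en; pose h n x := mean m (fun s => g (e s n) x).
have dh : in_dual h.
  by move=> n; apply: (@mean_dual_ball m (fun s => g (e s n))) => s _;
    exact: dg.
have hg : block h g.
  move=> N; exists N => n Nn;
    apply: (@mean_hull _ m (fun s => g (e s n))) => s _.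
  by apply: sub_hull; exists (e s n) => //=; exact: leq_trans Nn (en _ _).
(* Concentration loses a factor [2 ^ m]; with this [d], a defect of [2 * d] in the mean costs each
   single term at most [w / 4]. *)
set w := osc g in w0 *; pose d := w / (8 * 2 ^+ m).
have p1 : 1 <= 2 ^+ m :> R by rewrite exprn_ege1// ler1n.
have p0 : 0 < 2 ^+ m :> R by lra.
have d0 : 0 < d by rewrite divr_gt0// mulr_gt0.
have dw : 2 ^+ m * (2 * d) = w / 4.
  by rewrite /d; field; rewrite gt_eqF.
have dw8 : d <= w / 8.
  rewrite /d invfM mulrA ler_piMr//; first by rewrite divr_ge0// ltW.
  by rewrite invf_le1.
have [|x [a [b [x1 ba hb ha]]]] := @lt_osc h (w - d) dh.
  by apply: lt_le_trans (sg _ dh hg); rewrite ltrBlDr ltrDl.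
have gb := block_io_ge hg hb; have ga := block_io_le hg ha.
(* Passing [b + 2 * d] infinitely often would, together with the level [a], give [g] a gap larger
   than [w]. The bound below is symmetric. *)
have upper : exists N, forall n, (N <= n)%N -> re (g n x) <= b + 2 * d.
  have [H|/not_infinitely_often[N HN]] :=
      pselect (infinitely_often (fun n => b + 2 * d <= re (g n x))).
    have /(osc_ge dg) : osc_set g (w + d / 2).
      by exists x, a, (b + 2 * d); split => //; lra.
    by rewrite -/w; lra.
  by exists N => n /HN /negP; rewrite -ltNge => /ltW.
have lower : exists N, forall n, (N <= n)%N -> a - 2 * d <= re (g n x).
  have [H|/not_infinitely_often[N HN]] :=
      pselect (infinitely_often (fun n => re (g n x) <= a - 2 * d)).
    have /(osc_ge dg) : osc_set g (w + d / 2).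
      by exists x, (a - 2 * d), b; split => //; lra.
    by rewrite -/w; lra.
  by exists N => n /HN /negP; rewrite -ltNge => /ltW.
case: upper => Nu HNu; case: lower => Nl HNl.
have /choice[u uP] n : exists u, (n <= u)%N /\
    forall s, size s = m -> b - w / 4 <= re (g (e s u) x).
  have [u] := hb (maxn n Nu); rewrite geq_max => /andP[nu Nuu] bu.
  exists u; split => // s sm;
    apply: le_trans (_ : b + 2 * d - 2 ^+ m * (2 * d) <= _).
    by rewrite dw; lra.
  apply: (@re_mean_concentrate m (fun s => g (e s u) x)) => //.
    by move=> s' _; apply: HNu; exact: leq_trans Nuu (en _ _).
  by rewrite addrK.
have /choice[v vP] n : exists v, (n <= v)%N /\
    forall s, size s = m -> re (g (e s v) x) <= a + w / 4.
  have [v] := ha (maxn n Nl); rewrite geq_max => /andP[nv Nlv] av.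
  exists v; split => // s sm.
  have : - a + 2 * d - 2 ^+ m * (2 * d) <= re (- (g (e s v) x)).
    apply: (@re_mean_concentrate m (fun s => - g (e s v) x)) => //.
      move=> s' _; have := HNl (e s' v) (leq_trans Nlv (en _ _)).
      by rewrite reN; lra.
    by rewrite meanN reN addrK lerN2.
  by rewrite dw reN; lra.
exists x, (a + w / 4), (b - w / 4), u, v; split => //.
- by lra.
- by move=> n; split; [have [] := uP n|have [] := vP n].
- by move=> s n sm; split; [apply: (uP n).2|apply: (vP n).2].
Qed.

(** Iterating [oscillation_step] gives points [x k] and, for each [m], terms of [g] indexed by words
    of length [m]: bit [k] of the word decides on which side of a gap of width at least [osc g / 4]
    the term lies at [x k]. The functionals [f m k] are the Rademacher coefficients of these
    terms. *)
Lemma rademacher_system g : in_dual g -> stable g -> 0 < osc g ->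
  exists (x : nat -> V) (f : nat -> nat -> V -> K),
  [/\ forall k, rnorm (x k) <= 1,
      forall m k, dual_ball (f m k),
      forall m y, \sum_(k < m) re (f m k y) ^+ 2 <= rnorm y ^+ 2 &
      forall m k, (k < m)%N -> osc g / 8 <= re (f m k (x k))].
Proof.
move=> dg sg w0; pose T := (V * R * R * (nat -> nat) * (nat -> nat))%type.
have /choice[stp stpP] (me : nat * (seq bool -> nat -> nat)) : exists d : T,
    (forall s n, (n <= me.2 s n)%N) ->
    [/\ rnorm d.1.1.1.1 <= 1, osc g / 4 <= d.1.1.2 - d.1.1.1.2,
      forall n, (n <= d.1.2 n)%N /\ (n <= d.2 n)%N &
      forall s n, size s = me.1 -> d.1.1.2 <= re (g (me.2 s (d.1.2 n))
        d.1.1.1.1) /\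
        re (g (me.2 s (d.2 n)) d.1.1.1.1) <= d.1.1.1.2].
  have [H|nH] := pselect (forall s n, (n <= me.2 s n)%N); last first.
    by exists (0, 0, 0, id, id) => H.
  have [x [a [b [u [v Hx]]]]] := oscillation_step me.1 dg sg w0 H.
  by exists (x, a, b, u, v).
(* Each word selects a subsequence of [g]; its last bit refines the previous one along the indices
   of high values or along those of low values. *)
pose E := fix E m : seq bool -> nat -> nat := if m is m'.+1 then
  fun s n => E m' (take m' s) ((if nth false s m' then (stp (m', E m')).1.2
    else (stp (m', E m')).2) n) else fun _ n => n.
have En m s n : (n <= E m s n)%N.
  elim: m s n => [//|m IH] s n /=; apply: leq_trans (IH _ _).
  have [_ _ /(_ n)[? ?] _] := stpP (m, E m) IH.
  by case: ifP.
pose d m := stp (m, E m).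
have dP m := stpP (m, E m) (En m).
have EP m k s n : (k < m)%N -> size s = m ->
    if nth false s k then (d k).1.1.2 <= re (g (E m s n) (d k).1.1.1.1)
    else re (g (E m s n) (d k).1.1.1.1) <= (d k).1.1.1.2.
  elim: m s n => [//|m IH] s n km sm /=.
  have stm : size (take m s) = m by rewrite size_takel// sm.
  have [->|kneqm] := eqVneq k m.
    have [_ _ _ H] := dP m.
    by case: (nth false s m); [apply: (H _ _ stm).1|apply: (H _ _ stm).2].
  have ltkm : (k < m)%N by rewrite ltn_neqAle kneqm -ltnS.
  by have := IH (take m s) ((if nth false s m then (stp (m, E m)).1.2
    else (stp (m, E m)).2) n) ltkm stm; rewrite nth_take.
exists (fun k => (d k).1.1.1.1), (fun m k y => rademacher m k (fun s =>
  g (E m s 0%N) y)).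
split.
- by move=> k; have [] := dP k.
- by move=> m k; apply: (@rademacher_dual_ball m k (fun s =>
  g (E m s 0%N))) => s _.
- move=> m y; have := @rademacher_bessel m (fun s => g (E m s 0%N) y) (rnorm y).
  have := sqr_ge0 (re (mean m (fun s => g (E m s 0%N) y))) => sq0 H.
  apply: le_trans (H _); first by rewrite lerDl.
  move=> s _; apply: le_trans (abs_re_le_rnorm _ _) _;
    exact: dual_ball_le (dg _) _.
- move=> m k km; have [_ dk _ _] := dP k.
  have := @rademacher_ge m k (fun s => g (E m s 0%N) (d k).1.1.1.1) _ _ km
    (fun s sm => EP m k s 0%N km sm).
  by rewrite -/(d k) in dk *; lra.
Qed.

End blocks.

Lemma nonprincipal_ultrafilter (A : set nat) :
  infinitely_often A ->
  exists U : set_system nat, [/\ UltraFilter U, \oo `<=` U & U A].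
Proof.
move=> ioA; pose F : set_system nat := filter_from [set: nat] (fun N =>
  [set n | (N <= n)%N /\ A n]).
have FF : ProperFilter F.
  apply: filter_from_proper; last by move=> N _; have [n Nn An] := ioA N;
    exists n.
  apply: filter_from_filter; first by exists 0%N.
  move=> i j _ _; exists (maxn i j) => // n [/=].
  by rewrite geq_max => /andP[iN jn] An; split.
have [U [UU FU]] := ultraFilterLemma FF.
exists U; split => //.
  by move=> B [N _ HN]; apply: FU; exists N => // n [/HN].
by apply: FU; exists 0%N => // n [].
Qed.

Lemma square_summable_small (R : realType) (c : nat -> R) (B : R) :
  (forall M, \sum_(k < M) c k ^+ 2 <= B) ->
  forall e, 0 < e -> exists N, forall n, (N <= n)%N -> `|c n| < e.
Proof.
move=> cB e e0; apply: contrapT => H.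
have io : infinitely_often (fun n => e <= `|c n|).
  move=> N; apply: contrapT => HN; apply: H; exists N => n Nn.
  by rewrite ltNge; apply/negP => en; apply: HN; exists n.
have big m : exists M, m%:R * e ^+ 2 <= \sum_(k < M) c k ^+ 2.
  elim: m => [|m [M HM]]; first by exists 0%N; rewrite mul0r big_ord0.
  have [n Mn en] := io M; exists n.+1.
  rewrite big_ord_recr /= -natr1 mulrDl mul1r lerD//.
    apply: le_trans HM _; rewrite -!(big_mkord xpredT (fun k => c k ^+ 2)).
    rewrite (big_cat_nat (n := M) (p := n))//= lerDl.
    by apply: sumr_ge0 => k _; exact: sqr_ge0.
  by rewrite -[X in _ <= X]real_normK ?num_real// ler_sqr ?nnegrE// ltW.
have [M HM] := big (Num.truncn (B / e ^+ 2)).+1.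
have e20 : 0 < e ^+ 2 by rewrite exprn_gt0.
have := le_trans HM (cB M); rewrite leNgt -ltr_pdivrMr// => /negP; apply.
have [B0|B0] := leP 0 (B / e ^+ 2); first by have /andP[] := truncn_itv B0.
by apply: lt_le_trans B0 _; rewrite ler0n.
Qed.

Section josefson_nissenzweig.
Variables (R : realType) (K : numFieldType) (S : real_structure R K).
Variable V : normedModType K.
Local Notation ofR := (ofR S).
Local Notation re := (re S).
Local Notation imu := (imu S).
Local Notation rnorm := (rnorm S).
Local Notation dual_ball := (@dual_ball R K S V).
Local Notation midpoint := (@midpoint R K S V).
Local Notation midpoint_closed := (@midpoint_closed R K S V).
Local Notation hull := (@hull R K S V).
Local Notation block := (@block R K S V).
Local Notation osc := (@osc R K S V).
Local Notation osc_set := (@osc_set R K S V).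
Local Notation in_dual := (@in_dual R K S V).
Implicit Types f g : nat -> V -> K.

Definition weak_star_null f :=
  forall y e, 0 < e -> exists N, forall n, (N <= n)%N -> rnorm (f n y) < e.

Lemma weak_star_null_of_re f : in_dual f ->
  (forall y e, 0 < e -> exists N, forall n, (N <= n)%N -> `|re (f n y)| < e) ->
  weak_star_null f.
Proof.
move=> df H y e e0; have e20 : 0 < e / 2 by rewrite divr_gt0.
have [N1 H1] := H y _ e20; have [N2 H2] := H (imu *: y) _ e20.
exists (maxn N1 N2) => n; rewrite geq_max => /andP[/H1 h1 /H2 h2].
have := rnorm_le_re S (f n y); rewrite -(dual_ballZ (df n)); lra.
Qed.

Definition josefson_nissenzweig_sequence := exists c f (x : nat -> V),
  [/\ 0 < c, in_dual f, weak_star_null f &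
    forall k, rnorm (x k) <= 1 /\ c <= rnorm (f k (x k))].

(** For fixed [k], let [m] tend to infinity along an ultrafilter in the Rademacher system. Bessel's
    inequality becomes square summability at each point, which gives weak-star nullity, and the
    lower bound at [x k] is preserved. *)
Lemma jn_of_oscillation g : in_dual g -> stable S g -> 0 < osc g ->
  josefson_nissenzweig_sequence.
Proof.
move=> dg sg w0.
have [x [f [x1 df bes fx]]] := rademacher_system dg sg w0.
have ioT : infinitely_often [set: nat] by move=> N; exists N.
have [U [UU ooU _]] := nonprincipal_ultrafilter ioT.
have /choice[F FP] k : exists F : V -> K, dual_ball F /\
    forall y, (f m k y : K^o) @[m --> U] --> (F y : K^o).
  by have [F dF fF] := ultra_dual_ball UU (fun m => df m k); exists F.
have rF k y : re (f m k y) @[m --> U] --> re (F k y).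
  apply/cvgrPdist_lt => e e0.
  have /(cvg_rnormP S)/(_ e e0) := (FP k).2 y; apply: filterS => m /=.
  by rewrite distrC -reB => /(le_lt_trans _); apply; exact: abs_re_le_rnorm.
have UP (N : nat) (P : nat -> Prop) :
    (forall m, (N <= m)%N -> P m) -> U [set m | P m].
  by move=> H; apply: ooU; exists N.
have FB M y : \sum_(k < M) re (F k y) ^+ 2 <= rnorm y ^+ 2.
  have : \sum_(k < M) re (f m k y) ^+ 2 @[m --> U] --> \sum_(k < M) re (F k
    y) ^+ 2.
    elim: M => [|M IH].
      rewrite big_ord0; under eq_fun do rewrite big_ord0; exact: cvg_cst.
    rewrite big_ord_recr /=; under eq_fun do rewrite big_ord_recr /=.
    by apply: cvgD => //; rewrite expr2; under eq_fun do rewrite expr2;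
      exact: cvgM.
  move=> cv; rewrite leNgt; apply/negP => lt.
  have /cvgrPdist_lt/(_ _ (_ : 0 < _ - _)) := cv.
  move=> /(_ (\sum_(k < M) re (F k y) ^+ 2) (rnorm y ^+ 2)).
  rewrite subr_gt0 => /(_ lt) Um.
  have [m [/= Mm]] := filter_ex (filterI (UP M (fun m =>
    (M <= m)%N) (fun m H => H)) Um).
  have := bes m y; have : \sum_(k < M) re (f m k y) ^+ 2 <= \sum_(k < m) re
    (f m k y) ^+ 2.
    rewrite -!(big_mkord xpredT (fun k => re (f m k y) ^+ 2)).
    rewrite (big_cat_nat (n := M) (p := m))//= lerDl.
    by apply: sumr_ge0 => k _; exact: sqr_ge0.
  move=> h1 h2; rewrite ltr_norml => /andP[_]; lra.
exists (osc g / 8), F, x; split.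
- by rewrite divr_gt0.
- by move=> k; exact: (FP k).1.
- apply: weak_star_null_of_re; first by move=> k; exact: (FP k).1.
  by move=> y; exact: (square_summable_small (fun M => FB M y)).
- move=> k; split; first exact: x1.
  apply: le_trans (re_le_rnorm _ _); rewrite leNgt; apply/negP => lt.
  have /cvgrPdist_lt/(_ (osc g / 8 - re (F k (x k)))) := rF k (x k).
  rewrite subr_gt0 => /(_ lt) Um.
  have [m [/= km]] := filter_ex (filterI (UP k.+1 (fun m =>
    (k < m)%N) (fun m H => H)) Um).
  by have := fx m k km; rewrite ltr_norml => h /andP[]; lra.
Qed.

(* Each element [h] of the hull is one of the countably many dyadic
   averages of the [f n], and [f n] is chosen to vanish at points almost
   norming the first of them. *)
Lemma independent_functionals : ~ finite_dimensional V ->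
  exists f (y : nat -> V), [/\ in_dual f,
    forall k, rnorm (y k) <= 1 /\ 2^-1 <= rnorm (f k (y k)) &
    forall h, hull (tail f 0) h -> exists z, [/\ rnorm z <= 1,
      forall x, rnorm (h x) <= 2 * rnorm (h z) * rnorm x &
      exists N, forall n, (N <= n)%N -> f n z = 0]].
Proof.
move=> infV.
have /choice[zz zzP] (h : V -> K) : exists z, dual_ball h -> rnorm z <= 1 /\
    forall x, rnorm (h x) <= 2 * rnorm (h z) * rnorm x.
  have [dh|ndh] := pselect (dual_ball h); last by exists 0.
  have [h0|/existsNP[x0 hx0]] := pselect (forall x, h x = 0).
    by exists 0 => _; rewrite rnorm0; split => // x;
      rewrite !h0 rnorm0 mulr0 mul0r.
  have bh : bounded_functional S h.
    by split; [exact: dh.1|exists 1 => x; rewrite mul1r dual_ball_le].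
  have [|c [z [dch z1 cz]]] := bounded_functional_normalize bh (x0 := x0).
    by apply/eqP.
  have c0 : 0 < rnorm c.
    rewrite lt_neqAle rnorm_ge0 andbT eq_sym; apply/negP => /eqP c0.
    by move: cz; rewrite rnormM c0 mul0r; lra.
  exists z => _; split => // x.
  have := dual_ball_le dch x; rewrite rnormM => h1; rewrite rnormM in cz.
  rewrite -(ler_pM2l c0); apply: le_trans h1 _.
  have := rnorm_ge0 S x => x0';
    have -> : rnorm c * (2 * rnorm (h z) * rnorm x) =
    2 * (rnorm c * rnorm (h z)) * rnorm x by ring.
  by rewrite ler_peMl//; lra.
have /choice[nxt nxtP] (L : seq (V -> K)) : exists fy : (V -> K) * V,
    [/\ dual_ball fy.1, rnorm fy.2 <= 1, 2^-1 <= rnorm (fy.1 fy.2) &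
     forall h, h \in L -> fy.1 (zz h) = 0].
  have [f [y [df y1 f0 fy]]] := dual_ball_vanishing S [seq zz h | h <- L] infV.
  by exists (f, y); split => // h hL; apply: f0; exact: map_f.
(* The lists increase, and their union contains every [f n] and is closed under midpoints, so it
   contains the whole hull. *)
pose L := fix L n : seq (V -> K) := if n is n'.+1 then
  L n' ++ (nxt (L n')).1 :: [seq midpoint p q | p <- L n', q <- L n'] else [::].
pose f n := (nxt (L n)).1.
have LS n : {subset L n <= L n.+1} by move=> h hL /=; rewrite mem_cat hL.
have LL n m : (n <= m)%N -> {subset L n <= L m}.
  elim: m => [|m IH]; first by rewrite leqn0 => /eqP ->.
  rewrite leq_eqVlt => /predU1P[->//|]; rewrite ltnS => /IH H h /H.
  exact: LS.
have df : in_dual f by move=> n; have [] := nxtP (L n).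
exists f, (fun n => (nxt (L n)).2); split => //.
  by move=> n; have [] := nxtP (L n).
move=> h hh.
have dh : dual_ball h.
  by apply: (hull_min (@midpoint_closed_dual_ball _ _ S V) _ hh) =>
    _ [i _ <-]; exact: df.
have [N hN] : exists N, h \in L N.
  apply: (hh [set h | exists N, h \in L N]).
    move=> p q [N1 p1] [N2 q2]; exists (maxn N1 N2).+1 => /=.
    rewrite mem_cat inE; apply/orP; right; apply/orP; right; apply/allpairsP.
    exists (p, q); split => //=.
      by apply: LL p1; exact: leq_maxl.
    by apply: LL q2; exact: leq_maxr.
  by move=> _ [i _ <-]; exists i.+1; rewrite /= mem_cat inE eqxx orbT.
have [z1 zh] := zzP h dh; exists (zz h); split => //.
exists N => n Nn; have [_ _ _] := nxtP (L n); apply.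
exact: LL hN.
Qed.

(** Let [h] be the limit along an ultrafilter. At a point of the ball, values at distance [e] from
    [h] infinitely often, with values within [e / 2] of it infinitely often, would give a positive
    oscillation. The factor [1 / 2] keeps the differences in the dual ball. *)
Lemma no_oscillation_cvg g : in_dual g -> osc g <= 0 ->
  exists2 h, dual_ball h & weak_star_null (fun n => fun x =>
    ofR 2^-1 * (g n x - h x)) /\
    forall z, (exists N, forall n, (N <= n)%N -> g n z = 0) -> h z = 0.
Proof.
move=> dg w0.
have ioT : infinitely_often [set: nat] by move=> N; exists N.
have [U [UU ooU _]] := nonprincipal_ultrafilter ioT.
have [h dh gh] := ultra_dual_ball UU dg.
have near_h x e : 0 < e -> infinitely_often (fun n =>
  `|re (g n x) - re (h x)| < e).
  move=> e0; apply: (@infinitely_often_ultra U) => //.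
  have /(cvg_rnormP S)/(_ e e0) := gh x; apply: filterS => n /=.
  by rewrite -reB; exact/le_lt_trans/abs_re_le_rnorm.
have ball_cvg x e : rnorm x <= 1 -> 0 < e ->
    exists N, forall n, (N <= n)%N -> `|re (g n x) - re (h x)| < e.
  move=> x1 e0; apply: contrapT => H.
  have : infinitely_often (fun n =>
    re (h x) + e <= re (g n x) \/ re (g n x) <= re (h x) - e).
    move=> N; apply: contrapT => HN; apply: H; exists N => n Nn.
    rewrite ltr_norml; apply/andP; split; rewrite ltNge; apply/negP => le;
      apply: HN; exists n => //.
      by right; lra.
    by left; lra.
  have e20 : 0 < e / 2 by rewrite divr_gt0.
  have near2 := near_h x _ e20.
  move=> /infinitely_oftenU[io|io].
    have /(osc_ge dg) : osc_set g (e / 4); last by lra.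
    exists x, (re (h x) + e / 2), (re (h x) + e); split => //; first by lra.
    by apply: infinitely_often_sub near2 => n; rewrite ltr_norml => /andP[_];
      lra.
  have /(osc_ge dg) : osc_set g (e / 4); last by lra.
  exists x, (re (h x) - e), (re (h x) - e / 2); split => //; first by lra.
  by apply: infinitely_often_sub near2 => n; rewrite ltr_norml => /andP[]; lra.
exists h => //; split.
  apply: weak_star_null_of_re.
    by move=> n; apply: dual_ball_half_diff => //; exact: dg.
  move=> y e e0; pose c := (1 + rnorm y)^-1.
  have y0 := rnorm_ge0 S y.
  have c0 : 0 < c by rewrite invr_gt0; lra.
  have cy : rnorm (ofR c *: y) <= 1.
    by rewrite rnormZ rnorm_ofR gtr0_norm// mulrC ler_pdivrMr; lra.
  have [N HN] := ball_cvg _ (c * e) cy (mulr_gt0 c0 e0).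
  exists N => n /HN; rewrite (dual_ballZ (dg n)) (dual_ballZ dh) !reZ -mulrBr.
  rewrite normrM gtr0_norm// ltr_pM2l// reB => lt.
  rewrite normrM gtr0_norm ?invr_gt0//.
  by have := normr_ge0 (re (g n y) - re (h y)); lra.
move=> z [N HN].
have UN : U [set n | (N <= n)%N] by apply: ooU; exists N.
apply/eqP; rewrite -(rnorm_eq0 S); apply/negPn/negP => hz.
have hz0 : 0 < rnorm (h z) by rewrite lt_neqAle eq_sym hz rnorm_ge0.
have /(cvg_rnormP S)/(_ _ hz0) Uh := gh z.
have [n [/= /HN ->]] := filter_ex (filterI UN Uh).
by rewrite sub0r rnormN ltxx.
Qed.

Theorem josefson_nissenzweig : ~ finite_dimensional V ->
  josefson_nissenzweig_sequence.
Proof.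
move=> /independent_functionals[f [y [df fy hf]]].
have [wf|nwf] := pselect (weak_star_null f).
  by exists 2^-1, f, y; split => //; rewrite invr_gt0.
(* A large modulus at [x] gives a large real part at one of [x], [- x], [imu *: x] and
   [- (imu *: x)]. *)
have [x [e [e0 io]]] : exists x e, 0 < e /\ infinitely_often (fun n =>
  e <= re (f n x)).
  move: nwf => /existsNP[x /existsNP[e /not_implyP[e0 H]]].
  have io : infinitely_often (fun n => e <= rnorm (f n x)).
    move=> N; apply: contrapT => HN; apply: H; exists N => n Nn.
    by rewrite ltNge; apply/negP => en; apply: HN; exists n.
  have cases z : infinitely_often (fun n => e / 2 <= `|re (f n z)|) ->
      exists x e, 0 < e /\ infinitely_often (fun n => e <= re (f n x)).
    move=> ioz; have : infinitely_often (fun n =>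
      e / 2 <= re (f n z) \/ e / 2 <= re (f n (- z))).
      apply: infinitely_often_sub ioz => n; rewrite (dual_ballN (df n)) reN.
      by case: (ger0P (re (f n z))) => _; [left|right].
    move=> /infinitely_oftenU[ioz'|ioz']; first by exists z, (e / 2);
      split => //; rewrite divr_gt0.
    by exists (- z), (e / 2); split => //; rewrite divr_gt0.
  have : infinitely_often (fun n =>
    e / 2 <= `|re (f n x)| \/ e / 2 <= `|re (f n (imu *: x))|).
    apply: infinitely_often_sub io => n en.
    have := rnorm_le_re S (f n x); rewrite -(dual_ballZ (df n)) => h.
    by case: (leP (e / 2) `|re (f n x)|) => h'; [left|right; lra].
  by move=> /infinitely_oftenU[/cases|/cases].
have /choice[s sP] n : exists k, (n <= k)%N /\ e <= re (f k x).
  by have [k nk ek] := io n; exists k.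
have dfs : in_dual (fun n => f (s n)) by move=> n; exact: df.
have [g [dg gfs sg]] := stable_block dfs.
have gf : block g f by apply: block_trans gfs _; apply: block_subseq => n;
  exact: (sP n).1.
have [w0|w0] := ltP 0 (osc g); first exact: jn_of_oscillation w0.
have [h dh [gh h0]] := no_oscillation_cvg dg w0.
have [M1 HM1] := gfs 0%N; have [M2 HM2] := gf 0%N.
have x0 : 0 < rnorm x.
  have := dual_ball_le (dfs 0%N) x; have := re_le_rnorm S (f (s 0%N) x).
  by have := (sP 0%N).2; lra.
(* Every block of the chosen subsequence keeps real part at least [e] at [x], so it is at least
   [e / (2 * rnorm x)] at its almost norming point [z]. There [h] vanishes, since almost all [f i]
   do; halving gives the constant. *)
have /choice[z zP] n : exists z, rnorm z <= 1 /\
    e / (4 * rnorm x) <= rnorm (ofR 2^-1 * (g (n + maxn M1 M2)%N z - h z)).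
  set m := (n + _)%N.
  have m1 : (M1 <= m)%N by rewrite (leq_trans (leq_maxl M1 M2))// leq_addl.
  have m2 : (M2 <= m)%N by rewrite (leq_trans (leq_maxr M1 M2))// leq_addl.
  have [z [z1 gz [N HN]]] := hf _ (HM2 m m2).
  exists z; split => //.
  rewrite h0; last first.
    have [M3 HM3] := gf N; exists M3 => k /HM3 hk.
    apply: (hull_min (@midpoint_closed_vanish _ _ S V z) _ hk) =>
      _ [i /= Ni <-].
    exact: HN.
  have gx : e <= re (g m x).
    apply: (hull_min (@midpoint_closed_ge _ _ S V x e) _ (HM1 m m1)) =>
      _ [i _ <-].
    exact: (sP i).2.
  have := gz x; have := re_le_rnorm S (g m x).
  rewrite subr0 rnormM rnorm_half ler_pdivrMr ?mulr_gt0// => h1 h2.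
  by apply: le_trans gx _; apply: le_trans h1 _; apply: le_trans h2 _; lra.
exists (e / (4 * rnorm x)), (fun n => fun y =>
  ofR 2^-1 * (g (n + maxn M1 M2)%N y - h y)), z.
split => //.
- by rewrite divr_gt0// mulr_gt0.
- by move=> n; apply: dual_ball_half_diff => //; exact: dg.
- move=> y' e' e'0; have [N HN] := gh y' e' e'0; exists N => n Nn; apply: HN.
  exact: leq_trans Nn (leq_addr _ _).
Qed.

End josefson_nissenzweig.

(** * Infinite sets of indices *)

Lemma infinitely_often_enum (A : set nat) : infinitely_often A ->
  exists2 s : nat -> nat, (forall n, A (s n)) & injective s.
Proof.
move=> /(_ _)/cid2-/all_sig2[pick pickN pickA].
pose s := fix s n := if n is n'.+1 then pick (s n').+1 else pick 0%N.
exists s; first by case=> [|n] /=; exact: pickA.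
have smono : {homo s : m n / (m < n)%N}.
  by apply: homo_ltn; [exact: ltn_trans|move=> n /=; exact: pickN].
move=> m n smn; have [/smono|/smono|//] := ltngtP m n; by rewrite smn ltnn.
Qed.

Lemma injective_infinitely_often (j : nat -> nat) : injective j ->
  infinitely_often (range j).
Proof.
move=> ij N; apply: contrapT => H.
have jN n : (j n < N)%N.
  by rewrite ltnNge; apply/negP => Nj; apply: H; exists (j n) => //; exists n.
pose h (i : 'I_N.+1) : 'I_N := Ordinal (jN i).
have ih : injective h by move=> a b /(congr1 val) /= /ij /val_inj.
by have := leq_card h ih; rewrite !card_ord ltnn.
Qed.

(* [logn 2] has infinite fibres and splits an enumeration of [A]. *)
Lemma infinite_partition (A : set nat) : infinitely_often A ->
  exists B : nat -> set nat, [/\ forall p, B p `<=` A,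
    forall p, infinitely_often (B p) &
    forall p q k, B p k -> B q k -> p = q].
Proof.
move=> /infinitely_often_enum[s sA sinj].
exists (fun p => [set s i | i in [set i | logn 2 i = p]]); split.
- by move=> p _ [i _ <-].
- move=> p; apply: infinitely_often_sub (injective_infinitely_often (j :=
  fun q => s (2 ^ p * q.*2.+1)%N) _).
    move=> _ [q _ <-]; exists (2 ^ p * q.*2.+1)%N => //=.
    rewrite lognM ?expn_gt0// pfactorK// (_ : logn 2 _ = 0%N) ?addn0//.
    by rewrite lognE /= dvdn2 /= odd_double.
  move=> a b /sinj /eqP; rewrite eqn_pmul2l ?expn_gt0// => /eqP[] /double_inj.
  exact.
- by move=> p q _ [i <- <-] [j <- /sinj ->].
Qed.

(* Rosenthal's lemma: if no piece [B p] of a partition of [A] works,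
   selecting one bad row from each piece gives a set on which the row sums
   drop by [e]. *)
Lemma rosenthal_disjoint (R : realType) (a : nat -> nat -> R) (C e : R)
    (A : set nat) :
  (forall j k, 0 <= a j k) -> (forall j n, \sum_(k < n) a j k <= C) -> 0 < e ->
  infinitely_often A ->
  exists B : set nat, [/\ B `<=` A, infinitely_often B &
    forall j, B j -> forall n,
      \sum_(k < n | (val k \in B) && (val k != j)) a j k <= e].
Proof.
move=> a0 aC e0 ioA.
have Cr : C <= (Num.truncn (C / e)).+1%:R * e.
  rewrite -ler_pdivrMr//; have [Ce|Ce] := leP 0 (C / e).
    by apply: ltW; have /andP[] := truncn_itv Ce.
  by apply: le_trans (ltW Ce) _.
have : forall j, A j -> forall n, \sum_(k < n | val k \in A) a j k <=
    (Num.truncn (C / e)).+1%:R * e.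
  move=> j _ n; apply: le_trans Cr; apply: le_trans (aC j n).
  rewrite [leRHS](bigID (fun k : 'I_n => val k \in A)) /= lerDl.
  by apply: sumr_ge0 => k _.
(* Induction on the number of drops by [e] that the row sums over [A] still allow; at [0] these sums
   vanish. *)
elim: (Num.truncn (C / e)).+1 A ioA => [|r IH] A ioA HA.
  exists A; split => // j Aj n; apply: le_trans (ltW e0).
  apply: le_trans (_ : \sum_(k < n | val k \in A) a j k <= _); last first.
    by have := HA j Aj n; rewrite mul0r.
  rewrite [leRHS](bigID (fun k : 'I_n => val k != j)) /= lerDl.
  by apply: sumr_ge0 => k _.
have [B [BA ioB Bdisj]] := infinite_partition ioA.
have [[p Hp]|H] := pselect (exists p, forall j, B p j -> forall n,
    \sum_(k < n | (val k \in B p) && (val k != j)) a j k <= e).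
  by exists (B p).
have /choice[j jP] p : exists j, B p j /\ exists n,
    e < \sum_(k < n | (val k \in B p) && (val k != j)) a j k.
  move/forallNP: (H) => /(_ p) /existsNP[j /not_implyP[Bj /existsNP[n Hn]]].
  by exists j; split => //; exists n; rewrite ltNge; apply/negP.
have jinj : injective j.
  by move=> p q pq; apply: Bdisj (jP p).1 _; rewrite pq; exact: (jP q).1.
have jA : range j `<=` A by move=> _ [p _ <-]; exact: BA (jP p).1.
have [|D [DA' ioD HD]] := IH (range j) (injective_infinitely_often jinj);
  last first.
  by exists D; split => //; exact: subset_trans DA' jA.
move=> _ [p _ <-] n; have [_ [m Hm]] := jP p.
have := HA _ (BA _ _ (jP p).1) (maxn n m).
rewrite -natr1 mulrDl mul1r => sA.
(* Of the bad rows only [j p] lies in [B p], so the two sums run over disjoint parts of [A]. The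
   second one exceeds [e]. *)
suff : \sum_(k < n | val k \in range j) a (j p) k +
   \sum_(k < m | (val k \in B p) && (val k != j p)) a (j p) k <=
   \sum_(k < maxn n m | val k \in A) a (j p) k by lra.
have widen q (P : pred nat) : (q <= maxn n m)%N ->
    \sum_(k < q | P k) a (j p) k <= \sum_(k < maxn n m | P k) a (j p) k.
  move=> qn; rewrite -!(big_mkord P (fun k => a (j p) k)).
  by rewrite (big_cat_nat (n := q) (p := maxn n m))//= lerDl sumr_ge0.
apply: le_trans (lerD (widen n (fun k => k \in range j) (leq_maxl _ _))
  (widen m (fun k => (k \in B p) && (k != j p)) (leq_maxr _ _))) _.
rewrite [leRHS](bigID (fun k : 'I_(maxn n m) => val k \in range j)) /=.
apply: lerD.
  rewrite [leLHS](eq_bigl (fun k : 'I_(maxn n m) =>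
    (val k \in A) && (val k \in range j)))//.
  move=> k /=; apply/idP/andP => [kj|[]//]; split => //.
  by apply/mem_set/jA/set_mem.
rewrite [leRHS](bigID (fun k : 'I_(maxn n m) =>
  (val k \in B p) && (val k != j p))) /=.
rewrite [leLHS](eq_bigl (fun k : 'I_(maxn n m) =>
  (val k \in A) && (val k \notin range j)
  && ((val k \in B p) && (val k != j p)))).
  by rewrite lerDl sumr_ge0.
move=> k /=; apply/idP/andP => [/andP[kB kj]|[]//]; split; last by rewrite kB.
apply/andP; split; first by apply/mem_set/(BA p)/set_mem.
apply/negP => /set_mem[q _ qk]; move/negP: kj; apply.
have : B q (val k) by have := (jP q).1; rewrite qk.
by move=> /(Bdisj _ _ _ (set_mem kB)) ->; rewrite qk eqxx.
Qed.

(** * Almost disjoint families *)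

Section almost_disjoint.

(** The nodes of the binary tree along the path [b], numbered by [pickle] and carried by [s] into
    the set that it enumerates. *)
Definition branch (s : nat -> nat) (b : nat -> bool) : set nat :=
  range (fun n => s (pickle (mkseq b n))).

Lemma infinite_branch s b : injective s -> infinitely_often (branch s b).
Proof.
move=> sinj; apply: injective_infinitely_often => m n /sinj.
move=> /(pcan_inj pickleK) /(congr1 size); by rewrite !size_mkseq.
Qed.

(** A common node has the same level on both branches, and this level is at most a coordinate [i]
    where they differ. *)
Lemma almost_disjoint_branches s b c : injective s -> b <> c ->
  exists N, forall k, (N <= k)%N -> ~ (branch s b k /\ branch s c k).
Proof.
move=> sinj bc.
have [i bci] : exists i, b i <> c i.
  by apply/existsNP => H; apply: bc; exact/funext.
exists (\max_(n < i.+1) s (pickle (mkseq b n))).+1 => k Nk [[n _ nk] [m _ mk]].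
have /sinj/(pcan_inj pickleK) bcn : s (pickle (mkseq b n)) = s (pickle (mkseq
  c m)).
  by rewrite nk mk.
have nm : n = m by have := congr1 size bcn; rewrite !size_mkseq.
subst m; have [ni|ni] := leqP n i.
  have := @leq_bigmax _ (fun n : 'I_i.+1 =>
    s (pickle (mkseq b n))) (Ordinal (ni : (n < i.+1)%N)).
  by rewrite /= nk => /(leq_trans Nk); rewrite ltnn.
apply: bci; rewrite -(nth_mkseq false b ni) -(nth_mkseq false c ni).
by rewrite bcn.
Qed.

(** If all fibres of [F] were finite, [nat -> bool] would be countable, against Cantor's diagonal.
    An infinite fibre contains an injective sequence. *)
Lemma uncountable_branches (F : (nat -> bool) -> nat) :
  exists (m : nat) (b : nat -> nat -> bool), injective b /\ forall i,
    F (b i) = m.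
Proof.
apply: contrapT => H.
have fin m : finite_set [set b | F b = m].
  apply: contrapT => /infiniteP /pcard_leP /unsquash f.
  apply: H; exists m, f; split=> [i j fij|i];
    last by have := @funS _ _ _ _ f i I.
  by apply: (@inj _ _ _ f); rewrite ?inE.
have : countable [set: nat -> bool].
  have -> : [set: nat -> bool] = \bigcup_(m in [set: nat]) [set b | F b = m].
    by rewrite predeqE => b; split => // _; exists (F b).
  by apply: bigcup_countable => // m _; exact: finite_set_countable.
move=> /countable_injP[f finj].
pose b n := ~~ `[< exists c : nat -> bool, f c = n /\ c n >].
have : b (f b) = ~~ b (f b); last by case: (b (f b)).
rewrite {1}/b; congr (~~ _); apply/asboolP/idP => [[c [cb ccb]]|bb].
  by move: ccb; rewrite (finj c b (mem_set I) (mem_set I) cb).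
by exists b.
Qed.

(* Whitley's argument: each [q r] is at least [1 / m] on finitely many
   members of an almost disjoint family, and there are uncountably many
   branches. *)
Lemma negligible_infinite_set (R : realType) (q : nat -> set nat -> R) (A :
  set nat) :
  (forall r B, 0 <= q r B) ->
  (forall r, exists C, forall N (B : nat -> set nat),
     (forall i j k, B i k -> B j k -> i = j) -> \sum_(i < N) q r (B i) <= C) ->
  (forall r B D, (exists N, forall k,
    (N <= k)%N -> (B k <-> D k)) -> q r B = q r D) ->
  infinitely_often A ->
  exists B : set nat, [/\ B `<=` A, infinitely_often B & forall r, q r B = 0].
Proof.
move=> q0 qC qfin /infinitely_often_enum[s sA sinj].
apply: contrapT => H.
have /choice[F FP] b : exists rm : nat * nat,
  rm.2.+1%:R^-1 < q rm.1 (branch s b).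
  apply: contrapT => Hb; apply: H; exists (branch s b); split.
  - by move=> _ [n _ <-].
  - exact: infinite_branch.
  - move=> r; apply/eqP; rewrite eq_le q0 andbT leNgt; apply/negP => qr.
    apply: Hb; exists (r, Num.truncn (q r (branch s b))^-1) => /=.
    rewrite invf_plt ?posrE ?ltr0Sn//.
    by have /andP[] := @truncn_itv R (q r (branch s b))^-1 ltac:(by rewrite
      invr_ge0 ltW).
have [m [b [binj Fb]]] := uncountable_branches (pickle \o F).
pose rm := F (b 0%N).
have FbE i : F (b i) = rm.
  by apply: (pcan_inj pickleK);
    rewrite /rm (Fb i : pickle (F (b i)) = m) -(Fb 0%N).
have [C HC] := qC rm.1.
(* Removing the earlier branches makes the sets disjoint and takes away only finitely many points,
   which [q] does not see. *)
pose D i : set nat := [set k | branch s (b i) k /\ forall t,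
  (t < i)%N -> ~ branch s (b t) k].
have Ddisj i j k : D i k -> D j k -> i = j.
  move=> [bi Hi] [bj Hj]; have [ij|ji|//] := ltngtP i j.
    by case: (Hj i ij).
  by case: (Hi j ji).
have qD i : q rm.1 (D i) = q rm.1 (branch s (b i)).
  apply: qfin.
  have /choice[N HN] (t : 'I_i) : exists N, forall k, (N <= k)%N ->
      ~ (branch s (b i) k /\ branch s (b t) k).
    apply: almost_disjoint_branches => // /binj it.
    by have := ltn_ord t; rewrite -it ltnn.
  exists (\max_(t < i) N t) => k Nk; split=> [[]//|bk]; split => // t ti bt.
  apply: (HN (Ordinal ti) k) => //.
  by apply: leq_trans Nk; exact: (@leq_bigmax _ _ (Ordinal ti)).
pose n := (Num.truncn (C * rm.2.+1%:R)).+1.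
have := HC n D Ddisj; rewrite leNgt => /negP; apply.
apply: lt_le_trans (_ : \sum_(i < n) rm.2.+1%:R^-1 <= _); last first.
  apply: ler_sum => i _; rewrite qD -(FbE i).
  by apply: ltW; exact: FP.
rewrite sumr_const card_ord -[X in _ < X]mulr_natl ltr_pdivlMr ?ltr0Sn//.
have [Cm|Cm] := leP 0 (C * rm.2.+1%:R).
  by have /andP[] := truncn_itv Cm.
by apply: lt_le_trans Cm _; rewrite ler0n.
Qed.

End almost_disjoint.

(** * Polarization and pointwise limits of homogeneous polynomials *)

Section multilinear.
Variables (K : numFieldType) (E F : normedModType K) (n : nat).
Hypothesis n0 : (0 < n)%N.
Implicit Types (A : ('I_n -> E) -> F) (P : E -> F).

Lemma multilinear_sum A (k : 'I_n) (x : 'I_n -> E) (I : Type) (r : seq I) (y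
  : I -> E) :
  multilinear A ->
  A (dfwith x k (\sum_(i <- r) y i)) = \sum_(i <- r) A (dfwith x k (y i)).
Proof.
move=> Alin; elim: r => [|i r IH].
  rewrite !big_nil; have := Alin k x (-1) 0 0.
  by rewrite scaler0 addr0 scaleN1r addNr.
rewrite !big_cons -IH; have := Alin k x 1 (y i) (\sum_(j <- r) y j).
by rewrite !scale1r.
Qed.

(** The coordinates are expanded one after the other. At stage [k], the condition [C k] pins the
    choices for the coordinates not yet expanded to the default [i0], so that each partial choice is
    counted once. *)
Lemma multilinear_expand A (I : finType) (i0 : I) (y : 'I_n -> I -> E) :
  multilinear A ->
  A (fun l => \sum_i y l i) = \sum_(g : {ffun 'I_n -> I}) A (fun l =>
    y l (g l)).
Proof.
move=> Alin; pose z k (g : {ffun 'I_n -> I}) (l : 'I_n) :=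
  if (l < k)%N then y l (g l) else \sum_i y l i.
pose C k : pred {ffun 'I_n -> I} := fun g =>
  [forall l : 'I_n, (k <= l)%N ==> (g l == i0)].
suff H k : (k <= n)%N -> A (fun l => \sum_i y l i) = \sum_(g | C k g) A (z k g).
  rewrite (H n (leqnn n)); apply: eq_big => [g|g _].
    by apply/forallP => l; rewrite leqNgt ltn_ord.
  by congr A; apply/funext => l; rewrite /z ltn_ord.
elim: k => [_|k IH kn].
  rewrite (big_pred1 [ffun=> i0]) => [|g]; first by congr A.
  apply/forallP/eqP => [H|-> l]; last by rewrite ffunE eqxx.
  by apply/ffunP => l; rewrite ffunE; apply/eqP; exact: (H l).
rewrite {}IH 1?ltnW//; pose kk := Ordinal kn.
have zk g : z k g = dfwith (z k g) kk (\sum_i y kk i).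
  apply/funext => l; case: dfwithP => [|//].
  by rewrite /z /= ltnn.
under eq_bigr => g _ do rewrite zk multilinear_sum//.
rewrite pair_big_dep /=.
pose upd (g : {ffun 'I_n -> I}) i := [ffun l => if l == kk then i else g l].
rewrite (reindex_onto (fun g : {ffun 'I_n -> I} => (upd g i0, g kk))
   (fun p => upd p.1 p.2)) /=; last first.
  move=> [g i] /=; rewrite andbT => /forallP Cg; congr pair;
    last by rewrite ffunE eqxx.
  apply/ffunP => l; rewrite !ffunE; case: eqP => [->|//].
  by have := Cg kk; rewrite leqnn => /eqP.
apply: eq_big => [g|g Cg].
  rewrite andbT; apply/andP/forallP => [[/forallP Cg /eqP gE] l|Cg].
    apply/implyP => kl; have := Cg l; rewrite ltnW//= ffunE.
    by rewrite -val_eqE /= gtn_eqF.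
  split; last first.
    apply/eqP/ffunP => l; rewrite !ffunE; case: eqP => [->//|].
    by [].
  apply/forallP => l; apply/implyP; rewrite ffunE leq_eqVlt => /predU1P[kl|kl].
    by rewrite -val_eqE /= kl eqxx.
  by rewrite -val_eqE /= gtn_eqF//; have := Cg l; rewrite kl.
congr A; apply/funext => l; case: dfwithP => [|j kj]; rewrite /z.
  by rewrite /= ltnSn.
have jk : (j == kk) = false by apply/negP => /eqP jk; rewrite jk eqxx in kj.
rewrite ffunE jk ltnS [in RHS]leq_eqVlt.
by rewrite -[_ == k]/(j == kk :> nat) val_eqE jk.
Qed.

(* [n`!] times the symmetric multilinear form of [P]. *)
Definition polar P (x : 'I_n -> E) : F :=
  \sum_(d : {ffun 'I_n -> bool})
    (\prod_i (if d i then 1 else -1)) *: P (\sum_i (d i)%:R *: x i).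

Definition surjections : pred {ffun 'I_n -> 'I_n} :=
  fun g => [forall i, [exists l, g l == i]].

(** Expand each [P] and exchange the sums. The coefficient of the term of [g] factors over [i]; the
    factor is [1] if [g] takes the value [i], and [1 - 1 = 0] otherwise. *)
Lemma polarE P A : multilinear A -> (forall x, P x = A (fun=> x)) ->
  forall x, polar P x = \sum_(g | surjections g) A (fun l => x (g l)).
Proof.
move=> Alin PA x.
have scaleA g (c : 'I_n -> K) (v : 'I_n -> E) k : (k <= n)%N ->
    A (fun l => if (l < k)%N then c l *: v l else g l) =
    (\prod_(l < n | (l < k)%N) c l) *: A (fun l =>
      if (l < k)%N then v l else g l).
  elim: k g => [|k IH] g kn; first by rewrite big_pred0 ?scale1r//.
  pose kk := Ordinal kn.
  have -> : (fun l : 'I_n => if (l < k.+1)%N then c l *: v l else g l) =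
     dfwith (fun l : 'I_n =>
       if (l < k)%N then c l *: v l else g l) kk (c kk *: v kk).
    apply/funext => l; case: dfwithP => [|j kj]; first by rewrite ltnSn.
    have jk : (j == kk) = false by apply/negP => /eqP jk; rewrite jk eqxx in kj.
    by rewrite ltnS leq_eqVlt -[_ == k]/(j == kk :> nat) val_eqE jk.
  have := Alin kk (fun l : 'I_n =>
    if (l < k)%N then c l *: v l else g l) (c kk) (v kk) 0.
  have A0 (z : 'I_n -> E) : A (dfwith z kk (0 : E)) = 0.
    by have := Alin kk z (-1) 0 0; rewrite scaler0 addr0 scaleN1r addNr.
  rewrite addr0 A0 addr0 => ->.
  have dE (w : 'I_n -> E) : dfwith (fun l : 'I_n =>
    if (l < k)%N then w l else g l) kk (v kk) =
      fun l : 'I_n => if (l < k)%N then w l else dfwith g kk (v kk) l.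
    apply/funext => l; case: dfwithP => [|j kj]; first by rewrite ltnn dfwithin.
    by rewrite dfwithout.
  rewrite (dE (fun l => c l *: v l)) IH ?(ltnW kn)// scalerA [in RHS](bigD1
    kk) ?ltnSn//=.
  rewrite [in RHS](eq_bigl (fun l : 'I_n => (l < k)%N)); last first.
    move=> l; rewrite ltnS ltn_neqAle andbC -val_eqE /=.
    by [].
  congr (_ *: A _); apply/funext => l.
  case: (ltngtP l k) => [lk|kl|lk].
  - by rewrite ltnS ltnW.
  - rewrite ltnS leqNgt kl /= dfwithout// -val_eqE /= ltn_eqF//.
  - have -> : l = kk by apply/val_inj.
    by rewrite ltnSn dfwithin.
have expand (d : {ffun 'I_n -> bool}) : P (\sum_i (d i)%:R *: x i) =
    \sum_(g : {ffun 'I_n -> 'I_n}) (\prod_l (d (g l))%:R) *: A (fun l =>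
      x (g l)).
  rewrite PA (multilinear_expand (Ordinal n0) (fun l i =>
    (d i)%:R *: x i) Alin).
  apply: eq_bigr => g _.
  have := scaleA (fun=> 0) (fun l => (d (g l))%:R) (fun l =>
    x (g l)) n (leqnn n).
  have -> : \prod_(l < n | (l < n)%N) (d (g l))%:R = \prod_(l < n) (d (g
    l))%:R :> K.
    by apply: eq_bigl => l; rewrite ltn_ord.
  have simp (w : 'I_n -> E) : (fun l : 'I_n =>
    if (l < n)%N then w l else 0) = w.
    by apply/funext => l; rewrite ltn_ord.
  by rewrite !simp.
rewrite /polar; under eq_bigr => d _ do rewrite expand scaler_sumr.
rewrite exchange_big /= [RHS]big_mkcond /=; apply: eq_bigr => g _.
under eq_bigr => d _ do rewrite scalerA.
rewrite -scaler_suml.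
pose m i := #|[pred l | g l == i]|.
pose H i (b : bool) : K := (if b then 1 else -1) * b%:R ^+ m i.
have -> : \sum_(d : {ffun 'I_n -> bool}) (\prod_i (if d i then 1 else -1)) *
  \prod_l (d (g l))%:R
    = \prod_i \sum_b H i b.
  rewrite bigA_distr_bigA /=; apply: eq_bigr => d _.
  rewrite big_split /=; congr (_ * _).
  rewrite (partition_big g xpredT)//=; apply: eq_bigr => i _.
  by rewrite (eq_bigr (fun=> (d i)%:R)) ?prodr_const// => l /eqP ->.
have HE i : \sum_b H i b = if [exists l, g l == i] then 1 else 0.
  rewrite big_bool /H /= expr1n mulr1 mulN1r expr0n.
  have -> : (m i == 0%N) = ~~ [exists l, g l == i].
    rewrite /m; apply/eqP/existsPn => [/card0_eq h l|h].
      by have := h l; rewrite inE => ->.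
    by apply: eq_card0 => l; rewrite inE; apply/negbTE/h.
  by case: [exists l, g l == i]; rewrite /= ?subr0 ?subrr.
case: ifPn => [/forallP sg|]; first by rewrite big1 ?scale1r// => i _;
  rewrite HE sg.
rewrite negb_forall => /existsP[i ni].
by rewrite (bigD1 i)//= HE (negbTE ni) mul0r scale0r.
Qed.

Lemma multilinear_polar P : homogeneous_poly n P -> multilinear (polar P).
Proof.
move=> [A Alin PA] i x a u v.
rewrite !(polarE Alin PA) scaler_sumr -big_split /=;
  apply: eq_bigr => g /forallP sg.
have gs j : exists l, g l = j by have /existsP[l /eqP] := sg j; exists l.
have ginj : injective g.
  have /choice[h hK] := gs.
  exact: bij_inj (bij_can_bij (injF_bij (can_inj hK)) hK).
have [l gl] := gs i.
have gE w : (fun k => dfwith x i w (g k)) = dfwith (fun k => x (g k)) l w.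
  apply/funext => k; case: (eqVneq l k) => [<-|lk].
    by rewrite gl !dfwithin.
  rewrite !dfwithout// -gl; apply: contra lk => /eqP /ginj ->; exact: eqxx.
by rewrite !gE Alin.
Qed.

Definition surjections_number : nat := #|surjections|.

Lemma surjections_number_gt0 : (0 < surjections_number)%N.
Proof.
apply/card_gt0P; exists [ffun i => i]; apply/forallP => i; apply/existsP.
by exists i; rewrite ffunE.
Qed.

Lemma polar_diag P x : homogeneous_poly n P ->
  polar P (fun=> x) = surjections_number%:R *: P x.
Proof.
move=> [A Alin PA]; rewrite (polarE Alin PA) sumr_const.
by rewrite PA scaler_nat.
Qed.

Definition polarization P (x : 'I_n -> E) : F :=
  surjections_number%:R^-1 *: polar P x.

Lemma multilinear_polarization P : homogeneous_poly n P ->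
  multilinear (polarization P).
Proof.
move=> hP i x a u v; rewrite /polarization (multilinear_polar hP) scalerDr
  !scalerA.
by rewrite mulrC.
Qed.

Lemma polarization_diag P x : homogeneous_poly n P -> polarization P (fun=>
  x) = P x.
Proof.
move=> hP; rewrite /polarization polar_diag// scalerA mulVf ?scale1r//.
by rewrite pnatr_eq0 -lt0n surjections_number_gt0.
Qed.

(** Arbitrary forms representing the [Pn k] might not converge. The polarization is a fixed finite
    combination of values of the polynomial, so it converges together with them. *)
Lemma homogeneous_poly_cvg (Pn : nat -> E -> F) P :
  (forall k, homogeneous_poly n (Pn k)) ->
  (forall x, Pn k x @[k --> \oo] --> P x) -> homogeneous_poly n P.
Proof.
move=> hPn cP.
have cpol x : polarization (Pn k) x @[k --> \oo] --> polarization P x.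
  apply: cvgZl_tmp; rewrite /polar.
  by apply: cvg_big => [|d _]; [exact: add_continuous|apply: cvgZl_tmp].
exists (polarization P) => [i x a u v|x].
  have cD : a *: polarization (Pn k) (dfwith x i u) + polarization (Pn k)
    (dfwith x i v)
      @[k --> \oo] --> a *: polarization P (dfwith x i u) + polarization P
        (dfwith x i v).
    by apply: cvgD => //; apply: cvgZl_tmp.
  apply: (cvg_unique (@norm_hausdorff _ _) (cpol (dfwith x i (a *: u + v)))).
  rewrite (_ : (fun k => polarization (Pn k) _) = fun k =>
    a *: polarization (Pn k) (dfwith x i u) + polarization (Pn k) (dfwith x i
      v))//.
  by apply/funext => k; exact: multilinear_polarization.
apply: (cvg_unique (@norm_hausdorff _ _) (cP x)).
have := cpol (fun=> x); under eq_fun do rewrite (polarization_diag x (hPn _)).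
exact.
Qed.

Section continuity.
Variables (R : realType) (S : real_structure R K).
Local Notation rnorm := (rnorm S).

Lemma homogeneous_poly_bound P C x : homogeneous_poly n P ->
  (forall z, rnorm z <= 1 -> rnorm (P z) <= C) -> rnorm (P x) <= C * rnorm x
    ^+ n.
Proof.
move=> hP PC; have [->|x0] := eqVneq x 0.
  have -> : P 0 = 0.
    by have := homogeneous_polyZ 0 0 hP;
      rewrite scale0r expr0n gtn_eqF//= scale0r.
  by rewrite !rnorm0 expr0n gtn_eqF//= mulr0.
have r0 : 0 < rnorm x by rewrite lt_neqAle rnorm_ge0 andbT eq_sym rnorm_eq0.
have xE : x = ofR S (rnorm x) *: (ofR S (rnorm x)^-1 *: x).
  by rewrite scalerA -rmorphM divff ?gt_eqF// rmorph1 scale1r.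
rewrite {1}xE (homogeneous_polyZ _ _ hP) rnormZ rnormX rnorm_ofR gtr0_norm//
  mulrC.
rewrite ler_pM2r ?exprn_gt0//; apply: (PC).
by rewrite rnormZ rnorm_ofR gtr0_norm ?invr_gt0// mulVf ?gt_eqF.
Qed.

Lemma polarization_bound P C : homogeneous_poly n P ->
  (forall z, rnorm z <= 1 -> rnorm (P z) <= C) ->
  exists D, forall v r, 0 <= r -> (forall i, rnorm (v i) <= r) ->
    rnorm (polarization P v) <= D * r ^+ n.
Proof.
move=> hP PC.
(* The points where [P] is evaluated have norm at most [n * r], hence the factor [n ^ n]. *)
exists (rnorm (surjections_number%:R^-1 : K) *
  \sum_(d : {ffun 'I_n -> bool}) (C * n%:R ^+ n)) => v r r0 vr.
rewrite /polarization rnormZ -mulrA ler_wpM2l ?rnorm_ge0// mulr_suml.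
apply: le_trans (ler_rnorm_sum _ _ _ _) _; apply: ler_sum => d _.
have C0 : 0 <= C.
  by apply: le_trans (PC 0 _); rewrite ?rnorm_ge0// rnorm0.
have -> : rnorm (\prod_i (if d i then 1 else -1) *: P (\sum_i (d i)%:R *: v
  i)) =
    rnorm (P (\sum_i (d i)%:R *: v i)).
  rewrite rnormZ (_ : rnorm _ = 1) ?mul1r//.
  elim/big_ind : _ => [|a b a1 b1|i _]; first exact: rnorm1.
    by rewrite rnormM a1 b1 mulr1.
  by case: (d i); rewrite ?rnormN rnorm1.
apply: le_trans (homogeneous_poly_bound _ hP PC) _.
rewrite -mulrA ler_wpM2l// -exprMn lerXn2r ?nnegrE ?rnorm_ge0 ?mulr_ge0//.
apply: le_trans (ler_rnorm_sum _ _ _ _) _.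
apply: le_trans (_ : \sum_(i < n) r <= _);
  last by rewrite sumr_const card_ord mulr_natl.
apply: ler_sum => i _; rewrite rnormZ; case: (d i);
  first by rewrite rnorm1 mul1r.
by rewrite rnorm0 mul0r.
Qed.

Lemma multilinear_telescope A (x y : E) : multilinear A ->
  A (fun=> x) - A (fun=> y) =
  \sum_(k < n) A (dfwith (fun l : 'I_n =>
    if (l < k)%N then y else x) k (x - y)).
Proof.
move=> Alin; pose z k (l : 'I_n) := if (l < k)%N then y else x.
have z0 : (fun=> x) = z 0%N by apply/funext => l.
have zn : (fun=> y) = z n by apply/funext => l; rewrite /z ltn_ord.
rewrite z0 zn -opprB -(telescope_sumr (fun k =>
  A (z k)) (leq0n n)) big_mkord -sumrN.
apply: eq_bigr => k _; rewrite opprB.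
have zk : z k = dfwith (z k) k x.
  by apply/funext => l; case: dfwithP => //; rewrite /z ltnn.
have zk1 : z k.+1 = dfwith (z k) k y.
  apply/funext => l; case: dfwithP => [|j kj]; rewrite /z ?ltnSn//.
  by rewrite ltnS leq_eqVlt val_eqE eq_sym (negbTE kj).
rewrite {1}zk zk1; have Ax := Alin k (z k) (-1) y x.
rewrite !scaleN1r [- y + x]addrC in Ax.
by rewrite addrC -Ax.
Qed.

(** Telescoping the polarization gives a Lipschitz bound on the unit ball around [x]. *)
Lemma homogeneous_poly_continuous P C : homogeneous_poly n P ->
  (forall z, rnorm z <= 1 -> rnorm (P z) <= C) -> continuous P.
Proof.
move=> hP PC x; have [D HD] := polarization_bound hP PC.
have lipschitz y : rnorm (y - x) <= 1 ->
    rnorm (P y - P x) <= n%:R * (`|D| * (rnorm x + 1) ^+ n) * rnorm (y - x).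
  move=> yx1; rewrite -(polarization_diag y hP) -(polarization_diag x hP).
  have plin := multilinear_polarization hP.
  rewrite (multilinear_telescope _ _ plin).
  have [->|yx] := eqVneq (y - x) 0.
    rewrite rnorm0 mulr0 big1 ?rnorm0// => k _.
    have := plin k (fun l : 'I_n => if (l < k)%N then x else y) (-1) 0 0.
    by rewrite scaler0 addr0 scaleN1r addNr.
  set d := rnorm (y - x).
  have d0 : 0 < d by rewrite lt_neqAle rnorm_ge0 andbT eq_sym rnorm_eq0.
  (* Normalizing the entry [y - x] extracts the factor [d] and leaves all arguments of norm at most
     [rnorm x + 1]. *)
  have yxE : y - x = ofR S d *: (ofR S d^-1 *: (y - x)) + 0.
    by rewrite addr0 scalerA -rmorphM divff ?gt_eqF// rmorph1 scale1r.
  apply: le_trans (ler_rnorm_sum _ _ _ _) _.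
  apply: le_trans (_ : \sum_(k < n) (`|D| * (rnorm x + 1) ^+ n * d) <= _);
    last first.
    by rewrite sumr_const card_ord -[X in X <= _]mulr_natl mulrA.
  apply: ler_sum => k _; rewrite yxE plin.
  have -> : polarization P (dfwith (fun l : 'I_n =>
    if (l < k)%N then x else y) k 0) = 0.
    have := plin k (fun l : 'I_n => if (l < k)%N then x else y) (-1) 0 0.
    by rewrite scaler0 addr0 scaleN1r addNr.
  rewrite addr0 rnormZ rnorm_ofR gtr0_norm// mulrC ler_pM2r//.
  have x0 := rnorm_ge0 S x.
  have xr : 0 <= rnorm x + 1 by lra.
  apply: le_trans (HD _ (rnorm x + 1) xr _) _; last first.
    by rewrite ler_wpM2r ?exprn_ge0// ler_norm.
  move=> i; case: (eqVneq k i) => [<-|ki].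
    rewrite dfwithin rnormZ rnorm_ofR gtr0_norm ?invr_gt0//.
    by rewrite -/d mulVf ?gt_eqF//; lra.
  rewrite dfwithout//; case: ifP => _; first by lra.
  by rewrite -[y](subrK x) (le_trans (ler_rnormD _ _ _))// addrC lerD2l.
apply/(cvg_rnormP S) => e e0.
set M := n%:R * (`|D| * (rnorm x + 1) ^+ n) in lipschitz.
have M0 : 0 <= M.
  by rewrite !mulr_ge0// exprn_ge0// addr_ge0// rnorm_ge0.
have d0 : 0 < Num.min 1 (e / (M + 1)).
  by rewrite lt_min ltr01 divr_gt0//; lra.
have /(cvg_rnormP S)/(_ _ d0) : id y @[y --> x] --> x by exact: cvg_id.
apply: filterS => y /=; rewrite lt_min => /andP[y1 ye].
apply: le_lt_trans (lipschitz y (ltW y1)) _.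
rewrite ltr_pdivlMr in ye; last by lra.
by have := rnorm_ge0 S (y - x); nra.
Qed.

Lemma continuous_poly_cvg (Pn : nat -> E -> F) P C :
  (forall k, Pn k \in continuous_poly n) ->
  (forall k z, rnorm z <= 1 -> rnorm (Pn k z) <= C) ->
  (forall x, Pn k x @[k --> \oo] --> P x) -> 
  P \in continuous_poly n /\ forall z, rnorm z <= 1 -> rnorm (P z) <= C.
Proof.
move=> hPn PC cP.
have PB z : rnorm z <= 1 -> rnorm (P z) <= C.
  move=> z1; apply/ler_addgt0Pr => e e0.
  have /(cvgn_rnormP S)/(_ e e0)[N HN] := cP z.
  have := HN N (leqnn N); have := PC N z z1.
  have := ler_rnorm_tri S (Pn N z) (P z) 0; rewrite !subr0 rnormB; lra.
split=> //; apply/asboolP.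
have hP : homogeneous_poly n P.
  by apply: homogeneous_poly_cvg cP => k; have /asboolP[] := hPn k.
by split => //; exact: homogeneous_poly_continuous hP PB.
Qed.

End continuity.

End multilinear.

Lemma cauchy_series_cvg (R : realType) (K : numFieldType) (S : real_structure
  R K)
    (F : completeNormedModType K) (s : nat -> F) :
  (forall e, 0 < e -> exists N, forall m,
    (N <= m)%N -> rnorm S (s m - s N) < e) ->
  exists l : F, s @ \oo --> l.
Proof.
move=> H; suff : cvg (s @ \oo) by move=> sc; exists (lim (s @ \oo)).
apply: cauchy_cvg; apply: cauchy_exP => e e0.
have re0 : 0 < re S e by rewrite -(ofR_gt0 S) ofR_re ?ltW.
have [N HN] := H _ re0; exists (s N); exists N => // m /= /HN.
rewrite -ball_normE /= rnormB -(ltr_ofR S) (ofR_rnorm S (s N - s m)) ofR_re//.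
exact: ltW.
Qed.

(** * Spaces of polynomials *)

Section poly_space_theory.
Variables (R : realType) (K : numFieldType) (hK : real_or_complex R K).
Variable S : real_structure R K.
Variables (n : nat) (E F : normedModType K).
Hypothesis n0 : (0 < n)%N.
Local Notation rnorm := (rnorm S).
Local Notation X := (poly_space hK n E F).
Local Notation PK := (compact_polys hK n E F).

Lemma poly_spaceD (P Q : X) x : (P + Q) x = P x + Q x. Proof. by []. Qed.

Lemma poly_spaceZ a (P : X) x : (a *: P) x = a *: P x. Proof. by []. Qed.

Lemma poly_space_sum (I : Type) (r : seq I) (p : pred I) (P : I -> X) x :
  (\sum_(i <- r | p i) P i) x = \sum_(i <- r | p i) P i x.
Proof. by apply: (big_morph (fun Q : X => Q x)). Qed.

Lemma poly_space_ext (P Q : X) : (forall x, P x = Q x) -> P = Q.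
Proof. by move=> PQ; apply/val_inj/funext. Qed.

Lemma poly_space_homogeneous (P : X) : homogeneous_poly n P.
Proof. by have /asboolP[] := valP P. Qed.

Lemma poly_space_le (P : X) x : rnorm x <= 1 -> rnorm (P x) <= rnorm P.
Proof.
move=> x1; rewrite -(ler_ofR S) !ofR_rnorm.
apply: (le_sup_norm hK (continuous_poly_bounded (valP P))).
by rewrite /= -(rmorph1 (ofR S)) rnorm_le_ofR.
Qed.

Lemma poly_space_norm_le (P : X) C :
  (forall x, rnorm x <= 1 -> rnorm (P x) <= C) -> rnorm P <= C.
Proof.
move=> PC; rewrite -rnorm_le_ofR; apply: (sup_norm_le hK).
  by exists 0; rewrite /= normr0.
move=> x /=; rewrite -(rmorph1 (ofR S)) !rnorm_le_ofR; exact: PC.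
Qed.

Lemma poly_space_bound (P : X) x : rnorm (P x) <= rnorm P * rnorm x ^+ n.
Proof.
apply: (homogeneous_poly_bound n0 x (poly_space_homogeneous P)) => z.
exact: poly_space_le.
Qed.

(** The image of the unit ball is precompact, so the values at the [x j] converge along [U]. *)
Lemma compact_polys_ultra_cauchy (P : X) (x : nat -> E) (U : set_system nat) e :
  PK P -> (forall j, rnorm (x j) <= 1) -> UltraFilter U -> 0 < e ->
  exists2 B, U B & forall i j, B i -> B j -> rnorm (P (x i) - P (x j)) < e.
Proof.
move=> PKP x1 UU e0.
have : precompact (P @` [set x : E | rnorm x <= 1]).
  apply: PKP; exists 1; split => // M M1 z /= z1.
  by apply: le_trans (ltW M1); rewrite -(rmorph1 (ofR S)) rnorm_le_ofR.
rewrite precompactE => cP.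
have [|l _ /(cvg_rnormP S) Hl] := @ultra_compact_cvg _ _ U (fun j =>
  P (x j)) UU cP.
  apply: filterE => j; apply: subset_closure; exists (x j) => //; exact: x1.
exists [set j | rnorm (P (x j) - l) < e / 2]; first by apply: Hl;
  rewrite divr_gt0.
move=> i j /= Bi Bj; apply: le_lt_trans (ler_rnorm_tri S l _ _) _.
rewrite (rnormB S l); lra.
Qed.

Lemma rank_one_compact (P : X) (h : E -> K) (y : F) :
  (forall x, P x = h x *: y) ->
  (exists C, forall x, rnorm (h x) <= C * rnorm x ^+ n) -> PK P.
Proof.
move=> Ph [C hC] B [M [Mreal BM]].
have [C' cC' HC'] := compact_scalar_image S (`|C| * (re S (M + 1)) ^+ n) y.
exists C'; last by split => //; exact: compact_closed (@norm_hausdorff _ _) cC'.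
move=> _ [x Bx <-]; rewrite Ph; apply: HC'.
have xM : `|x| <= M + 1 by apply: BM => //; rewrite ltrDl.
have M0 : 0 <= M + 1 by exact: le_trans (normr_ge0 x) xM.
have xR : rnorm x <= re S (M + 1) by rewrite -rnorm_le_ofR ofR_re.
apply: le_trans (hC x) _; apply: le_trans (_ : `|C| * rnorm x ^+ n <= _).
  by rewrite ler_wpM2r ?exprn_ge0 ?rnorm_ge0// ler_norm.
by rewrite ler_wpM2l// lerXn2r ?nnegrE ?rnorm_ge0//;
  exact: le_trans (rnorm_ge0 S x) xR.
Qed.

Lemma functional_poly (Q : X) (phi : F -> K) (y : F) : dual_ball S phi ->
  exists2 P : X, (forall x, P x = phi (Q x) *: y) & PK P.
Proof.
move=> dphi; pose f x := phi (Q x) *: y.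
have hf : homogeneous_poly n f.
  have [A Alin QA] := poly_space_homogeneous Q.
  exists (fun v => phi (A v) *: y) => [i x a u v|x]; last by rewrite /f QA.
  by rewrite Alin dphi.1 scalerDl scalerA.
have fC x : rnorm (f x) <= rnorm Q * rnorm y * rnorm x ^+ n.
  rewrite rnormZ mulrAC ler_wpM2r ?rnorm_ge0//.
  exact: le_trans (dual_ball_le dphi _) (poly_space_bound _ _).
have cf : f \in continuous_poly n.
  apply/asboolP; split => //.
  apply: (homogeneous_poly_continuous n0 (S := S) (C :=
    rnorm Q * rnorm y) hf) => z z1.
  apply: le_trans (fC z) _; rewrite ler_piMr ?mulr_ge0 ?rnorm_ge0//.
  by rewrite exprn_ile1 ?rnorm_ge0.
exists (PolySpace hK cf) => //.
apply: (@rank_one_compact _ (fun x => phi (Q x)) y) => //.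
exists (rnorm Q) => x.
exact: le_trans (dual_ball_le dphi _) (poly_space_bound _ _).
Qed.

Lemma power_poly (phi : E -> K) (y : F) : dual_ball S phi ->
  exists2 P : X, (forall x, P x = phi x ^+ n *: y) & PK P.
Proof.
move=> dphi; pose f x := phi x ^+ n *: y.
have hf : homogeneous_poly n f.
  exists (fun v => (\prod_l phi (v l)) *: y) => [i x a u v|x]; last first.
    by rewrite prodr_const card_ord.
  have prodE w : \prod_l phi (dfwith x i w l) = phi w * \prod_(l | l != i)
    phi (x l).
    rewrite (bigD1 i)//= dfwithin; congr (_ * _); apply: eq_bigr => l li.
    by rewrite dfwithout// eq_sym.
  by rewrite !prodE dphi.1 mulrDl scalerDl scalerA mulrA.
have fC x : rnorm (f x) <= rnorm y * rnorm x ^+ n.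
  rewrite rnormZ rnormX mulrC ler_wpM2l ?rnorm_ge0//.
  by rewrite lerXn2r ?nnegrE ?rnorm_ge0// dual_ball_le.
have cf : f \in continuous_poly n.
  apply/asboolP; split => //.
  apply: (homogeneous_poly_continuous n0 (S := S) (C := rnorm y) hf) => z z1.
  apply: le_trans (fC z) _; rewrite ler_piMr ?rnorm_ge0//.
  by rewrite exprn_ile1 ?rnorm_ge0.
exists (PolySpace hK cf) => //.
apply: (@rank_one_compact _ (fun x => phi x ^+ n) y) => //.
exists 1 => x; rewrite mul1r rnormX.
by rewrite lerXn2r ?nnegrE ?rnorm_ge0// dual_ball_le.
Qed.

End poly_space_theory.

(** * Sums of pointwise convergent subseries *)

Section main_lemma.
Variables (R : realType) (K : numFieldType) (hK : real_or_complex R K).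
Variable S : real_structure R K.
Variables (n : nat) (E F : completeNormedModType K).
Hypothesis n0 : (0 < n)%N.
Local Notation rnorm := (rnorm S).
Local Notation X := (poly_space hK n E F).
Local Notation PK := (compact_polys hK n E F).

(** The first clause says that the series is weakly unconditionally Cauchy with constant [C]; the
    second one lets every subseries be summed pointwise. *)
Definition pointwise_unconditional (C : R) (T : nat -> X) :=
  (forall m (xi : nat -> K) x, (forall k, rnorm (xi k) <= 1) -> rnorm x <= 1 ->
     rnorm (\sum_(k < m) xi k *: T k x) <= C) /\
  (forall (A : set nat) x, rnorm x <= 1 ->
     exists l : F, \sum_(k < m | val k \in A) T k x @[m --> \oo] --> l).

Section subseries.
Variables (C : R) (T : nat -> X).
Hypothesis uT : pointwise_unconditional C T.

Lemma subseries_exists (A : set nat) :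
  exists Q : X, forall x, \sum_(k < m | val k \in A) T k x @[m --> \oo] --> Q x.
Proof.
have cvgA x : exists l : F, \sum_(k < m | val k \in A) T k x @[m --> \oo] --> l.
  pose r := 1 + rnorm x; have x0 := rnorm_ge0 S x.
  have r0 : 0 < r by rewrite /r; lra.
  have [|l Hl] := uT.2 A (ofR S r^-1 *: x).
    by rewrite rnormZ rnorm_ofR gtr0_norm ?invr_gt0// mulrC ler_pdivrMr// /r;
      lra.
  exists (ofR S r ^+ n *: l).
  have -> : (fun m => \sum_(k < m | val k \in A) T k x) =
      fun m => ofR S r ^+ n *: \sum_(k < m | val k \in A) T k (ofR S r^-1 *: x).
    apply/funext => m; rewrite scaler_sumr; apply: eq_bigr => k _.
    rewrite -(homogeneous_polyZ _ _ (poly_space_homogeneous (T k))).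
    by rewrite scalerA -rmorphM divff ?gt_eqF// rmorph1 scale1r.
  exact: cvgZl_tmp.
have /choice[f fP] := cvgA.
pose Pn m : X := \sum_(k < m | val k \in A) T k.
have PnE m x : Pn m x = \sum_(k < m | val k \in A) T k x by rewrite
  poly_space_sum.
have [|||fc _] := @continuous_poly_cvg _ _ _ n n0 R S (fun m =>
  Pn m : E -> F) f C.
- by move=> m; exact: valP.
- move=> m z z1; rewrite PnE big_mkcond /=.
  have := uT.1 m (fun k => (k \in A)%:R) z _ z1.
  rewrite (eq_bigr (fun k : 'I_m => if val k \in A then T k z else 0)) =>
    [|k _].
    by apply=> k; case: (k \in A); rewrite ?rnorm1 ?rnorm0.
  by case: (val k \in A); rewrite ?scale1r ?scale0r.
- move=> x; rewrite (_ : (fun m => _) = fun m =>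
  \sum_(k < m | val k \in A) T k x)//.
  by apply/funext => m; exact: PnE.
by exists (PolySpace hK fc).
Qed.

Definition subseries (A : set nat) : X := sval (cid (subseries_exists A)).

Lemma subseriesP A x :
  \sum_(k < m | val k \in A) T k x @[m --> \oo] --> subseries A x.
Proof. exact: (svalP (cid (subseries_exists A))). Qed.

(** Take as coefficients the phases of the numbers [phi (T k x)]. *)
Lemma sum_dual_ball_le (phi : F -> K) x m : dual_ball S phi -> rnorm x <= 1 ->
  \sum_(k < m) rnorm (phi (T k x)) <= C.
Proof.
move=> dphi x1.
have := uT.1 m (fun k => phase (phi (T k x))) x _ x1.
move=> /(_ (fun k => ltac:(by rewrite rnorm_phase))).
apply: le_trans; apply: le_trans (dual_ball_le dphi _).
rewrite (dual_ball_sum dphi) (eq_bigr (fun k : 'I_m =>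
  `|phi (T k x)| : K)) => [|k _].
  rewrite (eq_bigr (fun k : 'I_m => re S `|phi (T k x)|))// -re_sum.
  exact: re_le_rnorm.
by rewrite (dual_ballZ dphi) phaseM.
Qed.

Lemma cvg_rnorm_le (V : normedModType K) (s : nat -> V) (l c : V) e :
  s @ \oo --> l -> (exists N, forall m, (N <= m)%N -> rnorm (s m - c) <= e) ->
  rnorm (l - c) <= e.
Proof.
move=> /(cvgn_rnormP S) sl [N HN]; apply/ler_addgt0Pr => d d0.
have [M HM] := sl d d0.
have := HN (maxn N M) (leq_maxl _ _); have := HM (maxn N M) (leq_maxr _ _).
have := ler_rnorm_tri S (s (maxn N M)) l c; rewrite (rnormB S l (s _)); lra.
Qed.

Lemma subseries_dual_ball_le (phi : F -> K) (A : set nat) x c e : dual_ball S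
  phi ->
  (exists N, forall m, (N <= m)%N ->
    rnorm (\sum_(k < m | val k \in A) phi (T k x) - c) <= e) ->
  rnorm (phi (subseries A x) - c) <= e.
Proof.
move=> dphi; apply: (@cvg_rnorm_le K^o) => /=.
apply/(cvgn_rnormP S) => d d0;
  have /(cvgn_rnormP S)/(_ d d0)[N HN] := @subseriesP A x.
exists N => m /HN; apply: le_lt_trans.
by rewrite -(dual_ball_sum dphi) -(dual_ballB dphi); exact: dual_ball_le.
Qed.

(** By disjointness each [T k] occurs in at most one of the sums, so the combination is a single
    series with coefficients of modulus at most [1]. *)
Lemma subseries_comb_norm m (xi : nat -> K) (A : nat -> set nat) :
  (forall i j k, A i k -> A j k -> i = j) -> (forall i, rnorm (xi i) <= 1) ->
  rnorm (\sum_(i < m) xi i *: subseries (A i)) <= C.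
Proof.
move=> Adisj xi1; apply: poly_space_norm_le => x x1.
rewrite -[X in rnorm X]subr0.
pose co k : K := \sum_(i < m) xi i * (k \in A i)%:R.
apply: (@cvg_rnorm_le F (fun N => \sum_(k < N) co k *: T k x)).
  rewrite poly_space_sum (_ : (fun N => _) = fun N =>
      \sum_(i < m) xi i *: \sum_(k < N | val k \in A i) T k x).
    apply: cvg_big => [|i _]; first exact: add_continuous.
    by apply: cvgZl_tmp; exact: subseriesP.
  apply/funext => N; under [RHS]eq_bigr do rewrite big_mkcond scaler_sumr.
  rewrite exchange_big /=; apply: eq_bigr => k _; rewrite /co scaler_suml.
  apply: eq_bigr => i _; case: (val k \in A i); first by rewrite mulr1.
  by rewrite mulr0 scale0r scaler0.
exists 0%N => N _; rewrite subr0; apply: uT.1 => // k.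
rewrite /co; have [[i0 Ai0]|H] := pselect (exists i : 'I_m, A i k); last first.
  rewrite big1 ?rnorm0// => i _; rewrite memNset ?mulr0// => Ak.
  by apply: H; exists i.
rewrite (bigD1 i0)//= mem_set// mulr1 big1 ?addr0// => i ii0.
rewrite memNset ?mulr0// => Ak; move/eqP: ii0; apply.
by apply: val_inj; exact: Adisj Ak Ai0.
Qed.

(** A projection onto the compact polynomials fixes the finite correction when the [T k] are
    compact, so [p S_A - S_A] depends on [A] only up to finite sets. *)
Lemma subseries_eventually (A D : set nat) N :
  (forall k, (N <= k)%N -> (A k <-> D k)) ->
  subseries A = subseries D +
    \sum_(k < N) ((val k \in A)%:R - (val k \in D)%:R) *: T k.
Proof.
move=> AD; apply: poly_space_ext => x; rewrite poly_spaceD poly_space_sum.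
have sumE (B : set nat) m : \sum_(k < m | val k \in B) T k x =
    \sum_(0 <= k < m) (k \in B)%:R *: T k x.
  rewrite big_mkcond big_mkord; apply: eq_bigr => k _.
  by case: (val k \in B); rewrite ?scale1r ?scale0r.
apply/eqP; rewrite addrC -subr_eq; apply/eqP.
have cB : \sum_(k < m | val k \in A) T k x - \sum_(k < m | val k \in D) T k x
    @[m --> \oo] --> subseries A x - subseries D x.
  by apply: cvgB; exact: subseriesP.
apply: (cvg_unique (@norm_hausdorff _ _) cB).
apply/(cvgn_rnormP S) => e e0; exists N => m Nm.
rewrite !sumE -sumrB (big_cat_nat (n := N) (p := m))//=.
have -> : \sum_(N <= k < m) ((k \in A)%:R *: T k x - (k \in D)%:R *: T k x) = 0.
  rewrite big_nat_cond big1// => k /andP[/andP[Nk _] _].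
  have -> : (k \in A) = (k \in D).
    by apply/idP/idP => /set_mem/(AD k Nk)/mem_set.
  by rewrite subrr.
rewrite addr0 big_mkord (_ : \sum_(i < N) _ = \sum_(k < N) (((val k \in A)%:R
  - (val k \in D)%:R) *: T k) x).
  by rewrite subrr rnorm0.
by apply: eq_bigr => k _; rewrite poly_spaceZ scalerBl.
Qed.

End subseries.

End main_lemma.

(** * Projections onto the compact polynomials *)

Section projection.
Variables (R : realType) (K : numFieldType) (hK : real_or_complex R K).
Variable S : real_structure R K.
Variables (n : nat) (E F : completeNormedModType K).
Hypothesis n0 : (0 < n)%N.
Local Notation rnorm := (rnorm S).
Local Notation X := (poly_space hK n E F).
Local Notation PK := (compact_polys hK n E F).
Local Notation pointwise_unconditional :=
  (@pointwise_unconditional R K hK S n E F).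
Variables (p : {linear X -> X}) (D : R).
Hypothesis pD : forall Q, rnorm (p Q) <= D * rnorm Q.
Hypothesis p_compact : forall Q, PK (p Q).
Hypothesis p_id : forall Q, PK Q -> p Q = Q.

Lemma compact_polys_sum (I : Type) (r : seq I) (P : pred I) (c : I -> K) (T :
  I -> X) :
  (forall i, PK (T i)) -> PK (\sum_(i <- r | P i) c i *: T i).
Proof.
move=> TPK; rewrite (_ : \sum_(i <- r | P i) _ = p (\sum_(i <- r | P i) c i
  *: T i)) //.
rewrite linear_sum; apply: eq_bigr => i _.
by rewrite linearZ /= p_id.
Qed.

Section cauchy.
Variables (C : R) (T : nat -> X).
Hypothesis uT : pointwise_unconditional C T.
Hypothesis TPK : forall k, PK (T k).
Variable x : nat -> E.
Hypothesis x1 : forall j, rnorm (x j) <= 1.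
Local Notation psi := (subseries n0 uT).

(* The functionals [theta r] norm the finite sums of the [T k (x i) - T k
   (x j)], and on a suitable [B] they do not distinguish [psi B] from its
   compact image under [p]. *)
Lemma projection_ultra_cauchy (A : set nat) : infinitely_often A ->
  exists B : set nat, [/\ B `<=` A, infinitely_often B &
    forall U : set_system nat, UltraFilter U -> forall e, 0 < e ->
    exists2 G : set nat, U G & forall i j, G i -> G j ->
      rnorm (psi B (x i) - psi B (x j)) < e].
Proof.
move=> ioA.
pose dpsi B := p (psi B) - psi B.
(* [r] codes two points and a finite set of indices, which makes the norming functionals a countable
   family. *)
pose ijl (r : nat) : nat * nat * seq nat := odflt (0%N, 0%N, [::]) (unpickle r).
pose d r : F := \sum_(k <- (ijl r).2) (T k (x (ijl r).1.1) - T k (x (ijl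
  r).1.2)).
have /choice[phi phiP] r : exists phi : F -> K,
    dual_ball S phi /\ rnorm (phi (d r)) = rnorm (d r).
  by have [phi dphi phid] := hahn_banach_norming S (d r); exists phi.
pose theta r (Q : X) := phi r (Q (x (ijl r).1.1) - Q (x (ijl r).1.2)).
have theta_sum r N (c : nat -> K) (Q : nat -> X) :
    theta r (\sum_(t < N) c t *: Q t) = \sum_(t < N) c t * theta r (Q t).
  rewrite /theta !poly_space_sum -sumrB (dual_ball_sum (phiP r).1).
  apply: eq_bigr => t _.
  by rewrite !poly_spaceZ -scalerBr (dual_ballZ (phiP r).1).
have theta_le r Q : rnorm (theta r Q) <= 2 * rnorm Q.
  apply: le_trans (dual_ball_le (phiP r).1 _) _.
  apply: le_trans (ler_rnormB _ _ _) _.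
  have := poly_space_le Q (x1 (ijl r).1.1).
  have := poly_space_le Q (x1 (ijl r).1.2); lra.
have [|||B [BA ioB HB]] :=
    @negligible_infinite_set R (fun r B =>
      rnorm (theta r (dpsi B))) A _ _ _ ioA.
- by move=> r B; exact: rnorm_ge0.
- move=> r; exists (2 * ((`|D| + 1) * C)) => N B Bdisj.
  (* The phases turn the sum of moduli into one value of [theta r], at a combination of norm at most
     [C] whatever [N] is. *)
  pose xi t := phase (theta r (dpsi (B t))).
  have xi1 t : rnorm (xi t) <= 1 by rewrite rnorm_phase.
  pose Psi := \sum_(t < N) xi t *: psi (B t).
  have PsiC : rnorm Psi <= C := subseries_comb_norm n0 uT N Bdisj xi1.
  have -> : \sum_(t < N) rnorm (theta r (dpsi (B t))) = re S (theta r (p Psi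
    - Psi)).
    have -> : p Psi - Psi = \sum_(t < N) xi t *: dpsi (B t).
      rewrite /Psi linear_sum -sumrB; apply: eq_bigr => t _.
      by rewrite linearZ /= /dpsi scalerBr.
    rewrite (theta_sum r N xi (fun t => dpsi (B t))) re_sum;
      apply: eq_bigr => t _.
    by rewrite phaseM.
  apply: le_trans (re_le_rnorm _ _) _; apply: le_trans (theta_le _ _) _.
  rewrite ler_pM2l//; apply: le_trans (ler_rnormB _ _ _) _.
  rewrite mulrDl mul1r lerD//; apply: le_trans (pD _) _.
  apply: le_trans (_ : `|D| * rnorm Psi <= _).
    by rewrite ler_wpM2r ?rnorm_ge0// ler_norm.
  by rewrite ler_wpM2l.
- move=> r B1 B2 [N HN]; congr (rnorm (theta r _)).
  rewrite /dpsi (subseries_eventually n0 uT HN) linearD /= [p (\sum_(k < N)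
    _)]p_id.
    by rewrite opprD addrACA subrr addr0.
  by apply: compact_polys_sum => k.
exists B; split => // U UU e e0.
have [G UG HG] := compact_polys_ultra_cauchy (p_compact (psi B)) x1 UU e0.
exists G => // i j Gi Gj; apply: le_lt_trans (HG i j Gi Gj).
set w := psi B (x i) - psi B (x j); set pw := p (psi B) (x i) - p (psi B) (x j).
apply/ler_addgt0Pr => c c0.
have cw : \sum_(k < m | val k \in B) T k (x i) - \sum_(k < m | val k \in B) T
  k (x j)
    @[m --> \oo] --> w by apply: cvgB; exact: subseriesP.
have [N HN] := (cvgn_rnormP S _ _).1 cw (c / 2) ltac:(by rewrite divr_gt0).
have := HN N (leqnn N); set dN := (\sum_(k < N | _) T k (x i) - _) => dNw.
(* With this code [d r] is the partial sum [dN] close to [w]. Its norming functional agrees on [w]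
   and [pw], so the norm of [w] exceeds that of [pw] by at most [c]. *)
pose r := pickle (i, j, [seq k <- iota 0 N | k \in B]).
have rE : ijl r = (i, j, [seq k <- iota 0 N | k \in B]) by rewrite /ijl pickleK.
have dE : d r = dN.
  have iotaE : iota 0 N = index_iota 0 N by rewrite /index_iota subn0.
  rewrite /d rE /= big_filter /dN -sumrB iotaE.
  by rewrite (big_mkord (fun k => k \in B) (fun k => T k (x i) - T k (x j))).
have phiw : phi r w = phi r pw.
  have /eqP : rnorm (phi r ((p (psi B) (x i) - psi B (x i)) -
      (p (psi B) (x j) - psi B (x j)))) = 0.
    by have := HB r; rewrite /theta rE.
  rewrite rnorm_eq0 => /eqP h.
  apply/eqP; rewrite eq_sym -subr_eq0 -(dual_ballB (phiP r).1) -h.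
  by apply/eqP; congr (phi r _); rewrite /pw /w !opprD !opprK addrACA.
have h1 : rnorm dN <= rnorm (dN - w) + rnorm pw.
  rewrite -dE -(phiP r).2 dE -[dN in phi r dN](subrK w) (dual_ballD (phiP
    r).1) phiw.
  apply: le_trans (ler_rnormD _ _ _) _.
  by apply: lerD; exact: dual_ball_le (phiP r).1 _.
have := ler_rnorm_tri S dN w 0; rewrite !subr0 (rnormB S w); lra.
Qed.

End cauchy.

Lemma summable_tail (a : nat -> R) C : (forall k, 0 <= a k) ->
  (forall m, \sum_(0 <= k < m) a k <= C) ->
  forall e, 0 < e -> exists N, forall m,
    (N <= m)%N -> \sum_(N <= k < m) a k < e.
Proof.
move=> a0 aC e e0; pose A : set R := range (fun m => \sum_(0 <= k < m) a k).
have Asup : has_sup A.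
  split; first by exists (\sum_(0 <= k < 0) a k); exists 0%N.
  by exists C => _ [m _ <-].
have [_ [N _ <-] HN] := sup_adherent e0 Asup.
exists N => m Nm.
have : \sum_(0 <= k < m) a k <= sup A by apply: (ub_le_sup Asup.2); exists m.
by rewrite (big_cat_nat (n := N) (p := m))//=; lra.
Qed.

(** Let [f] be the limit of the thinned norming functionals [phi j]. If all sums for [f] from [N] on
    were at most [eps / 8], then for suitable [i] and [j] the value [phi j (w j)], of modulus at
    least [3 / 4 * eps] by Rosenthal's lemma, would be at most the sum of the distance from [w j] to
    [w i], the distance from [phi j (w i)] to [f (w i)], and the modulus of [f (w i)], each at most
    [eps / 8]. *)
Lemma large_scalar_tails C (T : nat -> X) (x : nat -> E) (eps : R) :
  pointwise_unconditional C T -> (forall k, PK (T k)) ->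
  (forall j, rnorm (x j) <= 1) -> 0 < eps ->
  (forall k, eps <= rnorm (T k (x k))) ->
  exists2 phi, dual_ball S phi & forall N, exists j m,
    eps / 8 < \sum_(N <= k < m) rnorm (phi (T k (x j))).
Proof.
move=> uT TPK x1 e0 Te.
have /choice[phi phiP] j : exists phi : F -> K,
    dual_ball S phi /\ rnorm (phi (T j (x j))) = rnorm (T j (x j)).
  by have [phi dphi phid] := hahn_banach_norming S (T j (x j)); exists phi.
have e4 : 0 < eps / 4 by rewrite divr_gt0.
have e8 : 0 < eps / 8 by rewrite divr_gt0.
have ioT : infinitely_often [set: nat] by move=> N; exists N.
have [||M [_ ioM HM]] := @rosenthal_disjoint R
  (fun j k => rnorm (phi j (T k (x j)))) C _ setT _ _ e4 ioT.
- by move=> j k; exact: rnorm_ge0.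
- by move=> j m; apply: (sum_dual_ball_le uT) => //; exact: (phiP j).1.
have [A [AM ioA HA]] := projection_ultra_cauchy uT TPK x1 ioM.
have [U [UU ooU UA]] := nonprincipal_ultrafilter ioA.
have [f df phif] := ultra_dual_ball UU (fun j => (phiP j).1).
exists f => // N; apply: contrapT => small.
have {}small j m : \sum_(N <= k < m) rnorm (f (T k (x j))) <= eps / 8.
  by rewrite leNgt; apply/negP => lt; apply: small; exists j, m.
(* Dropping the first [N] indices changes the sum by a compact polynomial, so the Cauchy property
   along [U] persists. *)
pose A' := [set k | A k /\ (N <= k)%N].
have AA' k : (N <= k)%N -> (A k <-> A' k) by move=> Nk; split => // -[].
have psiA := subseries_eventually n0 uT AA'.
set Q0 := \sum_(k < N) _ in psiA.
have Q0PK : PK Q0 by apply: compact_polys_sum => k.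
pose w j := subseries n0 uT A' (x j).
have [G UG HG] : exists2 G, U G & forall i j,
  G i -> G j -> rnorm (w i - w j) < eps / 8.
  have e16 : 0 < eps / 16 by rewrite divr_gt0.
  have [G1 UG1 HG1] := HA U UU _ e16.
  have [G2 UG2 HG2] := compact_polys_ultra_cauchy Q0PK x1 UU e16.
  exists (G1 `&` G2); first exact: filterI.
  move=> i j [G1i G2i] [G1j G2j].
  have wE l : w l = subseries n0 uT A (x l) - Q0 (x l).
    by rewrite psiA poly_spaceD addrK.
  have -> : w i - w j = (subseries n0 uT A (x i) - subseries n0 uT A (x j)) -
      (Q0 (x i) - Q0 (x j)) by rewrite !wE !opprD !opprK addrACA.
  apply: le_lt_trans (ler_rnormB _ _ _) _.
  by have := HG1 i j G1i G1j; have := HG2 i j G2i G2j; lra.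
have sumA' (h : nat -> K) m : \sum_(k < m | val k \in A') h k =
    \sum_(N <= k < m | k \in A) h k.
  rewrite big_geq_mkord; apply: eq_bigl => k.
  by apply/idP/andP => [/set_mem[Ak Nk]|[/set_mem Ak Nk]]; [split => //|];
    exact: mem_set.
have fw j : rnorm (f (w j)) <= eps / 8.
  rewrite -[f (w j)]subr0; apply: (subseries_dual_ball_le n0 uT df).
  exists 0%N => m _; rewrite subr0 (sumA' (fun k => f (T k (x j)))).
  apply: le_trans (ler_rnorm_sum _ _ _ _) _; apply: le_trans (small j m).
  rewrite [leLHS]big_mkcond; apply: ler_sum => k _.
  by case: ifP => // _; exact: rnorm_ge0.
have phiw j : A j -> (N <= j)%N -> 3 / 4 * eps <= rnorm (phi j (w j)).
  move=> Aj Nj.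
  have : rnorm (phi j (w j) - phi j (T j (x j))) <= eps / 4.
    apply: (subseries_dual_ball_le n0 uT (phiP j).1); exists j.+1 => m jm.
    rewrite (bigD1 (Ordinal jm)) /=; last by apply/mem_set.
    rewrite addrAC subrr add0r; apply: le_trans (ler_rnorm_sum _ _ _ _) _.
    apply: le_trans (HM j (AM _ Aj) m).
    rewrite [leLHS]big_mkcond [leRHS]big_mkcond; apply: ler_sum => k _.
    case: ifPn => [/andP[/set_mem[Ak _] kj]|_].
      by rewrite -val_eqE /= in kj; rewrite (mem_set (AM _ Ak)) kj.
    by case: ifP => // _; exact: rnorm_ge0.
  have := Te j; rewrite -(phiP j).2.
  have := ler_rnorm_tri S (phi j (w j)) (phi j (T j (x j))) 0.
  rewrite !subr0 (rnormB S (phi j (T j (x j)))); lra.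
have [i Gi] := filter_ex UG.
have Ui : U [set j | rnorm (phi j (w i) - f (w i)) < eps / 8].
  by have /(cvg_rnormP S)/(_ _ e8) := phif (w i).
have UN : U [set j | (N <= j)%N] by apply: ooU; exists N.
have [j [[Gj /= phij] [Aj Nj]]] :=
  filter_ex (filterI (filterI UG Ui) (filterI UA UN)).
have := phiw j Aj Nj; have := fw i.
have := dual_ball_le (phiP j).1 (w j - w i); rewrite (dual_ballB (phiP j).1).
have := HG j i Gj Gi.
have := ler_rnorm_tri S (phi j (w i)) (phi j (w j)) 0.
have := ler_rnorm_tri S (f (w i)) (phi j (w i)) 0.
rewrite !subr0; lra.
Qed.

(** Each [g i] kills the earlier vectors, so the [y i] are [1 / 2]-separated, even when multiplied
    by scalars of modulus at least [1]. *)
Lemma separated_sequence (V : normedModType K) : ~ finite_dimensional V ->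
  exists (y : nat -> V) (g : nat -> V -> K), forall i,
  [/\ dual_ball S (g i), rnorm (y i) <= 1, 2^-1 <= rnorm (g i (y i)) &
      forall l, (l < i)%N -> g i (y l) = 0].
Proof.
move=> infV.
have /choice[nxt nxtP] (L : seq V) : exists fy : (V -> K) * V,
    [/\ dual_ball S fy.1, rnorm fy.2 <= 1, 2^-1 <= rnorm (fy.1 fy.2) &
     forall v, v \in L -> fy.1 v = 0].
  have [f [y [df y1 f0 fy]]] := dual_ball_vanishing S L infV.
  by exists (f, y).
pose L := fix L n : seq V :=
  if n is n'.+1 then (nxt (L n')).2 :: L n' else [::].
exists (fun i => (nxt (L i)).2), (fun i => (nxt (L i)).1) => i.
have [dg y1 gy g0] := nxtP (L i); split => // l li; apply: g0.
elim: i li {dg y1 gy} => [//|i IH]; rewrite ltnS leq_eqVlt /= inE.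
by move=> /predU1P[->|/IH ->]; rewrite ?eqxx ?orbT.
Qed.

(** The series of the polynomials [phi (Q k z) *: y k] converges absolutely. For [l] in [A] its sum
    over [A] at [x l] is within [eta / 16] of the diagonal term. Two diagonal terms are [eta / 2]
    apart, as the later functional [g j] shows, while the sums get within [eta / 16] of each
    other. *)
Lemma no_scalar_family C (phi : F -> K) (Q : nat -> X) (x : nat -> E) (eta :
  R) :
  ~ finite_dimensional F -> dual_ball S phi ->
  (forall m z, rnorm z <= 1 -> \sum_(0 <= k < m) rnorm (phi (Q k z)) <= C) ->
  (forall j, rnorm (x j) <= 1) -> 0 < eta ->
  ~ (forall k, eta <= rnorm (phi (Q k (x k)))).
Proof.
move=> infF dphi QC x1 eta0 Qeta.
have [y [g yg]] := separated_sequence infF.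
have y1 k : rnorm (y k) <= 1 by have [] := yg k.
have /choice[T TP] k : exists P : X, (forall z,
  P z = phi (Q k z) *: y k) /\ PK P.
  by have [P PE PPK] := functional_poly n0 (Q k) (y k) dphi; exists P.
have Tle k z : rnorm (T k z) <= rnorm (phi (Q k z)).
  by rewrite (TP k).1 rnormZ ler_piMr ?rnorm_ge0.
have uT : pointwise_unconditional C T.
  split=> [m xi z xi1 z1|A z z1].
    apply: le_trans (QC m z z1); rewrite big_mkord.
    apply: le_trans (ler_rnorm_sum _ _ _ _) _; apply: ler_sum => k _.
    by apply: le_trans (Tle k z); rewrite rnormZ ler_piMl ?rnorm_ge0.
  apply: (@cauchy_series_cvg _ _ S) => e e0.
  have [N HN] := @summable_tail (fun k => rnorm (phi (Q k z))) C
    (fun k => rnorm_ge0 _ _) (fun m => QC m z z1) e e0.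
  exists N => m Nm; apply: le_lt_trans (HN m Nm).
  rewrite -!(big_mkord (fun k => k \in A) (fun k => T k z)).
  rewrite (big_cat_nat (n := N) (p := m))//= addrAC subrr add0r.
  apply: le_trans (ler_rnorm_sum _ _ _ _) _.
  rewrite [leLHS]big_mkcond; apply: ler_sum => k _.
  by case: ifP => _; [exact: Tle|exact: rnorm_ge0].
have TPK k : PK (T k) := (TP k).2.
have eta16 : 0 < eta / 16 by rewrite divr_gt0.
have ioT : infinitely_often [set: nat] by move=> N; exists N.
have [||M [_ ioM HM]] := @rosenthal_disjoint R
  (fun j k => rnorm (phi (Q k (x j)))) C _ setT _ _ eta16 ioT.
- by move=> j k; exact: rnorm_ge0.
- by move=> j m; rewrite -(big_mkord xpredT (fun k =>
  rnorm (phi (Q k (x j))))); exact: QC.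
have [A [AM ioA HA]] := projection_ultra_cauchy uT TPK x1 ioM.
have [U [UU ooU UA]] := nonprincipal_ultrafilter ioA.
have [G UG HG] := HA U UU _ eta16.
have UGA : U (G `&` A) by exact: filterI.
have ioGA := infinitely_often_ultra (@ultra_proper _ _ UU) ooU UGA.
have [i _ [Gi Ai]] := ioGA 0%N; have [j ij [Gj Aj]] := ioGA i.+1.
have diag l : A l -> rnorm (subseries n0 uT A (x l) - T l (x l)) <= eta / 16.
  move=> Al; apply: (cvg_rnorm_le (@subseriesP _ _ _ _ _ _ _ n0 _ _ uT A (x
    l))).
  exists l.+1 => m lm; rewrite (bigD1 (Ordinal lm)) /=; last exact/mem_set.
  rewrite addrAC subrr add0r; apply: le_trans (ler_rnorm_sum _ _ _ _) _.
  apply: le_trans (HM l (AM _ Al) m).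
  rewrite [leLHS]big_mkcond [leRHS]big_mkcond; apply: ler_sum => k _.
  case: ifPn => [/andP[/set_mem Ak kl]|_].
    by rewrite -val_eqE /= in kl; rewrite (mem_set (AM _ Ak)) kl Tle.
  by case: ifP => // _; exact: rnorm_ge0.
have [dg _ gy g0] := yg j.
have big : eta / 2 <= rnorm (T j (x j) - T i (x i)).
  apply: le_trans (dual_ball_le dg _).
  rewrite (dual_ballB dg) (TP j).1 (TP i).1 !(dual_ballZ dg) (g0 i ij) mulr0
    subr0.
  by rewrite rnormM ler_pM// ?invr_ge0// ltW.
have := HG i j Gi Gj; have := diag i Ai; have := diag j Aj; move: big.
set a := T j (x j); set b := T i (x i); set sa := subseries _ _ _ (x j).
set sb := subseries _ _ _ (x i).
have := ler_rnorm_tri S sa a b; have := ler_rnorm_tri S sb sa b.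
rewrite (rnormB S a sa) (rnormB S sb sa); lra.
Qed.

(** The large tails of [phi] are cut into consecutive blocks, to which [no_scalar_family]
    applies. *)
Lemma no_unconditional_family C (T : nat -> X) (x : nat -> E) (eps : R) :
  ~ finite_dimensional F -> pointwise_unconditional C T ->
  (forall k, PK (T k)) -> (forall j, rnorm (x j) <= 1) -> 0 < eps ->
  ~ (forall k, eps <= rnorm (T k (x k))).
Proof.
move=> infF uT TPK x1 e0 Te.
have [phi dphi tails] := large_scalar_tails uT TPK x1 e0 Te.
have /choice[jm jmP] N : exists jm : nat * nat,
    eps / 8 < \sum_(N <= k < jm.2) rnorm (phi (T k (x jm.1))).
  by have [j [m H]] := tails N; exists (j, m).
pose N := fix N i := if i is i'.+1 then (jm (N i')).2 else 0%N.
have e8 : 0 < eps / 8 by rewrite divr_gt0.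
have NS i : (N i <= N i.+1)%N.
  rewrite leqNgt; apply/negP => lt; have := jmP (N i).
  by rewrite big_geq ?(ltnW lt)//; lra.
(* These phases align the terms of the block at its own point, where its value under [phi] becomes
   the large sum of moduli. *)
pose s i k := phase (phi (T k (x (jm (N i)).1))).
pose Q i : X := \sum_(N i <= k < N i.+1) s i k *: T k.
have phiQ i z : phi (Q i z) = \sum_(N i <= k < N i.+1) s i k * phi (T k z).
  rewrite poly_space_sum (dual_ball_sum dphi); apply: eq_bigr => k _.
  by rewrite poly_spaceZ (dual_ballZ dphi).
apply: (@no_scalar_family C phi Q (fun i => x (jm (N i)).1) (eps / 8)) => //.
- move=> m z z1; apply: le_trans (sum_dual_ball_le uT (N m) dphi z1).
  rewrite -(big_mkord xpredT (fun k => rnorm (phi (T k z)))).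
  elim: m => [|m IH]; first by rewrite !big_geq.
  rewrite big_nat_recr//= (big_cat_nat (leq0n (N m)) (NS m)) /=.
  apply: lerD => //; rewrite phiQ; apply: le_trans (ler_rnorm_sum _ _ _ _) _.
  by apply: ler_sum => k _; rewrite rnormM rnorm_phase mul1r.
- move=> i; apply: le_trans (ltW (jmP (N i))) _.
  rewrite phiQ; under [in leRHS]eq_bigr do rewrite phaseM.
  apply: le_trans (re_le_rnorm _ _); rewrite re_sum.
  by apply: ler_sum.
Qed.

End projection.

(** * Copies of c0 *)

Section c0_copies.
Variables (R : realType) (K : numFieldType) (hK : real_or_complex R K).
Variable S : real_structure R K.
Local Notation rnorm := (rnorm S).

Lemma c0_basis_null k : (fun i : nat => (i == k)%:R : K^o) \in @null_seq K.
Proof.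
apply/asboolP/(cvgn_rnormP S) => e e0; exists k.+1 => i ki.
by rewrite gtn_eqF// subr0 rnorm0.
Qed.

Definition c0_basis k : c0 hK := C0 hK (c0_basis_null k).

Lemma c0_sumE m (xi : nat -> K) i :
  (\sum_(k < m) xi k *: c0_basis k : c0 hK) i = if (i < m)%N then xi i else 0.
Proof.
rewrite (big_morph (fun u : c0 hK => u i : K) (id1 := 0) (op1 := +%R))//.
rewrite (eq_bigr (fun k : 'I_m => xi k * (i == k)%:R : K))//.
elim: m => [|m IH]; first by rewrite big_ord0.
rewrite big_ord_recr /= IH.
have [->|im] := eqVneq i m; first by rewrite ltnn ltnSn mulr1 add0r.
by rewrite ltnS (leq_eqVlt i m) (negbTE im) mulr0 addr0.
Qed.

Lemma c0_rnorm_le (u : c0 hK) C : (forall i, rnorm (u i) <= C) -> rnorm u <= C.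
Proof.
move=> uC; rewrite -rnorm_le_ofR; apply: (sup_norm_le hK); first by exists 0%N.
by move=> i _; rewrite rnorm_le_ofR.
Qed.

Lemma c0_rnorm_ge (u : c0 hK) i : rnorm (u i) <= rnorm u.
Proof.
rewrite -(ler_ofR S) !ofR_rnorm.
exact: (le_sup_norm hK (c0_bounded u) (I : [set: nat] i)).
Qed.

Lemma c0_sum_rnorm_le m (xi : nat -> K) : (forall k, rnorm (xi k) <= 1) ->
  rnorm (\sum_(k < m) xi k *: c0_basis k : c0 hK) <= 1.
Proof.
move=> xi1; apply: c0_rnorm_le => i; rewrite c0_sumE.
by case: ifP => // _; rewrite rnorm0.
Qed.

Lemma c0_basis_rnorm_ge1 k : 1 <= rnorm (c0_basis k).
Proof.
apply: le_trans (c0_rnorm_ge _ k).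
by rewrite -[c0_basis k k]/((k == k)%:R : K) eqxx rnorm1.
Qed.

Lemma nbhs_rnorm (V : normedModType K) (x : V) (A : set V) : nbhs x A ->
  exists2 d, 0 < d & forall y, rnorm (y - x) < d -> A y.
Proof.
move=> /nbhs_normP[e /= e0 eA];
  have re0 : 0 < re S e by rewrite -(ofR_gt0 S) ofR_re ?ltW.
exists (re S e) => // y yx; apply: eA => /=.
by rewrite distrC -(ofR_rnorm S) -[e](@ofR_re _ _ S) ?ltr_ofR// ltW.
Qed.

Lemma continuous_linear_bound (V W : normedModType K) (T : {linear V -> W}) :
  continuous T -> exists C, forall u, rnorm u <= 1 -> rnorm (T u) <= C.
Proof.
move=> cT; have /(cvg_rnormP S)/(_ 1 ltr01) := cT 0.
move=> /nbhs_rnorm[d d0 H]; exists (2 / d) => u u1.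
have Td y : rnorm y < d -> rnorm (T y) < 1.
  by move=> yd; have := H y; rewrite subr0 => /(_ yd);
    rewrite /= (linear0 T) subr0.
have d20 : 0 < d / 2 by rewrite divr_gt0.
have := Td (ofR S (d / 2) *: u); rewrite linearZ /= !rnormZ.
rewrite !rnorm_ofR gtr0_norm// => h.
have : d / 2 * rnorm (T u) < 1 by apply: h; have := rnorm_ge0 S u; nra.
by rewrite ler_pdivlMr//; lra.
Qed.

Variables (n : nat) (E F : completeNormedModType K).
Hypothesis n0 : (0 < n)%N.
Local Notation X := (poly_space hK n E F).
Local Notation PK := (compact_polys hK n E F).

(** The images of the unit vectors of c0: continuity of [T] bounds their combinations, continuity of
    its inverse at [0] bounds them below, and [x k] reaches half of that lower bound. *)
Lemma c0_copy_sequence : contains_copy PK (c0 hK) ->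
  exists (C eps : R) (T : nat -> X) (x : nat -> E), [/\ 0 < eps,
    forall m (xi : nat -> K) x, (forall k, rnorm (xi k) <= 1) -> rnorm x <= 1 ->
      rnorm (\sum_(k < m) xi k *: T k x) <= C,
    forall k, PK (T k),
    forall k, rnorm (x k) <= 1 &
    forall k, eps <= rnorm (T k (x k))].
Proof.
move=> [T [g [TPK _ cT Tg cg]]].
have [C TC] := continuous_linear_bound cT.
have [d d0 gd] : exists2 d, 0 < d & forall u : c0 hK,
  rnorm (T u) < d -> rnorm u < 1.
  have /subspace_continuousP/(_ (T 0)) := cg.
  move=> /(_ (ex_intro2 _ _ 0 I erefl)) /(cvg_rnormP S)/(_ 1 ltr01).
  rewrite /within /= => /nbhs_rnorm[d d0 Hd]; exists d => // u Tu.
  have Tu0 : rnorm (T u - T 0) < d by rewrite (linear0 T) subr0.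
  have : rnorm (g (T u) - g (T 0)) < 1 :=
    Hd (T u) Tu0 (ex_intro2 _ _ u I erefl).
  by rewrite !Tg subr0.
have dT k : d <= rnorm (T (c0_basis k)).
  rewrite leNgt; apply/negP => /gd.
  by rewrite ltNge c0_basis_rnorm_ge1.
have /choice[x xP] k : exists x : E,
  rnorm x <= 1 /\ d / 2 <= rnorm (T (c0_basis k) x).
  apply: contrapT => H; have := dT k; apply/negP; rewrite -ltNge.
  apply: le_lt_trans (_ : d / 2 < d); last by lra.
  apply: poly_space_norm_le => z z1; rewrite leNgt; apply/negP => lt.
  by apply: H; exists z; split => //; exact: ltW.
exists C, (d / 2), (fun k => T (c0_basis k)), x; split.
- by rewrite divr_gt0.
- move=> m xi z xi1 z1.
  apply: le_trans (TC _ (c0_sum_rnorm_le m xi1)); rewrite linear_sum.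
  apply: le_trans (poly_space_le _ z1); rewrite poly_space_sum.
  by under [in leRHS]eq_bigr do rewrite linearZ.
- by move=> k; apply: TPK; exists (c0_basis k).
- by move=> k; have [] := xP k.
- by move=> k; have [] := xP k.
Qed.

End c0_copies.

(** * Blocks of a divergent subseries *)

Section block_sequence.
Variables (R : realType) (K : numFieldType) (S : real_structure R K).
Local Notation rnorm := (rnorm S).

(** By completeness the partial sums are not Cauchy, so consecutive blocks of norm at least [eps]
    exist. A combination of blocks is one of the [v k] with coefficients bounded by [1], hence the
    same [C]. *)
Lemma divergent_subseries_blocks (F : completeNormedModType K) (v : nat -> F)
    (A : set nat) C :
  (forall m (xi : nat -> K), (forall k, rnorm (xi k) <= 1) ->
    rnorm (\sum_(k < m) xi k *: v k) <= C) ->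
  ~ (exists l : F, \sum_(k < m | val k \in A) v k @[m --> \oo] --> l) ->
  exists (y : nat -> F) (eps : R), [/\ 0 < eps, forall i, eps <= rnorm (y i) &
    forall m (xi : nat -> K), (forall k, rnorm (xi k) <= 1) ->
      rnorm (\sum_(i < m) xi i *: y i) <= C].
Proof.
move=> vC div.
have sE m : \sum_(k < m | val k \in A) v k = \sum_(0 <= k < m) (k \in A)%:R
  *: v k.
  rewrite big_mkcond big_mkord; apply: eq_bigr => k _.
  by case: (val k \in A); rewrite ?scale1r ?scale0r.
have [eps [eps0 Heps]] : exists eps, 0 < eps /\ forall N, exists m,
  (N <= m)%N /\
    eps <= rnorm (\sum_(N <= k < m) (k \in A)%:R *: v k).
  apply: contrapT => H; apply: div; apply: (@cauchy_series_cvg _ _ S) => e e0.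
  apply: contrapT => He; apply: H; exists e; split => // N.
  apply: contrapT => HN; apply: He; exists N => m Nm.
  rewrite ltNge; apply/negP => le; apply: HN; exists m; split => //.
  move: le; rewrite !sE (big_cat_nat (n := N) (p := m))//=.
  by rewrite addrAC subrr add0r.
have /choice[nx nxP] := Heps.
pose N := fix N i := if i is i'.+1 then nx (N i') else 0%N.
exists (fun i => \sum_(N i <= k < N i.+1) (k \in A)%:R *: v k), eps;
  split => //.
  by move=> i; exact: (nxP (N i)).2.
move=> m xi xi1.
suff [ze [ze1 ->]] : exists ze : nat -> K, (forall k, rnorm (ze k) <= 1) /\
    \sum_(i < m) xi i *: (\sum_(N i <= k < N i.+1) (k \in A)%:R *: v k) =
    \sum_(k < N m) ze k *: v k by exact: vC.
elim: m => [|m [ze [ze1 IH]]].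
  by exists (fun=> 0); rewrite !big_ord0; split => // k; rewrite rnorm0.
exists (fun k => if (k < N m)%N then ze k else xi m * (k \in A)%:R); split.
  move=> k; case: ifP => // _; rewrite rnormM.
  by case: (k \in A); rewrite ?rnorm1 ?rnorm0 ?mulr1 ?mulr0.
rewrite big_ord_recr /= IH -!(big_mkord xpredT (fun k => _ k *: v k)).
rewrite -(big_mkord xpredT (fun k =>
  (if (k < N m)%N then ze k else xi m * (k \in A)%:R) *: v k)).
rewrite (big_cat_nat (leq0n (N m)) (nxP (N m)).1) /=; congr (_ + _).
  by apply: eq_big_nat => k /andP[_ ->].
rewrite scaler_sumr; apply: eq_big_nat => k /andP[Nk _].
by rewrite ltnNge Nk /= scalerA.
Qed.

End block_sequence.

Theorem proposition3p10 (R : realType) (K : numFieldType)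
    (hK : real_or_complex R K) (E F : completeNormedModType K) (n : nat) :
  (0 < n)%N ->
  ~ finite_dimensional E -> ~ finite_dimensional F ->
  contains_copy (compact_polys hK n E F) (c0 hK) ->
  ~ complemented (compact_polys hK n E F).
Proof.
move=> n0 infE infF copy [p [[D0 pD0] pp rp]].
have [S] := real_structure_ex hK.
have pD Q : rnorm S (p Q) <= rnorm S D0 * rnorm S Q.
  rewrite -(ler_ofR S) rmorphM /= !ofR_rnorm; apply: le_trans (pD0 Q) _.
  have := le_trans (normr_ge0 _) (pD0 Q) => h.
  by rewrite -[D0 * _]ger0_norm// normrM normr_id.
have p_compact Q : compact_polys hK n E F (p Q) by rewrite -rp; exists Q.
have p_id Q : compact_polys hK n E F Q -> p Q = Q.
  by rewrite -rp => -[P _ <-]; exact: pp.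
have [C [eps [T [x [eps0 TC TPK x1 Tx]]]]] := c0_copy_sequence S copy.
have [cvgT|ncvgT] := pselect (forall (A : set nat) x, rnorm S x <= 1 ->
    exists l : F, \sum_(k < m | val k \in A) T k x @[m --> \oo] --> l).
  exact: (no_unconditional_family n0 pD p_compact p_id infF (conj TC cvgT)
    TPK x1 eps0 Tx).
move/existsNP: ncvgT => [A /existsNP[z /not_implyP[z1 div]]].
have [y [e [e0 ye yC]]] :=
  @divergent_subseries_blocks R K S F (fun k => T k z) A C
    (fun m xi xi1 => TC m xi z xi1 z1) div.
have [c [f [x' [c0 df fnull fx']]]] := josefson_nissenzweig S infE.
have /choice[T' T'P] k : exists P : poly_space hK n E F,
    (forall z, P z = f k z ^+ n *: y k) /\ compact_polys hK n E F P.
  by have [P PE PPK] := power_poly hK n0 (y k) (df k); exists P.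
have fn1 k w : rnorm S w <= 1 -> rnorm S (f k w ^+ n) <= 1.
  by move=> w1; rewrite rnormX exprn_ile1 ?rnorm_ge0// (dual_ball_le1 (df k)).
have uT' : pointwise_unconditional S C T'.
  split=> [m xi w xi1 w1|B w w1].
    under eq_bigr do rewrite (T'P _).1 scalerA.
    apply: (yC m (fun k => xi k * f k w ^+ n)) => k;
      rewrite rnormM mulr_ile1 ?rnorm_ge0//; exact: fn1.
  apply: (@cauchy_series_cvg _ _ S) => d d0.
  have C0 : 0 <= C by have :=
    yC 0%N (fun=> 0) (fun=> ltac:(by rewrite rnorm0)); apply: le_trans;
      exact: rnorm_ge0.
  (* Once the values [f k w] are smaller than [t], their powers divided by [t] have modulus at most
     [1]. A tail is then [t] times a combination bounded by [C], and [t * C < d]. *)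
  pose t := Num.min 1 (d / (C + 1)).
  have t0 : 0 < t by rewrite lt_min ltr01 divr_gt0//; lra.
  have t1 : t <= 1 by rewrite ge_min lexx.
  have [N HN] := fnull w t t0; exists N => m Nm.
  rewrite -!(big_mkord (fun k => k \in B) (fun k => T' k w)).
  rewrite (big_cat_nat (n := N) (p := m))//= addrAC subrr add0r.
  pose xi k : K := if (N <= k)%N && (k \in B) then ofR S t^-1 * f k w ^+ n
    else 0.
  have xi1 k : rnorm S (xi k) <= 1.
    rewrite /xi; case: ifP => [/andP[Nk _]|_]; last by rewrite rnorm0.
    rewrite rnormM rnorm_ofR gtr0_norm ?invr_gt0// mulrC ler_pdivrMr// mul1r
      rnormX.
    have h := HN k Nk; rewrite -(prednK n0) exprS.
    apply: le_trans (_ : rnorm S (f k w) <= _); last exact: ltW.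
    by rewrite ler_piMr ?rnorm_ge0// exprn_ile1 ?rnorm_ge0// (dual_ball_le1
      (df k)).
  have -> : \sum_(N <= k < m | k \in B) T' k w = ofR S t *: \sum_(k < m) xi k
    *: y k.
    rewrite big_geq_mkord big_mkcond scaler_sumr; apply: eq_bigr => k _.
    rewrite /xi andbC; case: ifP => _; last by rewrite scale0r scaler0.
    by rewrite (T'P k).1 scalerA mulrA -rmorphM divff ?gt_eqF// rmorph1 mul1r.
  rewrite rnormZ rnorm_ofR gtr0_norm//.
  apply: le_lt_trans (_ : t * C < d); first by rewrite ler_pM2l// yC.
  have : t <= d / (C + 1) by rewrite ge_min lexx orbT.
  by rewrite ler_pdivlMr; nra.
have x'1 k : rnorm S (x' k) <= 1 by have [] := fx' k.
apply: (no_unconditional_family (eps :=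
  c ^+ n * e) n0 pD p_compact p_id infF uT'
  (fun k => (T'P k).2) x'1); first by rewrite mulr_gt0// exprn_gt0.
move=> k; rewrite (T'P k).1 rnormZ rnormX ler_pM//.
- by rewrite exprn_ge0// ltW.
- exact: ltW.
- by rewrite lerXn2r ?nnegrE ?rnorm_ge0 ?(ltW c0)//; have [] := fx' k.
Qed.
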